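(* Let $m,n$ be coprime positive integers, let $z$ be a real number with $1\le z<mn$, and put $r=z/n$, $s=z/m$. Then $$S_{\tau_{r,s}}(q,t,a)=\sum_{k\ge0}\bigl\langle \mathcal{H}_{\tau_{r,s}}(X;q,t),\,h_ke_{\lfloor s\rfloor-k}\bigr\rangle\,a^k,$$ where $\langle\cdot,\cdot\rangle$ is the Hall scalar product on symmetric functions, $h_k,e_k$ are the complete homogeneous and elementary symmetric functions, and $e_j=0$ for $j<0$.
   Context: Partitions and Dyck paths. A partition $\lambda=(\lambda_1\ge\lambda_2\ge\dots)$ is identified with the set of boxes (indexed by northeast corners) $\{(x,y)\in\mathbb{Z}_{\ge1}^2: x\le\lambda_y\}$. The triangular partition $\tau_{r,s}$ is $\{(x,y)\in\mathbb{Z}_{\ge1}^2: x/r+y/s\le1\}$. $\mathrm{D}(r,s)$ is the set of pairs $\pi=(\lambda,\tau_{r,s})$ with $\lambda\subset\tau_{r,s}$ a partition. $\mathrm{area}(\pi)=|\tau_{r,s}|-|\lambda|$. $\mathrm{dinv}(\pi)$ is the number of $\Box\in\lambda$ with $\frac{\mathrm{leg}(\Box)}{\mathrm{arm}(\Box)+1}<\frac sr\le\frac{\mathrm{leg}(\Box)+1}{\mathrm{arm}(\Box)}$, where leg (resp. arm) is the number of boxes of $\lambda$ strictly above in the same column (resp. strictly right in the same row); the right-hand fraction is $+\infty$ if $\mathrm{arm}(\Box)=0$. The symmetric function $\mathcal{H}$. Let $\tilde r=\lfloor r\rfloor+1$. For $\pi=(\lambda,\tau_{r,s})$ let $\tau'_1,\dots,\tau'_{\tilde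 r-1}$ and $\lambda'_1,\dots,\lambda'_{\tilde r-1}$ be the column lengths of $\tau_{r,s}$ and $\lambda$ (padded with zeros), $\tilde\tau=(\lfloor s\rfloor,\tau'_1,\dots,\tau'_{\tilde r-1})$, $\tilde\lambda=(\lfloor s\rfloor,\lambda'_1,\dots,\lambda'_{\tilde r-1})$, $\tilde\lambda_{\tilde r+1}=0$. For $1\le i\le\tilde r$ let $h_i=s-\frac sr(i-1)-\tilde\tau_i$ (these numbers $h_i$ are not the symmetric functions $h_k$), and let $\gamma_i$ be the skew row $(\tilde\tau_i-\tilde\lambda_{i+1})\setminus(\tilde\tau_i-\tilde\lambda_i)$, i.e. the boxes $(x,1)$ with $\tilde\tau_i-\tilde\lambda_i<x\le\tilde\tau_i-\tilde\lambda_{i+1}$. $\nu(\pi)=(\nu_1,\dots,\nu_{\tilde r})$ is obtained from $(\gamma_1,\dots,\gamma_{\tilde r})$ by reordering so that the corresponding values $h_i$ (which are distinct) are increasing. For a tuple $\nu$ of skew shapes of length $p$ fix $\epsilon>0$ with $p\epsilon<1$; a box $\Box\in\nu_j$ with northeast corner $(x,y)$ has content $c(\Box)=x-y+j\epsilon$. Boxes $\Box_1,\Box_2$ are attacking if $0<|c(\Box_1)-c(\Box_2)|<1$. For a semistandard filling $T$ of $\nu$ (each component semistandard: weakly increasing in rows, strictly in columns, entries in $\mathbb{Z}_{\ge0}$), $\mathrm{inv}(T)$ is the number of attacking pairs with $c(\Box_1)<c(\Box_2)$ and $T(\Box_1)>T(\Box_2)$. The LLT polynomial is $\mathcal{G}_\nu(X;t)=\sum_{T}t^{\mathrm{inv}(T)}X^T$.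 With $\omega$ the standard involution ($\omega e_k=h_k$), $$\mathcal{H}_{\tau_{r,s}}(X;q,t)=\sum_{\pi\in \mathrm{D}(r,s)}q^{\mathrm{area}(\pi)}t^{\mathrm{dinv}(\pi)}\,\omega\bigl(\mathcal{G}_{\nu(\pi)}(X;t^{-1})\bigr).$$ Triangular Schröder polynomial. With $\ell=\lfloor z\rfloor$ one has $\tau_{r,s}=\tau_{m,n,\ell}:=\{(x,y)\in\mathbb{Z}_{\ge1}^2:nx+my\le\ell\}$, and $S_{\tau_{r,s}}:=S_{m,n,\ell}$ (which depends only on the partition). Here: $\Gamma_{m,n}=\{nx+my: x,y\in\mathbb{Z}_{\ge0}\}$; $\mathrm{Inv}_{m,n}$ is the set of $\Delta\subset\mathbb{Z}_{\ge0}$ with $\Delta+m,\Delta+n\subset\Delta$; $\overline\Delta=\mathbb{Z}_{\ge0}\setminus\Delta$; $n\text{-}\mathrm{gen}(\Delta)=\{k\in\Delta:k-n\notin\Delta\}$; $\mathrm{cogen}_{\ge0}(\Delta)=\{k\in\mathbb{Z}_{\ge0}\setminus\Delta: k+n,k+m\in\Delta\}$; $\xi_k(\Delta)=|\{x\in n\text{-}\mathrm{gen}(\Delta): n+k+1\le x\le n+k+m\}|$; $\mathrm{area}'(\Delta)=|\overline\Delta\cap\mathbb{Z}_{\ge n+m}|$; $\mathrm{codinv}'(\Delta)=\sum_{x\in n\text{-}\mathrm{gen}(\Delta)}|\overline\Delta\cap\mathbb{Z}_{\ge n+m}\cap[x,x+m-1]|-\binom{\xi_{-1}(\Delta)}{2}$.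 Let $w_i=1$ if $i+mn-\ell-(n+m)\in\Gamma_{m,n}$, $w_i=0$ otherwise ($0\le i\le m+n-1$), and $\mathrm{Inv}_{\mathbf{w}}$ the set of $\Delta\in\mathrm{Inv}_{m,n}$ with, for $0\le i\le m+n-1$, $i\in\Delta$ iff $w_i=1$. Then $$S_{m,n,\ell}(q,t,a)=t^{|\tau_{m,n,\ell}|}\sum_{\Delta\in\mathrm{Inv}_{\mathbf{w}}}q^{\mathrm{area}'(\Delta)}t^{-\mathrm{codinv}'(\Delta)}\prod_{k\in\mathrm{cogen}_{\ge0}(\Delta)}(1+at^{-\xi_k(\Delta)}).$$
   Formalization: The formal theorem adds the hypothesis that the first column of τ_{r,s} has fewer than ⌊s⌋ boxes; without it the identity fails, e.g. m=2, n=1, z=1 gives 1+a on the left and 1 on the right. *)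

(* Defs.v *)
From HB Require Import structures.
From mathcomp Require Import all_boot all_order all_algebra finmap.
From mathcomp Require Import mathcomp_extra boolp classical_sets functions.
From mathcomp Require Import cardinality fsbigop reals.

Set Implicit Arguments.
Unset Strict Implicit.
Unset Printing Implicit Defensive.
Import Order.TTheory GRing.Theory Num.Theory.
Local Open Scope classical_set_scope.
Local Open Scope ring_scope.

(* [fset_set A] is empty when [A] is infinite; every set measured below is
   finite in the intended range of parameters. *)
Definition card (T : choiceType) (A : set T) : nat := #|` fset_set A|%fset.

(** ** Partitions and Dyck paths *)

(* A box is named by its northeast corner (x, y); coordinates start at 1. *)
Notation box := (nat * nat)%type.

Definition tau (R : realType) (r s : R) : set box :=
  [set b | [/\ (1 <= b.1)%N, (1 <= b.2)%N & b.1%:R / r + b.2%:R / s <= 1]].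

(* The value [lam 0] plays no role beyond being at least [lam 1]. *)
Definition is_partition (L : set box) : Prop :=
  exists lam : nat -> nat,
    [/\ {homo lam : x y / (x <= y)%N >-> (y <= x)%N},
        exists N, lam N = 0%N
      & L = [set b | [/\ (1 <= b.1)%N, (1 <= b.2)%N & (b.1 <= lam b.2)%N]]].

(* The pair (L, tau r s) is represented by its first component. *)
Definition Dyck (R : realType) (r s : R) : set (set box) :=
  [set L | is_partition L /\ L `<=` tau r s].

Definition area (R : realType) (r s : R) (L : set box) : nat :=
  (card (tau r s) - card L)%N.

Definition arm (L : set box) (b : box) : nat :=
  card [set c | [/\ L c, c.2 = b.2 & (b.1 < c.1)%N]].
Definition leg (L : set box) (b : box) : nat :=
  card [set c | [/\ L c, c.1 = b.1 & (b.2 < c.2)%N]].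

(* The disjunction encodes that (leg + 1) / 0 is +oo. *)
Definition dinv (R : realType) (r s : R) (L : set box) : nat :=
  card [set b | [/\ L b,
    (leg L b)%:R / ((arm L b)%:R + 1) < s / r
  & arm L b = 0%N \/ s / r <= ((leg L b)%:R + 1) / (arm L b)%:R]].

Definition column_length (L : set box) (i : nat) : nat :=
  card [set b | L b /\ b.1 = i].

(** ** The tuple of skew rows of a path *)

Section SkewRows.
Variables (R : realType) (r s : R).

(* In this section indices i are 1-based, and r, s are positive, so that
   [Num.truncn] is the floor. *)
Definition rtilde : nat := (Num.truncn r).+1.

Definition tautilde (i : nat) : nat :=
  if i == 1%N then Num.truncn s else column_length (tau r s) i.-1.

Definition lamtilde (L : set box) (i : nat) : nat :=
  if i == 1%N then Num.truncn s
  else if (i <= rtilde)%N then column_length L i.-1 else 0%N.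

Definition hgap (i : nat) : R := s - s / r * (i%:R - 1) - (tautilde i)%:R.

(* The natural subtractions do not truncate when L is contained in tau r s. *)
Definition gamma (L : set box) (i : nat) : {fset box} :=
  fset_set [set b | [/\ b.2 = 1%N,
    (tautilde i - lamtilde L i < b.1)%N
  & (b.1 <= tautilde i - lamtilde L i.+1)%N]].

Definition hgap_order : rtilde.-tuple 'I_rtilde :=
  [tuple of sort (fun i j : 'I_rtilde => hgap i.+1 <= hgap j.+1)
                 (ord_tuple rtilde)].

Definition nu_of (L : set box) (j : 'I_rtilde) : {fset box} :=
  gamma L (tnth hgap_order j).+1.

End SkewRows.

(** ** Symmetric functions *)

(* Exponent vectors of monomials in x_0, x_1, x_2, ...  A partition, when it
   indexes symmetric functions, is a weakly decreasing exponent vector. *)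
Notation mon := {fsfun nat -> nat with 0%N}.

Definition is_partn (l : mon) : Prop :=
  {homo l : i j / (i <= j)%N >-> (j <= i)%N}.

Definition mdeg (a : mon) : nat := (\sum_(i <- finsupp a) a i)%N.

(* Formal power series in x_0, x_1, ..., given by their coefficients.  The
   symmetric functions are those that are finite combinations of the [msf l]. *)
Definition series (K : fieldType) := mon -> K.

Section SymmetricFunctions.
Variable K : fieldType.

Definition sone : series K := fun a => (mdeg a == 0%N)%:R.

Definition smul (f g : series K) : series K := fun a =>
  \sum_(b \in [set b : mon * mon | forall i, (b.1 i + b.2 i)%N = a i])
    f b.1 * g b.2.

Definition msf (l : mon) : series K := fun a =>
  (perm_eq [seq a i | i <- finsupp a] [seq l i | i <- finsupp l])%:R.

Definition hsf (k : nat) : series K := fun a => (mdeg a == k)%:R.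

(* The index is an integer: [esf j] is the zero series for j < 0. *)
Definition esf (j : int) : series K := fun a =>
  (((mdeg a)%:Z == j) && all (fun i => a i == 1%N) (finsupp a))%:R.

Definition hsf_part (l : mon) : series K :=
  \big[smul/sone]_(i <- finsupp l) hsf (l i).
Definition esf_part (l : mon) : series K :=
  \big[smul/sone]_(i <- finsupp l) esf (l i)%:Z.

(* Coordinates of a symmetric function f in a basis B of the symmetric
   functions indexed by partitions; the zero vector if f has no finite
   expansion. *)
Definition coord (B : mon -> series K) (f : series K) :
    {fsfun mon -> K with 0} :=
  xget [fsfun] [set c : {fsfun mon -> K with 0} |
    (forall l, l \in finsupp c -> is_partn l) /\
    (forall a, f a = \sum_(l <- finsupp c) c l * B l a)].

(* The algebra involution exchanging e_k and h_k, i.e. the linear map sending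
   the basis (e_l) to (h_l). *)
Definition omega (f : series K) : series K := fun a =>
  \sum_(l <- finsupp (coord esf_part f)) coord esf_part f l * hsf_part l a.

(* The bilinear form for which (m_l) and (h_l) are dual bases. *)
Definition hall (f g : series K) : K :=
  \sum_(l <- finsupp (coord hsf_part g)) coord msf f l * coord hsf_part g l.

End SymmetricFunctions.

(** ** LLT polynomials *)

Section LLT.
Variables (R : realType) (eps : R) (p : nat) (nu : 'I_p -> {fset box}).

(* Boxes of the tuple nu; components are numbered from 1 in the content. *)
Definition tbox : finType := {j : 'I_p & nu j}.
Definition tcomp (u : tbox) : 'I_p := tag u.
Definition tcorner (u : tbox) : box := fsval (tagged u).

Definition content (u : tbox) : R :=
  (tcorner u).1%:R - (tcorner u).2%:R + (tcomp u).+1%:R * eps.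

Definition attacking (u v : tbox) : bool :=
  0 < `|content u - content v| < 1.

Definition semistandard (T : {ffun tbox -> nat}) : Prop :=
  forall u v : tbox, tcomp u = tcomp v ->
    ((tcorner u).2 = (tcorner v).2 ->
     ((tcorner u).1 <= (tcorner v).1)%N -> (T u <= T v)%N) /\
    ((tcorner u).1 = (tcorner v).1 ->
     ((tcorner u).2 < (tcorner v).2)%N -> (T u < T v)%N).

Definition inv_filling (T : {ffun tbox -> nat}) : nat :=
  #|[set uv : tbox * tbox | [&& attacking uv.1 uv.2,
      content uv.1 < content uv.2 & (T uv.2 < T uv.1)%N]]%SET|.

(* X^T is the monomial with exponent vector a. *)
Definition has_weight (T : {ffun tbox -> nat}) (a : mon) : Prop :=
  forall i : nat, #|[set u | T u == i]%SET| = a i.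

Definition LLT (K : fieldType) (t : K) : series K := fun a =>
  \sum_(T \in [set T | semistandard T /\ has_weight T a]) t ^+ inv_filling T.

End LLT.

Definition Hfun (R : realType) (r s eps : R) (K : fieldType) (q t : K) :
    series K := fun a =>
  \sum_(L \in Dyck r s)
    q ^+ area r s L * t ^+ dinv r s L *
    omega (LLT eps (@nu_of R r s L) t^-1) a.

(** ** The triangular Schroeder polynomial *)

Section Schroeder.
Variables m n : nat.

Definition tau_mnl (l : nat) : set box :=
  [set b | [/\ (1 <= b.1)%N, (1 <= b.2)%N & (n * b.1 + m * b.2 <= l)%N]].

Definition Gamma : set int :=
  [set v | exists x y : nat, v = (n * x + m * y)%N%:Z].

Definition Inv : set (set int) :=
  [set D | [/\ forall k, D k -> 0 <= k,
               forall k, D k -> D (k + m%:Z)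
             & forall k, D k -> D (k + n%:Z)]].

Definition gaps (D : set int) : set int := [set k | 0 <= k /\ ~ D k].

Definition ngen (D : set int) : set int := [set k | D k /\ ~ D (k - n%:Z)].

Definition cogen (D : set int) : set int :=
  [set k | [/\ gaps D k, D (k + n%:Z) & D (k + m%:Z)]].

Definition xi (D : set int) (k : int) : nat :=
  card [set x | ngen D x /\ n%:Z + k + 1 <= x <= n%:Z + k + m%:Z].

Definition area' (D : set int) : nat :=
  card [set k | gaps D k /\ n%:Z + m%:Z <= k].

Definition codinv' (D : set int) : int :=
  \sum_(x \in ngen D)
    (card [set k | [/\ gaps D k, n%:Z + m%:Z <= k
                     & x <= k <= x + m%:Z - 1]])%:Z
  - ('C(xi D (-1), 2))%:Z.

Definition InvW (l : nat) : set (set int) :=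
  [set D | Inv D /\
    forall i : int, 0 <= i <= m%:Z + n%:Z - 1 ->
      (D i <-> Gamma (i + m%:Z * n%:Z - l%:Z - (n%:Z + m%:Z)))].

(* A polynomial in a = 'X. *)
Definition Schroeder (l : nat) (K : fieldType) (q t : K) : {poly K} :=
  (t ^+ card (tau_mnl l))%:P *
  \sum_(D \in InvW l)
    (q ^+ area' D * t ^ (- codinv' D))%:P *
    \big[*%R/1]_(k \in cogen D) (1 + (t ^- xi D k)%:P * 'X).

End Schroeder.

(** ** The coefficient field Q(q, t), as the fraction field of Q[q][t] *)

Definition Qqt : fieldType := {fraction {poly {poly rat}}}.
Definition qvar : Qqt := tofrac ('X%:P : {poly {poly rat}}).
Definition tvar : Qqt := tofrac ('X : {poly {poly rat}}).

(* Main.v *)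
(* Row LLT polynomials are sums over colourings of an indifference graph, with
   weak inequalities imposed on the pairs of horizontally adjacent boxes.  The
   modular law for twin vertices and lexicographic induction reduce these graphs
   to paths, whose colour sums are explicit combinations of products of
   elementary functions; all of this holds verbatim over super-alphabets.  The
   generating function of the pairings of the omega-image with h_k e_(N-k) is
   therefore the colour sum over the two-letter super-alphabet with weights 1
   and a, the second letter being odd, and there it factorizes over the vertices.

   On the other side a partition in tau is sent to the semimodule Delta made of
   the labels l + n + m - n x - m y of its boxes and of a shifted copy of Gamma.
   The rows of the partition give the n-generators of Delta, and two boxes of nu
   attack each other iff the labels of their rows differ by less than m; the
   cogenerators are the rows whose box comes last in its skew row, so the two
   products agree.  That no cogenerator comes from a row above tau is where the
   first column of tau must be shorter than floor(s).  Finally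
   dinv + codinv' = |lambda| + area' by telescoping the number of steps along
   the boundary path of lambda. *)
Require Import Defs.
From mathcomp Require Import all_boot all_order all_algebra all_fingroup finmap.
From mathcomp Require Import mathcomp_extra boolp classical_sets functions.
From mathcomp Require Import cardinality fsbigop reals.
From mathcomp Require Import mpoly.
From mathcomp Require Import ring lra zify.
Set Implicit Arguments.
Unset Strict Implicit.
Unset Printing Implicit Defensive.
Import Order.TTheory GRing.Theory Num.Theory.
Local Open Scope classical_set_scope.
Local Open Scope ring_scope.

(** * Colour sums and modular laws *)

(** Evaluation at a super-alphabet replaces plethysm. An expansion into products of e_p whose
    coefficients do not depend on the alphabet holds for symmetric polynomials and for the two
    letters of weights 1 and a alike, and on the latter e_p becomes a^p + a^(p-1). The pairing
    produces the same factor: omega sends e_p to h_p, pairing with h_l reads a monomial coefficient,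
    and in h_k e_(N-k) each part p leaves p or p - 1 to h_k.

    The obstacle is that [coord] selects some expansion, and its definition gives no uniqueness.
    Uniqueness is established for monomials; for the h_l and e_l it is bypassed, because the
    matrices of monomial coefficients of the h_l and of the e_l are symmetric, so that the pairings
    do not depend on the coordinates selected.

    The modular law exchanges the colours of two twins and needs 2 invertible; its dual form divides
    by 1 + t, and removing a weak inequality divides by 1 - t. With t^-1 in the place of t these are
    nonzero in Q(q, t). *)

(* Off the diagonal [gt] is a strict total order; [gt a a] is free, and is true
   exactly for the letters treated as odd ("super") variables. *)
Definition superorder (A : finType) (gt : rel A) : Prop :=
  (forall a b, a != b -> gt a b = ~~ gt b a) /\ transitive gt.

Section Colorings.
Variables (K : fieldType) (B : comAlgType K) (A : finType).
Variables (gt : rel A) (wt : A -> B) (t : K).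

Definition colsum (V : finType) (E : rel V) : B :=
  \sum_(k : {ffun V -> A})
    (\prod_(p : V * V) (if E p.1 p.2 && gt (k p.1) (k p.2) then t%:A else 1)) *
    \prod_x wt (k x).

(* [chain k] sums over the words of length k in which [gt] holds between
   neighbours: it is e_k for the strict order and h_k for the weak one. *)
Fixpoint chain_to (k : nat) (c : A) : B :=
  if k is k'.+1 then (\sum_(b | gt b c) chain_to k' b) * wt c else wt c.

Definition chain (k : nat) : B :=
  if k is k'.+1 then \sum_c chain_to k' c else 1.

Lemma eq_colsum (V : finType) (E E' : rel V) :
  E =2 E' -> colsum E = colsum E'.
Proof.
move=> eqE; apply: eq_bigr => k _; congr (_ * _).
by apply: eq_bigr => p _; rewrite eqE.
Qed.

Hypothesis gt_super : superorder gt.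
Hypothesis two_neq0 : 2%:R != 0 :> K.

(** Exchanging the colours of p and q is an involution on colourings, so the hypothesis makes twice
    the sum vanish. *)
Lemma swap_sum0 (V : finType) (p q : V) (F : {ffun V -> A} -> B) :
  (forall k : {ffun V -> A}, F k + F [ffun x => k (tperm p q x)] = 0) ->
  \sum_k F k = 0.
Proof.
move=> F0.
have swapK : involutive (fun k : {ffun V -> A} => [ffun x => k (tperm p q x)]).
  by move=> k; apply/ffunP => x; rewrite !ffunE tpermK.
have : 2%:R *: (\sum_k F k) = 0.
  rewrite scaler_nat mulr2n {2}(reindex_inj (inv_inj swapK)) /= -big_split /=.
  by rewrite big1.
by move/eqP; rewrite scaler_eq0 (negPf two_neq0) => /eqP.
Qed.

Lemma swap_prod (V : finType) (p q : V) (E0 : rel V) (k : {ffun V -> A}) :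
  (forall x y, E0 (tperm p q x) (tperm p q y) = E0 x y) ->
  \prod_(z : V * V) (if E0 z.1 z.2 &&
       gt ([ffun x => k (tperm p q x)] z.1) ([ffun x => k (tperm p q x)] z.2)
     then t%:A else 1) =
  \prod_(z : V * V) (if E0 z.1 z.2 && gt (k z.1) (k z.2) then t%:A else 1) :> B.
Proof.
move=> E0s; pose s (z : V * V) := (tperm p q z.1, tperm p q z.2).
have sK : involutive s by case=> x y; rewrite /s /= !tpermK.
rewrite [RHS](reindex_inj (inv_inj sK)) /=; apply: eq_bigr => -[x y] _ /=.
by rewrite !ffunE E0s.
Qed.

Lemma swap_wt (V : finType) (p q : V) (k : {ffun V -> A}) :
  \prod_x wt ([ffun x => k (tperm p q x)] x) = \prod_x wt (k x).
Proof.
rewrite [RHS](reindex_inj (@perm_inj _ (tperm p q))) /=.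
by apply: eq_bigr => x _; rewrite ffunE.
Qed.

(** Isolates the factors of the displayed edges, which leaves a case analysis on the colours of
    three vertices. *)
Lemma colsum_split (V : finType) (E0 E : rel V) (S : seq (V * V)) :
  uniq S -> (forall z, z \in S -> ~~ E0 z.1 z.2) ->
  E =2 (fun x y => E0 x y || ((x, y) \in S)) ->
  colsum E = \sum_(k : {ffun V -> A})
    (\prod_(z : V * V) (if E0 z.1 z.2 && gt (k z.1) (k z.2) then t%:A else 1)) *
    (\prod_(z <- S) (if gt (k z.1) (k z.2) then t%:A else 1)) *
    \prod_x wt (k x).
Proof.
move=> uS S0 eqE; apply: eq_bigr => k _; congr (_ * _).
rewrite (big_uniq _ uS) /= [X in _ * X]big_mkcond /= -big_split /=.
apply: eq_bigr => -[x y] _; rewrite eqE /=.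
case: ifP => //; case: (boolP ((x, y) \in S)) => [/S0 /= /negPf -> | _];
  rewrite ?orbF ?orbT /=; do ?[by move->; rewrite ?mul1r ?mulr1|by rewrite ?mulr1].
Qed.

Definition adjoin (V : finType) (E0 : rel V) (S : seq (V * V)) : rel V :=
  fun x y => E0 x y || ((x, y) \in S).

(* Away from the displayed edges p and q are twins, and exchanging their colours
   turns each summand of the difference of the two sides into its opposite. *)
Lemma modular_right (V : finType) (p q c : V) (E0 : rel V) :
  p != q -> c != p -> c != q ->
  ~~ E0 p q -> ~~ E0 c p -> ~~ E0 c q ->
  (forall x y, E0 (tperm p q x) (tperm p q y) = E0 x y) ->
  colsum (adjoin E0 [:: (p, q); (c, p); (c, q)]) +
    t *: colsum (adjoin E0 [:: (p, q)]) =
  (1 + t) *: colsum (adjoin E0 [:: (p, q); (c, p)]).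
Proof.
move=> npq ncp ncq Epq Ecp Ecq E0s.
have [gt_tot gt_tr] := gt_super.
rewrite !(@colsum_split _ E0 _ _ _ _ (fun _ _ => erefl)); first last.
all: try by move=> z; rewrite !inE => /or3P[] /eqP->.
all: try by move=> z; rewrite !inE => /orP[] /eqP->.
all: try by move=> z; rewrite !inE => /eqP->.
all: rewrite /= ?inE ?xpair_eqE ?(negPf npq) ?(negPf ncp) ?(negPf ncq) ?andbF
  ?(eq_sym p c) ?(negPf ncp) //=.
apply/eqP; rewrite -subr_eq0; apply/eqP.
rewrite !scaler_sumr -big_split /= -sumrB; apply: (swap_sum0 (p := p) (q := q)) => k.
rewrite !(swap_prod _ E0s) swap_wt.
set C := \prod_(z : V * V) _; set w := \prod_x wt _.
rewrite !big_cons !big_nil /= !ffunE.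
rewrite tpermL tpermR tpermD 1?eq_sym //.
set T := t%:A; have sE x : t *: x = T * x by rewrite mulr_algl.
rewrite !(scalerDl _ _ t) !scale1r !sE; move: T {sE} => T.
set a := k p; set b := k q; set d := k c.
(* For equal colours the summand is a multiple of (y - 1)(y - T), where y, the factor of the pair
   (d, b), is 1 or T. *)
have [ab | nab] := eqVneq a b.
  by rewrite ab; case: (gt b b); case: (gt d b); rewrite ?mulr1 ?mul1r; ring.
(* Transitivity excludes the colour patterns on which the identity would fail. *)
have := gt_tr a d b; have := gt_tr b d a.
rewrite (gt_tot _ _ nab).
case: (gt b a); case: (gt d b); case: (gt d a) => /= h1 h2;
  by [ring | move: h1 => /(_ isT isT) | move: h2 => /(_ isT isT)].
Qed.

(** Mirror image of [modular_right]: the third vertex comes after the twins, and the intermediate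
    graph keeps its edge from q. *)
Lemma modular_left (V : finType) (p q c : V) (E0 : rel V) :
  p != q -> c != p -> c != q ->
  ~~ E0 p q -> ~~ E0 p c -> ~~ E0 q c ->
  (forall x y, E0 (tperm p q x) (tperm p q y) = E0 x y) ->
  colsum (adjoin E0 [:: (p, q); (q, c); (p, c)]) +
    t *: colsum (adjoin E0 [:: (p, q)]) =
  (1 + t) *: colsum (adjoin E0 [:: (p, q); (q, c)]).
Proof.
move=> npq ncp ncq Epq Ecp Ecq E0s.
have [gt_tot gt_tr] := gt_super.
rewrite !(@colsum_split _ E0 _ _ _ _ (fun _ _ => erefl)); first last.
all: try by move=> z; rewrite !inE => /or3P[] /eqP->.
all: try by move=> z; rewrite !inE => /orP[] /eqP->.
all: try by move=> z; rewrite !inE => /eqP->.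
all: rewrite /= ?inE ?xpair_eqE ?(eq_sym q c) ?(negPf npq) ?(negPf ncp)
  ?(negPf ncq) ?(eq_sym q p) ?(negPf npq) ?andbF //=.
apply/eqP; rewrite -subr_eq0; apply/eqP.
rewrite !scaler_sumr -big_split /= -sumrB; apply: (swap_sum0 (p := p) (q := q)) => k.
rewrite !(swap_prod _ E0s) swap_wt.
set C := \prod_(z : V * V) _; set w := \prod_x wt _.
rewrite !big_cons !big_nil /= !ffunE.
rewrite tpermL tpermR tpermD 1?eq_sym //.
set T := t%:A; have sE x : t *: x = T * x by rewrite mulr_algl.
rewrite !(scalerDl _ _ t) !scale1r !sE; move: T {sE} => T.
set a := k p; set b := k q; set d := k c.
have [ab | nab] := eqVneq a b.
  by rewrite ab; case: (gt b b); case: (gt b d); rewrite ?mulr1 ?mul1r; ring.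
have := gt_tr b a d; have := gt_tr a b d.
rewrite (gt_tot _ _ nab).
case: (gt b a); case: (gt b d); case: (gt a d) => /= h1 h2;
  by [ring | move: h1 => /(_ isT isT) | move: h2 => /(_ isT isT)].
Qed.

End Colorings.

(** * Expansions into elementary functions, uniform in the super-alphabet *)

Definition functional (K : fieldType) : Type :=
  forall (B : comAlgType K) (A : finType), rel A -> (A -> B) -> B.

(* The coefficients [cs] do not depend on the super-alphabet, so an expansion
   into elementary functions can be evaluated at {0 < 1} with 1 odd. *)
Definition expands (K : fieldType) (n : nat) (F : functional K) : Prop :=
  exists2 cs : seq (K * seq nat), all (fun c => sumn c.2 == n) cs &
  forall (B : comAlgType K) (A : finType) (gt : rel A) (wt : A -> B),
    superorder gt ->
    F B A gt wt = \sum_(c <- cs) c.1 *: \prod_(k <- c.2) chain gt wt k.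

Section Expansion.
Variable K : fieldType.

Lemma expands_ext n (F G : functional K) :
  (forall (B : comAlgType K) (A : finType) (gt : rel A) (wt : A -> B),
    superorder gt -> G B A gt wt = F B A gt wt) ->
  expands n F -> expands n G.
Proof.
by move=> FG [cs ? e]; exists cs => // B A gt wt s; rewrite FG ?e.
Qed.

Lemma expands_lin n (a b : K) (F G : functional K) :
  expands n F -> expands n G ->
  expands n (fun B A gt wt => a *: F B A gt wt + b *: G B A gt wt).
Proof.
move=> [c1 h1 e1] [c2 h2 e2].
exists ([seq (a * c.1, c.2) | c <- c1] ++ [seq (b * c.1, c.2) | c <- c2]).
  by rewrite all_cat !all_map; apply/andP; split.
move=> B A gt wt s; rewrite big_cat !big_map /= e1 // e2 // !scaler_sumr.
by congr (_ + _); apply: eq_bigr => c _; rewrite scalerA.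
Qed.

Variable t : K.
Hypothesis two_neq0 : 2%:R != 0 :> K.
Hypothesis t1_neq0 : 1 + t != 0.

(** * Indifference graphs as Dyck paths: f x is the last neighbour of x *)

Definition dyck_graph n (f : nat -> nat) : rel 'I_n := fun x y => (x < y <= f x)%N.

Definition dyck_fun n (f : nat -> nat) : Prop :=
  (forall i, (i < n)%N -> (i <= f i < n)%N) /\
  (forall i j, (i <= j < n)%N -> (f i <= f j)%N).

Definition upd (f : nat -> nat) (u v i : nat) := if i == u then v else f i.

Definition dyck_expands n f :=
  expands n (fun B A gt wt => colsum (B := B) gt wt t (@dyck_graph n f)).

(** Away from the edges at u, [v.+1] and [v.+2] are twins: vertices before u reach neither, those
    between u and [v.+1] reach both because f is monotone, and the two have the same last
    neighbour. *)
Lemma dyck_law_right n f u v : dyck_fun n f -> (u < n)%N -> f u = v.+2 ->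
  (u <= v)%N -> (forall w, (w < u)%N -> (f w <= v)%N) -> f v.+1 = f v.+2 ->
  dyck_expands n (upd f u v.+1) -> dyck_expands n (upd f u v) ->
  dyck_expands n f.
Proof.
move=> [fr fm] un fu uv fw fv h1 h2.
have vn : (v.+2 < n)%N by rewrite -fu; have /andP[] := fr _ un.
have vn1 : (v.+1 < n)%N by lia.
pose p := Ordinal vn1; pose q := Ordinal vn; pose c := Ordinal un.
pose E0 : rel 'I_n := fun x y =>
  dyck_graph f x y && ((x, y) \notin [:: (p, q); (c, p); (c, q)]).
have dE : forall x y, adjoin E0 [:: (p, q); (c, p); (c, q)] x y = dyck_graph f x y.
  move=> x y; rewrite /adjoin /E0; case: (boolP (_ \in _)) => [|_]; last first.
    by rewrite andbT orbF.
  rewrite orbT !inE !xpair_eqE /dyck_graph => /or3P[] /andP[/eqP-> /eqP->] /=;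
    rewrite ?fu; last by lia.
  - by have := fr _ vn1; have := fr _ vn; rewrite fv; lia.
  - by lia.
apply: expands_ext (expands_lin (1 + t) (- t) h1 h2) => B A gt wt gs.
rewrite -(eq_colsum _ _ _ dE).
rewrite -[LHS](addrK (t *: colsum gt wt t (adjoin E0 [:: (p, q)]))).
rewrite modular_right //; try by rewrite /E0 !inE !eqxx ?orbT andbF.
- rewrite scaleNr; congr (_ *: _ - _ *: _); apply: eq_colsum => x y;
  rewrite /adjoin /E0 /dyck_graph /upd !inE !xpair_eqE -!val_eqE /=;
  have := fr _ (ltn_ord x); have := fr _ vn; have := fr _ vn1; move: (fm x y) (fm y x) (ltn_ord x) (ltn_ord y) (fm x u) (fm u x);
  by case: (eqVneq (val x) u) => [->|?]; rewrite ?fu; lia.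
- by rewrite -val_eqE /=; lia.
- by rewrite -val_eqE /=; lia.
- by rewrite -val_eqE /=; lia.
move=> x y; rewrite /E0 /dyck_graph !inE !xpair_eqE -!val_eqE /=.
have X (x : 'I_n) := (fw x, fm u x, ltn_ord x).
have Fx := X x; have Fy := X y.
case: tpermP => [->|->|/eqP + /eqP]; case: tpermP => [->|->|/eqP + /eqP];
  rewrite -?val_eqE /= ?fv;
  by move: Fx Fy (fm u v.+2) (fr _ vn) => [[? ?] ?] [[? ?] ?]; lia.
Qed.

(** Here f is the intermediate graph of [modular_left] for the twins v and [v.+1], and the law is
    solved for it by dividing by 1 + t. No earlier vertex has v as its last neighbour, hence each
    sees both twins or neither. *)
Lemma dyck_law_left n f v c : dyck_fun n f -> (v.+1 < n)%N ->
  f v = c -> f v.+1 = c.+1 -> (v < c)%N ->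
  (forall w, (w < v)%N -> f w != v) ->
  dyck_expands n (upd f v c.+1) -> dyck_expands n (upd f v.+1 c) ->
  dyck_expands n f.
Proof.
move=> [fr fm] vn fv fv1 vc fw h1 h2.
have cn : (c.+1 < n)%N by rewrite -fv1; have /andP[] := fr _ vn.
have vn1 : (v < n)%N by lia.
pose p := Ordinal vn1; pose q := Ordinal vn; pose d := Ordinal cn.
pose E0 : rel 'I_n := fun x y =>
  dyck_graph f x y && ((x, y) \notin [:: (p, q); (q, d); (p, d)]).
have dE : forall x y, adjoin E0 [:: (p, q); (q, d)] x y = dyck_graph f x y.
  move=> x y; rewrite /adjoin /E0 !inE !xpair_eqE /dyck_graph -!val_eqE /=.
  case: (eqVneq (val x) v) => [->|?]; rewrite ?fv; first by lia.
  by case: (eqVneq (val x) v.+1) => [->|?]; rewrite ?fv1; lia.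
apply: expands_ext (expands_lin ((1 + t)^-1) (t / (1 + t)) h1 h2) => B A gt wt gs.
rewrite -(eq_colsum _ _ _ dE).
have -> : colsum gt wt t (adjoin E0 [:: (p, q); (q, d)]) =
  (1 + t)^-1 *: ((1 + t) *: colsum gt wt t (adjoin E0 [:: (p, q); (q, d)])).
  by rewrite scalerA mulVf // scale1r.
rewrite -modular_left //; try by rewrite /E0 !inE !eqxx ?orbT andbF.
- rewrite scalerDr scalerA (mulrC t); congr (_ *: _ + _ *: _);
  apply: eq_colsum => x y; rewrite /adjoin /E0 /dyck_graph /upd !inE !xpair_eqE -!val_eqE /=;
  (case: (eqVneq (val x) v) => [->|?];
    [rewrite ?fv | case: (eqVneq (val x) v.+1) => [->|?]; rewrite ?fv1]);
  by rewrite ?if_same; lia.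
- by rewrite -val_eqE /=; lia.
- by rewrite -val_eqE /=; lia.
- by rewrite -val_eqE /=; lia.
move=> x y; rewrite /E0 /dyck_graph !inE !xpair_eqE -!val_eqE /=.
have X (x : 'I_n) := (fw x, fm v x, fm v.+1 x, fm x v, ltn_ord x).
have Fx := X x; have Fy := X y.
case: tpermP => [->|->|/eqP + /eqP]; case: tpermP => [->|->|/eqP + /eqP];
  rewrite -?val_eqE /= ?fv ?fv1;
  by move: Fx Fy => [[[[? ?] ?] ?] ?] [[[[? ?] ?] ?] ?]; lia.
Qed.

(** The values of f as base-n digits, [f 0] leading, so that lexicographic induction becomes
    induction on a number. *)
Fixpoint lexcode (n : nat) (f : nat -> nat) (k : nat) : nat :=
  if k is k'.+1 then lexcode n f k' * n + f k' else 0.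

Lemma lexcode_lt n f g u k : (u < k)%N ->
  (forall i, (i < u)%N -> f i = g i) -> (f u < g u)%N ->
  (forall i, (i < k)%N -> (f i < n)%N) -> (lexcode n f k < lexcode n g k)%N.
Proof.
move=> + eqfg ltfg; elim: k => // k IH; rewrite ltnS leq_eqVlt => /orP[/eqP <- _ | uk lim] /=.
  have -> : lexcode n f u = lexcode n g u.
    by elim: u eqfg {ltfg IH} => //= u IHu e; rewrite IHu ?e // => i iu; apply: e; lia.
  by rewrite ltn_add2l.
have /IH lt : (u < k)%N by []; have := lim k (leqnn _).
have {}lt : (lexcode n f k < lexcode n g k)%N by apply: lt => i ik; apply: lim; lia.
have : ((lexcode n f k).+1 * n <= lexcode n g k * n)%N by rewrite leq_mul2r lt orbT.
by rewrite mulSn; lia.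
Qed.

(* Lowering [f u] by the modular law at u requires [f v.+1 = f v.+2] for
   [v.+2 = f u].  A gap of one there is removed by the dual law; a larger gap
   makes [v.+2] a vertex of the same kind as u, and the argument restarts. *)
Lemma dyck_bounce n f u : dyck_fun n f -> (u < n)%N -> (u.+2 <= f u)%N ->
  (forall w, (w < u)%N -> (f w + 2 <= f u)%N) ->
  (forall g, dyck_fun n g -> (lexcode n g n < lexcode n f n)%N -> dyck_expands n g) ->
  dyck_expands n f.
Proof.
elim: {u}(n - u)%N {-2}u (leqnn (n - u)) => [|k IH] u; first by lia.
move=> nu Hf un fu fw IHg; have [fr fm] := Hf.
case Ev : (f u) (fu) => [//|[//|v]] uv; have /andP[_ vn] := fr _ un; rewrite Ev in vn.
have fw' w : (w < u)%N -> (f w <= v)%N by move/fw; rewrite Ev; lia.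
have fv1 := fm v.+1 v.+2; have fuv := fm u v.+1; have fvr := fr v.+2; have fv1r := fr v.+1.
(* Beyond u the function g may exceed f, as one of the two graphs of the dual law does; lowering its
   value at u still brings it below f lexicographically. *)
have red : forall g, dyck_fun n g -> (forall i, (i <= u)%N -> g i = f i) ->
    g v.+1 = g v.+2 -> dyck_expands n g.
  move=> g Hg eqg gv; have [gr gm] := Hg.
  have gu : g u = v.+2 by rewrite eqg ?Ev.
  have gw w : (w < u)%N -> (g w <= v)%N by move=> wu; rewrite eqg; [exact: fw'|lia].
  have ok e : (v <= e <= v.+1)%N -> dyck_expands n (upd g u e).
    move=> er; apply: IHg.
      split=> [i|i j]; rewrite /upd.
        by move: (gr i); case: eqP => [->|_]; lia.
      move: (gm i j) (gm u j) (gw i); case: (eqVneq i u) => [->|?];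
      case: (eqVneq j u) => [->|?]; rewrite ?gu; by lia.
    apply: (@lexcode_lt _ _ _ u) => //.
    - by move=> i iu; rewrite /upd ifF ?eqg; lia.
    - by rewrite /upd eqxx Ev; lia.
    - by move=> i /gr; rewrite /upd; case: eqP; lia.
  by apply: (@dyck_law_right n g u v) => //; apply: ok; lia.
have [e|ne] := eqVneq (f v.+1) (f v.+2); first exact: red.
have [e|ne2] := eqVneq (f v.+2) (f v.+1).+1.
  apply: (@dyck_law_left n f v.+1 (f v.+1)) => //.
  - by lia.
  - move=> w wv; case: (ltngtP w u) => wu.
    + by have := fw' _ wu; lia.
    + by have := fm u w; lia.
    + by rewrite wu Ev; lia.
  - apply: red.
    + split=> [i|i j]; rewrite /upd.
        by move: (fr i); case: eqP => [->|_]; lia.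
      move: (fm i j) (fm i v.+1) (fm v.+2 j); case: (eqVneq i v.+1) => [->|?];
      case: (eqVneq j v.+1) => [->|?]; by lia.
    + by move=> i iu; rewrite /upd ifF //; lia.
    + by rewrite /upd eqxx ifF //; lia.
  - apply: red.
    + split=> [i|i j]; rewrite /upd.
        by move: (fr i); case: eqP => [->|_]; lia.
      move: (fm i j) (fm i v.+1) (fm v.+1 j) (fm v.+2 j); case: (eqVneq i v.+2) => [->|?];
      case: (eqVneq j v.+2) => [->|?]; by lia.
    + by move=> i iu; rewrite /upd ifF //; lia.
    + by rewrite /upd eqxx ifF //; lia.
apply: (IH v.+2) => //; try by lia.
move=> w wv; have := fm w v.+1; lia.
Qed.
End Expansion.

(** * Colour sums of paths *)

Definition ffun_cons (A : Type) n (a : A) (k : {ffun 'I_n -> A}) : {ffun 'I_n.+1 -> A} :=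
  [ffun i => if unlift ord0 i is Some j then k j else a].

Lemma ffun_cons0 (A : Type) n (a : A) (k : {ffun 'I_n -> A}) : ffun_cons a k ord0 = a.
Proof. by rewrite ffunE unlift_none. Qed.

Lemma ffun_consS (A : Type) n (a : A) (k : {ffun 'I_n -> A}) i :
  ffun_cons a k (lift ord0 i) = k i.
Proof. by rewrite ffunE liftK. Qed.

Lemma big_ffun_ordS (B : nmodType) (A : finType) n (F : {ffun 'I_n.+1 -> A} -> B) :
  \sum_k F k = \sum_a \sum_k F (ffun_cons a k).
Proof.
rewrite pair_bigA /=.
pose uncons (k : {ffun 'I_n.+1 -> A}) := (k ord0, [ffun i => k (lift ord0 i)]).
rewrite (reindex (fun p : A * {ffun 'I_n -> A} => ffun_cons p.1 p.2)) //=.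
exists uncons => [[a k]|k] _; rewrite /uncons /=.
  by rewrite ffun_cons0; congr (_, _); apply/ffunP => i; rewrite ffunE ffun_consS.
apply/ffunP => i; case: (unliftP ord0 i) => [j|] ->.
  by rewrite ffun_consS ffunE.
by rewrite ffun_cons0.
Qed.

Section Paths.
Variables (K : fieldType) (B : comAlgType K) (A : finType).
Variables (gt : rel A) (wt : A -> B) (t : K).

(** Transfer-matrix recursion: the sum over the vertices that follow one coloured a, where d tells
    which neighbours are joined. *)
Fixpoint path_rest (d : seq bool) (a : A) : B :=
  if d is b :: d' then
    \sum_c (if b && gt a c then t%:A else 1) * (wt c * path_rest d' c)
  else 1.

Definition path_graph (d : seq bool) n : rel 'I_n :=
  fun x y => (y == x.+1 :> nat) && nth false d x.

(** The weight h of the first vertex is left free so that the induction can absorb the first edge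
    and the second vertex into it. *)
Lemma path_sum (d : seq bool) (h : A -> B) :
  \sum_(k : {ffun 'I_(size d).+1 -> A}) h (k ord0) *
    (\prod_x \prod_y (if path_graph d x y && gt (k x) (k y) then t%:A else 1)) *
    \prod_x wt (k (lift ord0 x)) = \sum_a h a * path_rest d a.
Proof.
elim: d h => [|b d IH] h.
  rewrite big_ffun_ordS; apply: eq_bigr => a _ /=.
  rewrite (eq_bigr (fun=> h a)); last first.
    move=> k _; rewrite ffun_cons0 big_ord0 mulr1 !big_ord_recl !big_ord0 /=.
    by rewrite /path_graph /= !mulr1.
  by rewrite sumr_const card_ffun card_ord expn0 mulr1.
rewrite big_ffun_ordS; apply: eq_bigr => a _ /=.
under eq_bigr do rewrite ffun_cons0 -mulrA.
rewrite -big_distrr /=; congr (_ * _).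
rewrite -[RHS](eq_bigr _ (fun c _ => esym (mulrA _ _ _))).
rewrite -(IH (fun c => (if b && gt a c then t%:A else 1) * wt c)).
apply: eq_bigr => k _; rewrite big_ord_recl /=.
set M := fun x y => if path_graph (b :: d) x y &&
  gt (ffun_cons a k x) (ffun_cons a k y) then t%:A else 1 : B.
have -> : \prod_(y < (size d).+2) M ord0 y = if b && gt a (k ord0) then t%:A else 1.
  rewrite !big_ord_recl big1 /M /path_graph /= ?ffun_consS ?ffun_cons0 ?mul1r ?mulr1 //.
have -> : \prod_i \prod_y M (lift ord0 i) y =
    \prod_x \prod_y (if path_graph d x y && gt (k x) (k y) then t%:A else 1).
  apply: eq_bigr => x _; rewrite big_ord_recl {1}/M /path_graph /= mul1r.
  by apply: eq_bigr => y _; rewrite /M !ffun_consS.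
rewrite [X in _ * X]big_ord_recl ffun_consS -!mulrA; congr (_ * _).
rewrite mulrCA; congr (_ * (_ * _)).
by apply: eq_bigr => x _; rewrite ffun_consS.
Qed.

Lemma colsum_path (d : seq bool) :
  colsum gt wt t (@path_graph d (size d).+1) = \sum_a wt a * path_rest d a.
Proof.
rewrite -path_sum; apply: eq_bigr => k _.
rewrite -(pair_bigA _ (fun x y => if path_graph d x y && gt (k x) (k y) then t%:A else 1)) /=.
by rewrite [X in _ * X]big_ord_recl mulrCA mulrA.
Qed.

End Paths.

Section DyckGraphs.
Variables (K : fieldType) (t : K).

Lemma expands_chain_mul n k (F : functional K) :
  expands n F -> expands (k + n) (fun B A gt wt => chain gt wt k * F B A gt wt).
Proof.
move=> [cs h e]; exists [seq (c.1, k :: c.2) | c <- cs].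
  by rewrite all_map; apply: sub_all h => c /= /eqP->.
move=> B A gt wt s; rewrite big_map e // big_distrr /=.
by apply: eq_bigr => c _; rewrite big_cons scalerAr.
Qed.

(* A factor t on the descents is 1 + (t - 1) [descent]: either the current chain
   is closed, or it is extended by one letter. *)
Lemma expands_path_rest (d : seq bool) k :
  expands (k.+1 + size d)
    (fun B A gt wt => \sum_(c : A) chain_to gt wt k c * @path_rest K B A gt wt t d c).
Proof.
elim: d k => [|b d IH] k.
  exists [:: (1, [:: k.+1])] => [|B A gt wt _]; first by rewrite /= addn0 eqxx.
  rewrite !big_seq1 scale1r /=; apply: eq_bigr => c _; by rewrite mulr1.
have h0 := expands_chain_mul k.+1 (IH 0).
have h1 := IH k.+1.
rewrite addSn -addnS /= -/(size _) in h1.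
apply: expands_ext (expands_lin 1 (if b then t - 1 else 0) h0 h1) => B A gt wt _ /=.
set s := if b then _ else _; set C := \sum_c chain_to gt wt k c.
under eq_bigr do rewrite big_distrr /=.
rewrite exchange_big /= scale1r big_distrr scaler_sumr -big_split /=.
apply: eq_bigr => c _; rewrite /= -mulrA scalerAl -mulrDl mulrA.
under eq_bigr do rewrite mulrA.
rewrite -!big_distrl /= -!mulrA; congr (_ * _).
rewrite /C [X in s *: X]big_mkcond scaler_sumr -big_split /=.
apply: eq_bigr => a _; rewrite /s; case: b {IH h0 h1 s C}; last by rewrite /= mulr1 scale0r addr0.
case: (gt a c) => /=; last by rewrite mulr1 scaler0 addr0.
by rewrite mulr_algr scalerBl scale1r addrC subrK.
Qed.

Lemma expands_path (d : seq bool) :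
  expands (size d).+1 (fun B A gt wt => colsum (B := B) gt wt t (@path_graph d (size d).+1)).
Proof.
by apply: expands_ext (expands_path_rest d 0) => B A gt wt _; rewrite colsum_path.
Qed.

Hypothesis two_neq0 : 2%:R != 0 :> K.
Hypothesis t1_neq0 : 1 + t != 0.

Lemma expands_dyck n f : dyck_fun n f -> dyck_expands t n f.
Proof.
elim: {f}(lexcode n f n).+1 {-2}f (ltnSn (lexcode n f n)) => // k IH f lt Hf.
have [fr fm] := Hf.
have IHf g : dyck_fun n g -> (lexcode n g n < lexcode n f n)%N -> dyck_expands t n g.
  by move=> Hg ltg; apply: IH => //; lia.
have [/existsP[u0 u0P]|nex] := boolP [exists u : 'I_n, u.+2 <= f u]%N.
  have exu : exists u, (u < n)%N && (u.+2 <= f u)%N.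
    by exists u0; rewrite u0P ltn_ord.
  (* For the least such u every earlier w has [f w <= w.+1 <= u], which is at most [f u - 2], as
     [dyck_bounce] requires. *)
  case: (ex_minnP exu) => u /andP[un fu] umin.
  apply: (dyck_bounce two_neq0 t1_neq0 Hf un fu _ IHf) => w wu.
  have : ~~ ((w < n) && (w.+2 <= f w))%N by apply/negP => /umin; lia.
  by rewrite negb_and; lia.
have fS i : (i < n)%N -> (f i <= i.+1)%N.
  move=> ltin; move/existsPn: nex => /(_ (Ordinal ltin)) /=; lia.
case: n {IH IHf lt} Hf fr fm nex fS => [|n] Hf fr fm nex fS.
  exists [:: (1, [::])] => // B A gt wt _.
  rewrite big_seq1 big_nil scale1r /colsum.
  rewrite (eq_bigr (fun=> 1)) => [|k' _]; first by rewrite sumr_const card_ffun card_ord expn0.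
  by rewrite !big1 ?mulr1 // => [[]|[[]]].
have := expands_path (mkseq (fun i => f i == i.+1) n); rewrite size_mkseq.
apply: expands_ext => B A gt wt _; apply: eq_colsum => x y.
rewrite /path_graph /dyck_graph.
have [xn|xn] := ltnP x n.
  rewrite nth_mkseq //; have := fr _ (ltn_ord x); have := fS _ (ltn_ord x).
  by case: (eqVneq (f x) x.+1) => [->|?]; lia.
rewrite nth_default ?size_mkseq // andbF.
by have := ltn_ord y; move: xn; clear; lia.
Qed.

End DyckGraphs.

(** * Weak inequalities between colours *)

Section WeakColorings.
Variables (K : fieldType) (B : comAlgType K) (A : finType).
Variables (gt : rel A) (wt : A -> B) (t : K).

Definition colsum_weak (V : finType) (E W : rel V) : B :=
  \sum_(k : {ffun V -> A})
    (\prod_(p : V * V) (if E p.1 p.2 && gt (k p.1) (k p.2) then t%:A else 1)) *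
    (\prod_(p : V * V) (if W p.1 p.2 && gt (k p.1) (k p.2) then 0 else 1)) *
    \prod_x wt (k x).

Lemma eq_colsum_weak (V : finType) (E E' W W' : rel V) :
  E =2 E' -> W =2 W' -> colsum_weak E W = colsum_weak E' W'.
Proof.
move=> eqE eqW; apply: eq_bigr => k _; congr (_ * _ * _);
  by apply: eq_bigr => p _; rewrite ?eqE ?eqW.
Qed.

Lemma colsum_weak0 (V : finType) (E W : rel V) :
  (forall x y, ~~ W x y) -> colsum_weak E W = colsum gt wt t E.
Proof.
move=> W0; apply: eq_bigr => k _; congr (_ * _).
by rewrite [X in _ * X]big1 ?mulr1 // => p _; rewrite (negPf (W0 _ _)).
Qed.

Lemma prod_adjoin1 (V : finType) (E : rel V) (x y : V) (a : B) (k : {ffun V -> A}) :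
  ~~ E x y ->
  \prod_(p : V * V) (if adjoin E [:: (x, y)] p.1 p.2 && gt (k p.1) (k p.2) then a else 1)
  = (if gt (k x) (k y) then a else 1) *
    \prod_(p : V * V) (if E p.1 p.2 && gt (k p.1) (k p.2) then a else 1).
Proof.
move=> nE; rewrite (bigD1 (x, y)) //= [in RHS](bigD1 (x, y)) //= /adjoin inE eqxx.
rewrite orbT (negPf nE) mul1r; congr (_ * _).
by apply: eq_bigr => -[u v] /= ne; rewrite inE (negPf ne) orbF.
Qed.

(* Forbidding [gt] on (x, y) is a combination of an edge and of a non-edge, since
   0 = (t - t) / (1 - t) and 1 = (1 - t) / (1 - t). *)
Lemma colsum_weak_adjoin (V : finType) (E W : rel V) (x y : V) :
  1 - t != 0 -> ~~ E x y -> ~~ W x y ->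
  colsum_weak E (adjoin W [:: (x, y)]) =
    (1 - t)^-1 *: colsum_weak (adjoin E [:: (x, y)]) W +
    (- t / (1 - t)) *: colsum_weak E W.
Proof.
move=> t1 nE nW; rewrite !scaler_sumr -big_split; apply: eq_bigr => k _ /=.
rewrite !prod_adjoin1 //.
set P := \prod_p _; set Q := \prod_p _; set w := \prod_x _.
case: (gt _ _).
  rewrite mul0r mulr0 mul0r -!mulrA mulr_algl scalerA -scalerDl.
  by rewrite mulrC mulNr subrr scale0r.
rewrite !mul1r -scalerDl -[X in (X + _)]mul1r -mulrDl mulrC mulrV ?unitfE // scale1r //.
Qed.

Lemma colsum_weak_bij (V V' : finType) (e : V' -> V) (E W : rel V) : bijective e ->
  colsum_weak E W = colsum_weak (relpre e E) (relpre e W).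
Proof.
move=> bij; have [e' e'K eK] := bij.
rewrite /colsum_weak (reindex (fun k : {ffun V' -> A} => [ffun x => k (e' x)])) /=; last first.
  exists (fun k : {ffun V -> A} => [ffun x => k (e x)]) => k _;
  by apply/ffunP => x; rewrite !ffunE ?e'K ?eK.
have bij2 : {on xpredT, bijective (fun p : V' * V' => (e p.1, e p.2))}.
  by exists (fun p : V * V => (e' p.1, e' p.2)) => -[x y] _ /=; rewrite ?e'K ?eK.
apply: eq_bigr => k _; congr (_ * _ * _).
- by rewrite (reindex _ bij2); apply: eq_bigr => -[x y] _ /=; rewrite !ffunE !e'K.
- by rewrite (reindex _ bij2); apply: eq_bigr => -[x y] _ /=; rewrite !ffunE !e'K.
rewrite (reindex e) /=; last exact: onW_bij.
by apply: eq_bigr => x _; rewrite ffunE e'K.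
Qed.

End WeakColorings.

Section Labelled.
Variables (K : fieldType) (t : K).
Hypothesis two_neq0 : 2%:R != 0 :> K.
Hypothesis t1_neq0 : 1 + t != 0.
Hypothesis t_neq1 : 1 - t != 0.

(** A weak pair joins w to the vertex just past its last neighbour, so turning it into an edge
    raises [f w] by one; f stays monotone because its later values are strictly larger. *)
Lemma expands_weak n f (W : seq nat) : dyck_fun n f -> uniq W ->
  (forall w, w \in W -> (f w).+1 < n)%N ->
  (forall w u, w \in W -> (w < u < n)%N -> (f w < f u)%N) ->
  expands n (fun B A gt wt => colsum_weak (B := B) gt wt t (@dyck_graph n f)
     (fun x y => (nat_of_ord x \in W) && (y == (f x).+1 :> nat))).
Proof.
elim: W f => [|w W IH] f Hf.
  move=> _ _ _; apply: expands_ext (expands_dyck two_neq0 t1_neq0 Hf) => B A gt wt _.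
  by apply: colsum_weak0.
have [fr fm] := Hf.
move=> /= /andP[wW uW] Wn Wlt.
have wn : ((f w).+1 < n)%N by apply: Wn; rewrite inE eqxx.
have wlt u : (w < u < n)%N -> (f w < f u)%N by apply: Wlt; rewrite inE eqxx.
have wf : (w < n)%N -> (w <= f w)%N by move/fr/andP => [].
have [ltwn|?] := ltnP w n; last first.
  apply: expands_ext (IH f Hf uW _ _) => [B A gt wt _|v vW|v u vW].
  - apply: eq_colsum_weak => // x y; rewrite inE; case: eqP => // e.
    by have := ltn_ord x; rewrite e; lia.
  - by apply: Wn; rewrite inE vW orbT.
  - by apply: Wlt; rewrite inE vW orbT.
pose f' := upd f w (f w).+1.
have Hf' : dyck_fun n f'.
  split=> [i|i j]; rewrite /f' /upd.
    by have := fr i; case: eqP => [->|_]; lia.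
  have := fm i j; have := wlt j; have := fm i w.
  by case: (eqVneq i w) => [->|?]; case: (eqVneq j w) => [->|?]; lia.
have h1 := IH f' Hf' uW; have h2 := IH f Hf uW.
apply: expands_ext (expands_lin (1 - t)^-1 (- t / (1 - t)) (h1 _ _) (h2 _ _)) => [B A gt wt _|v vW|v u vW uv|v vW|v u vW].
- pose x := Ordinal ltwn; pose y := Ordinal wn.
  have eqW z : z \in W -> (z == w) = false.
    by move=> zW; apply: contraNF wW => /eqP <-.
  transitivity (colsum_weak gt wt t (@dyck_graph n f)
    (adjoin (fun x y => (nat_of_ord x \in W) && (y == (f x).+1 :> nat)) [:: (x, y)])).
    apply: eq_colsum_weak => // u v; rewrite /adjoin !inE xpair_eqE -!val_eqE /=.
    case: (eqVneq (val u) w) => [->|_] /=; last by rewrite orbF.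
    by rewrite (negPf wW).
  rewrite colsum_weak_adjoin //; last 2 first.
  - by rewrite /dyck_graph /=; lia.
  - by rewrite /= (negPf wW).
  congr (_ *: _ + _); apply: eq_colsum_weak => u v.
    rewrite /adjoin /dyck_graph /f' /upd !inE xpair_eqE -!val_eqE /=.
    by case: (eqVneq (val u) w) => [->|_] /=; have := wf ltwn; lia.
  by rewrite /f' /upd; case: (boolP (_ \in W)) => //= /eqW ->.
- by rewrite /f' /upd (_ : (v == w) = false); [apply: Wn; rewrite inE vW orbT|
    apply: contraNF wW => /eqP <-].
- have vw : (v == w) = false by apply: contraNF wW => /eqP <-.
  rewrite /f' /upd vw; have : (f v < f u)%N by apply: Wlt; rewrite ?inE ?vW ?orbT.
  by case: eqP => [->|]; lia.
- by apply: Wn; rewrite inE vW orbT.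
- by apply: Wlt; rewrite inE vW orbT.
Qed.

(** Listing the vertices by increasing label turns the window condition into a Dyck graph. A vertex
    at distance exactly m carries the least label outside the window, so it comes right after the
    last neighbour. *)
Theorem expands_labelled (V : finType) (g : V -> int) (m : nat) :
  injective g -> (0 < m)%N ->
  expands #|V| (fun B A gt wt => colsum_weak (B := B) gt wt t
    (fun x y => 0 < g y - g x < m%:Z) (fun x y => g y - g x == m%:Z)).
Proof.
move=> g_inj m_gt0; set n := #|V|.
pose s := sort (fun x y => g x <= g y) (enum V).
have sz : size s == n by rewrite size_sort -cardE.
have us : uniq s by rewrite sort_uniq enum_uniq.
pose e (i : 'I_n) : V := tnth (Tuple sz) i.
have e_inj : injective e by apply/tuple_uniqP.
have ebij : bijective e by apply: inj_card_bij e_inj _; rewrite card_ord.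
pose G i : int := nth 0 (map g s) i.
have Ge (i : 'I_n) : g (e i) = G i.
  by rewrite /G (nth_map (e i)) ?(eqP sz) ?ltn_ord //; congr g; exact: tnth_nth.
have Gsort : sorted <%R (map g s).
  rewrite lt_sorted_uniq_le map_inj_uniq // us /= sorted_map.
  by apply: sort_sorted => x y; apply: le_total.
have Glt i j : (i < n)%N -> (j < n)%N -> (G i < G j) = (i < j)%N.
  by move=> ? ?; rewrite /G lt_sorted_ltn_nth ?inE ?size_map ?(eqP sz).
have Gle i j : (i < n)%N -> (j < n)%N -> (G i <= G j) = (i <= j)%N.
  by move=> ? ?; rewrite /G lt_sorted_leq_nth ?inE ?size_map ?(eqP sz).
pose f i := (\max_(j < n | (G j < G i + m%:Z)%R) (j : nat))%N.
have fP i (j : nat) : (i < n)%N -> (j < n)%N -> (j <= f i)%N = (G j < G i + m%:Z).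
  move=> ltin ltjn; apply/idP/idP => [|lt]; last first.
    exact: (@leq_bigmax_cond _ (fun j : 'I_n => (G j < G i + m%:Z)%R) (fun j => j : nat) (Ordinal ltjn) lt).
  have : (0 < #|[pred j : 'I_n | (G j < G i + m%:Z)%R]|)%N.
    apply/card_gt0P; exists (Ordinal ltin); rewrite inE /=; lia.
  case/(eq_bigmax_cond (fun j : 'I_n => j : nat)) => j0; rewrite inE => lt0 ef.
  rewrite /f ef -Gle // => le; exact: le_lt_trans le lt0.
have fn i : (i < n)%N -> (f i < n)%N.
  move=> ltin; have n0 : (0 < n)%N by lia.
  suff : (f i <= n.-1)%N by lia.
  by apply/bigmax_leqP => j _; have := ltn_ord j; lia.
have Hf : dyck_fun n f.
  split=> [i ltin|i j /andP[leij ltjn]].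
    by rewrite fn // andbT fP //; lia.
  have ltin : (i < n)%N by lia.
  rewrite fP ?fn //; have := fP i (f i) ltin (fn _ ltin); rewrite leqnn => /esym.
  by have := Gle i j ltin ltjn; rewrite leij; lia.
pose W := [seq i <- iota 0 n | ((f i).+1 < n)%N && (G (f i).+1 == G i + m%:Z)].
have WP i : (i \in W) = [&& (i < n)%N, ((f i).+1 < n)%N & G (f i).+1 == G i + m%:Z].
  by rewrite mem_filter mem_iota andbC.
have h : expands n (fun B A gt wt => colsum_weak (B := B) gt wt t (@dyck_graph n f)
     (fun x y => (nat_of_ord x \in W) && (y == (f x).+1 :> nat))).
  apply: expands_weak => //; first by rewrite filter_uniq ?iota_uniq.
    by move=> w; rewrite WP => /and3P[].
  (* The vertex at distance exactly m from w lies in the window of every later u. *)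
  move=> w u; rewrite WP => /and3P[wn fwn /eqP ew] /andP[wu un].
  by rewrite fP // ew; have := Glt w u wn un; rewrite wu; lia.
apply: expands_ext h => B A gt wt _; rewrite (colsum_weak_bij _ _ _ _ _ ebij).
apply: eq_colsum_weak => x y; rewrite /= !Ge.
  by rewrite /dyck_graph fP // -Glt //; lia.
rewrite WP ltn_ord /=; apply/idP/idP => [/eqP e1|].
  have e2 : G y = G x + m%:Z by lia.
  have fy : (f x < y)%N by rewrite ltnNge fP // e2 ltxx.
  have fx1n : ((f x).+1 < n)%N by apply: leq_ltn_trans (ltn_ord y).
  have : (f x < (f x).+1)%N by [].
  rewrite ltnNge fP // -leNgt => le1.
  have : (y <= (f x).+1)%N by rewrite -Gle // e2.
  move=> le2; have -> : (f x).+1 = y by lia.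
  by rewrite ltn_ord e2 !eqxx.
by case/andP=> /andP[_ /eqP e1] /eqP e2; rewrite e2 e1; lia.
Qed.

End Labelled.

(** * Chains as elementary and complete symmetric functions *)

Section ChainCoefficients.
Variables (K : fieldType) (M : nat) (gt : rel 'I_M).
Hypothesis gt_super : superorder gt.

Local Notation X := (fun i : 'I_M => 'X_i : {mpoly K[M]}).

Definition repeats_ok (m : 'X_{1..M}) : bool :=
  [forall i, (2 <= m i)%N ==> gt i i].

(** Characterizes the contents of the chains with last letter c: every remaining letter, c itself if
    repeated, must be [gt] c. *)
Definition ends_at (c : 'I_M) (m : 'X_{1..M}) : bool :=
  [&& (0 < m c)%N, [forall i, (0 < (m - U_(c))%MM i)%N ==> gt i c] & repeats_ok m].

Lemma gt_last (m : 'X_{1..M}) : m != 0%MM ->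
  exists2 c, (0 < m c)%N & forall i, (0 < m i)%N -> i != c -> gt i c.
Proof.
move=> m0; have [gt_tot gt_tr] := gt_super.
have H (s : seq 'I_M) : s != [::] ->
    exists2 c, c \in s & forall i, i \in s -> i != c -> gt i c.
  elim: s => // a s IH _; have [->|s0] := eqVneq s [::].
    by exists a; rewrite ?inE // => i; rewrite inE => ->.
  have [c cs cP] := IH s0; have [ac|nac] := eqVneq a c.
    by exists c; rewrite ?inE ?cs ?orbT // => i; rewrite inE ac => /orP[/eqP->|/cP //]; rewrite eqxx.
  have := gt_tot _ _ nac; case gac: (gt a c) => /esym gca.
    exists c; rewrite ?inE ?cs ?orbT // => i; rewrite inE => /orP[/eqP-> //|]; exact: cP.
  exists a; rewrite ?inE ?eqxx // => i; rewrite inE => /orP[-> //|si] nia.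
  have {}gca : gt c a by case: (gt c a) gca.
  by have [->|nic] := eqVneq i c; rewrite ?gca //; apply: gt_tr (cP _ si nic) gca.
have [|c cs cP] := H (enum [pred i | 0 < m i]%N).
  apply: contraNneq m0 => e; apply/eqP/mnmP => i; rewrite mnm0E.
  have := in_nil i; rewrite -e mem_enum inE; lia.
exists c; first by move: cs; rewrite mem_enum inE.
by move=> i i0; apply: cP; rewrite mem_enum inE.
Qed.

(* The last letter of a chain is forced by its content: it is the least one. *)
Lemma sum_ends_at (m : 'X_{1..M}) (P : pred 'I_M) : m != 0%MM ->
  (exists2 c, (0 < m c)%N & forall i, (0 < m i)%N -> i != c -> gt i c) ->
  \sum_(b | P b) (ends_at b m)%:R = (repeats_ok m && [exists b, P b && ends_at b m])%:R :> K.
Proof.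
move=> m0 [c mc cP]; have [gt_tot gt_tr] := gt_super.
have uniq_end b : ends_at b m -> b = c.
  case/and3P => mb /forallP bP _; apply/eqP; apply/negPn/negP => nbc.
  have := cP _ mb nbc; rewrite gt_tot //.
  have := bP c; rewrite mnmBE mnm1E (negPf nbc) subn0 mc => /= ->.
  by [].
case: (boolP [exists b, P b && ends_at b m]) => [/existsP[b /andP[Pb eb]]|/existsPn ne].
  have ebc := uniq_end _ eb; subst b; rewrite (bigD1 c) //= eb big1 ?addr0 ?andbT.
    by have /and3P[_ _ ->] := eb.
  by move=> b /andP[_ nbc]; case: (boolP (ends_at b m)) => // /uniq_end/eqP; rewrite (negPf nbc).
rewrite andbF big1 // => b Pb; have := ne b; rewrite Pb /= => /negPf ->; exact: erefl.
Qed.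

Lemma mcoeffMXU (p : {mpoly K[M]}) c m :
  (p * 'X_c)@_m = if (0 < m c)%N then p@_(m - U_(c)) else 0.
Proof.
case: ifP => mc.
  have {1}-> : m = (U_(c) + (m - U_(c)))%MM.
    apply/mnmP => i; rewrite mnmDE mnmBE mnm1E; case: eqP => [<-|]; lia.
  by rewrite mcoeffMX.
rewrite mcoeffM big1 // => -[k1 k2] /= /eqP e; rewrite mcoeffX.
case: eqP => [e2|]; last by rewrite mulr0.
by move: (congr1 (fun u : 'X_{1..M} => u c) e); rewrite /= mnmDE -e2 mnm1E eqxx; lia.
Qed.

(** The letters of a chain are sorted by [gt], so the content determines the chain and every
    coefficient is 0 or 1. *)
Lemma chain_to_coef k c m :
  (chain_to gt X k c)@_m = ((mdeg m == k.+1) && ends_at c m)%:R.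
Proof.
have [gt_tot gt_tr] := gt_super.
elim: k c m => [|k IH] c m /=.
  rewrite mcoeffX; congr (_ : bool)%:R; apply/eqP/andP => [<-|[/mdeg1P[i /eqP->]]].
    rewrite mdeg1; split=> //; rewrite /ends_at mnm1E eqxx /=; apply/andP; split.
      by apply/forallP => i; rewrite mnmBE subnn.
    by apply/forallP => i; rewrite mnm1E; case: (_ == _).
  by case/and3P; rewrite mnm1E lt0b => /eqP ->.
rewrite mcoeffMXU; case: ifP => mc; last by rewrite /ends_at mc andbF.
rewrite raddf_sum /=; under eq_bigr do rewrite IH.
set m' := (m - U_(c))%MM.
have dm : mdeg m = (mdeg m').+1.
  have -> : m = (m' + U_(c))%MM.
    by apply/mnmP => i; rewrite mnmDE mnmBE mnm1E; case: eqP => [<-|]; lia.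
  by rewrite mdegD mdeg1 /m' addn1; congr (mdeg _).+1; apply/mnmP => i; rewrite !mnmBE mnmDE mnmBE; lia.
rewrite dm eqSS; case: eqP => [dk|_] /=; last by rewrite big1.
have m'0 : m' != 0%MM by rewrite -mdeg_eq0 dk.
have lst := gt_last m'0; have [b mb bP] := lst.
have m'E i : m i = (m' i + (c == i))%N by rewrite mnmBE mnm1E; case: eqP => [<-|]; lia.
rewrite sum_ends_at //; congr (_ : bool)%:R; rewrite [in RHS]/ends_at mc /=; apply/idP/idP => [/andP|/andP].
  case=> /forallP ok /existsP[a /andP[gac /and3P[ma /forallP aP _]]].
  have gic i : (0 < m' i)%N -> gt i c.
    move=> mi; have [-> //|nia] := eqVneq i a; apply: gt_tr gac.
    by have := aP i; rewrite mnmBE mnm1E eq_sym (negPf nia) subn0 mi.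
  apply/andP; split=> //; apply/forallP => i; apply/implyP; first exact: gic.
  rewrite m'E; case: eqP => [<-|_]; last by rewrite addn0 => h; exact: (implyP (ok i)).
  by rewrite addn1 ltnS; exact: gic.
case=> /forallP gic /forallP ok.
have ok' : repeats_ok m'.
  by apply/forallP => i; apply/implyP => h; apply: (implyP (ok i)); rewrite m'E; lia.
apply/andP; split=> //; apply/existsP; exists b; rewrite (implyP (gic b)) //=.
apply/and3P; split=> //; apply/forallP => i; apply/implyP; rewrite mnmBE mnm1E.
case: (eqVneq i b) => [->|nib].
  by rewrite ?eqxx => h; apply: (implyP (forallP ok' b)); lia.
by rewrite 1?eq_sym ?(negPf nib) subn0 => h; apply: bP.
Qed.

Lemma chain_coef k m : (chain gt X k)@_m = ((mdeg m == k) && repeats_ok m)%:R.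
Proof.
case: k => [|k] /=.
  rewrite mcoeff1 mdeg_eq0; congr (_ : bool)%:R; case: eqP => //= ->.
  by symmetry; apply/forallP => i; rewrite mnm0E.
rewrite raddf_sum /=; under eq_bigr do rewrite chain_to_coef.
case: eqP => [dk|_]; last by rewrite big1.
have m0 : m != 0%MM by rewrite -mdeg_eq0 dk.
have lst := gt_last m0; have [b mb bP] := lst.
under eq_bigr do rewrite andTb.
rewrite sum_ends_at //= ; congr (_ : bool)%:R; case: (boolP (repeats_ok m)) => //= ok.
apply/existsP; exists b; apply/and3P; split=> //.
apply/forallP => i; apply/implyP; rewrite mnmBE mnm1E.
case: (eqVneq i b) => [->|nib].
  by rewrite ?eqxx => h; apply: (implyP (forallP ok b)); lia.
by rewrite 1?eq_sym ?(negPf nib) subn0 => h; apply: bP.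
Qed.

End ChainCoefficients.

(** * Complementary relations and the two-letter super-alphabet *)

Section ChainComplement.
Variable K : fieldType.

(** At t = 0 an edge forbids [gt], so a fully joined path sums over the words with no [gt] between
    neighbours. *)
Lemma chainN_path_rest (B : comAlgType K) (A : finType) (gt : rel A) (wt : A -> B) j k :
  \sum_c chain_to (fun a b => ~~ gt a b) wt j c * path_rest gt wt 0 (nseq k true) c =
  chain (fun a b => ~~ gt a b) wt (j + k).+1.
Proof.
elim: k j => [|k IH] j.
  by rewrite addn0 /=; apply: eq_bigr => c _; rewrite mulr1.
rewrite addnS -addSn -IH /=.
under eq_bigr do rewrite big_distrr /=.
rewrite exchange_big /=; apply: eq_bigr => c _.
rewrite -[RHS]mulrA [X in _ = X * _]big_mkcond big_distrl /=; apply: eq_bigr => b _.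
by rewrite scale0r; case: (gt b c); rewrite ?mul0r ?mulr0 ?mul1r.
Qed.

(** Since the complement of the strict order is the weak order read backwards, this expands h_k in
    products of e_j and also e_k in products of h_j. *)
Lemma expands_chainN k :
  expands k (fun (B : comAlgType K) A gt wt => chain (fun a b => ~~ gt a b) wt k).
Proof.
case: k => [|k]; first by exists [:: (1, [::])] => // *; rewrite big_seq1 big_nil scale1r.
have := expands_path_rest (0 : K) (nseq k true) 0; rewrite size_nseq add1n.
by apply: expands_ext => B A gt wt _; rewrite -[in LHS](add0n k) -chainN_path_rest.
Qed.

(** A chain over this alphabet is a run of odd letters followed by one arbitrary letter. *)
Lemma chain_super k : chain (fun a _ : bool => a)
    (fun a => if a then 'X else 1 : {poly K}) k =
  if k is j.+1 then ('X ^+ j.+1) + ('X ^+ j) else 1.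
Proof.
have cT j : chain_to (fun a _ : bool => a) (fun a => if a then 'X else 1 : {poly K}) j true = 'X ^+ j.+1.
  by elim: j => [|j IH] /=; rewrite ?expr1 // big_mkcond big_bool /= addr0 IH -exprSr.
have cF j : chain_to (fun a _ : bool => a) (fun a => if a then 'X else 1 : {poly K}) j false = 'X ^+ j.
  by case: j => [|j] //=; rewrite big_mkcond big_bool /= addr0 cT mulr1.
by case: k => [|k] //; rewrite /= big_bool /= cT cF.
Qed.

(** The relation looks only at its first argument, so the vertices are coloured independently: an
    odd vertex gains t for each outgoing edge and is forbidden if it starts a weak pair. *)
Lemma colsum_weak_super (t : K) (V : finType) (E W : rel V) :
  colsum_weak (fun a _ : bool => a) (fun a => if a then 'X else 1 : {poly K}) t E W =
  \prod_x (1 + (if [exists y, W x y] then 0 else (t ^+ #|E x|)%:P * 'X)).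
Proof.
transitivity (\prod_(x : V) \sum_(a : bool)
    (if a then (if [exists y, W x y] then 0 else (t ^+ #|E x|)%:P * 'X) else 1 : {poly K})); last first.
  by apply: eq_bigr => x _; rewrite big_bool /= addrC.
rewrite bigA_distr_bigA; apply: eq_bigr => k _.
rewrite -(pair_bigA _ (fun x y => if E x y && k x then _ else 1 : {poly K})) /=.
rewrite -(pair_bigA _ (fun x y => if W x y && k x then _ else 1 : {poly K})) /=.
rewrite -!big_split /=; apply: eq_bigr => x _.
case: (k x); last first.
  by rewrite big1 ?big1 ?mul1r // => y _; rewrite andbF.
under eq_bigr do rewrite andbT.
rewrite -big_mkcond prodr_const -mul_polyC mulr1 -rmorphXn /=.
under eq_bigr do rewrite andbT.
case: ifP => [/existsP[y Wxy]|/negbT/existsPn nW].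
  by rewrite (bigD1 y) //= Wxy mul0r mulr0 mul0r.
by rewrite big1 ?mulr1 // => y _; rewrite (negPf (nW y)).
Qed.

End ChainComplement.

(** * Products of chains and matrices with given margins *)

Section Tables.
Variables (K : fieldType) (M D : nat).

Definition mnm_ord (a : nat -> nat) : 'X_{1..M} := [multinom a i | i < M].

(** The bound D on the entries covers both bases: D = 2 gives the coefficients of products of e's,
    and a D above all the margins those of products of h's. *)
Definition tables (l a : nat -> nat) : nat :=
  #|[set T : {ffun 'I_M * 'I_M -> 'I_D} |
     [forall i : 'I_M, \sum_j T (i, j) == l i]%N && [forall j : 'I_M, \sum_i T (i, j) == a j]%N]%SET|.

Lemma tablesC l a : tables l a = tables a l.
Proof.
rewrite /tables -!sum1_card.
rewrite (reindex_inj (inv_inj (f := fun T : {ffun 'I_M * 'I_M -> 'I_D} => [ffun p => T (p.2, p.1)]) _)) /=.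
  apply: eq_bigl => T; rewrite !inE andbC; congr (_ && _); apply: eq_forallb => i;
  by congr (_ == _); apply: eq_bigr => j _; rewrite ffunE.
by move=> T; apply/ffunP => -[i j]; rewrite !ffunE.
Qed.

Local Notation X := (fun i : 'I_M => 'X_i : {mpoly K[M]}).

Lemma chain_rows (gt : rel 'I_M) k : superorder gt ->
  (forall m : 'X_{1..M}, mdeg m = k -> repeats_ok gt m = [forall i, m i < D]%N) ->
  chain gt X k =
  \sum_(b : {ffun 'I_M -> 'I_D} | (\sum_j b j == k)%N) \prod_j 'X_j ^+ b j.
Proof.
move=> gts okP; apply/mpolyP => m; rewrite chain_coef // raddf_sum /=.
under eq_bigr => b _.
  rewrite (_ : \prod_j _ = 'X_[[multinom b j : nat | j < M]]); last first.
    by rewrite mpolyXE_id; apply: eq_bigr => j _; rewrite mnmE.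
  rewrite mcoeffX; over.
case: eqP => [dk|nd] /=; last first.
  rewrite big1 // => b /eqP bk; case: eqP => // e; case: nd.
  by rewrite -e mdegE -bk; apply: eq_bigr => j _; rewrite mnmE.
rewrite okP //; case: (boolP [forall i, _]) => [/forallP mD|/forallPn[i mi]].
  pose b0 : {ffun 'I_M -> 'I_D} := [ffun i => Ordinal (mD i)].
  rewrite (bigD1 b0) /=; last first.
    by rewrite -dk mdegE; apply/eqP; apply: eq_bigr => j _; rewrite ffunE.
  rewrite (_ : [multinom _ | _ < _] = m) ?eqxx; last by apply/mnmP => j; rewrite mnmE ffunE.
  rewrite big1 ?addr0 // => b /andP[_ nb]; case: eqP => // e; case/eqP: nb.
  by apply/ffunP => j; apply: val_inj; rewrite ffunE /= -e mnmE.
rewrite big1 // => b _; case: eqP => // e; case/negP: mi.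
by rewrite -e mnmE.
Qed.

Lemma prod_chain_tables (gt : rel 'I_M) (l a : nat -> nat) : superorder gt ->
  (forall (i : 'I_M) (m : 'X_{1..M}), mdeg m = l i ->
     repeats_ok gt m = [forall i, m i < D]%N) ->
  (\prod_(i < M) chain gt X (l i))@_(mnm_ord a) = (tables l a)%:R.
Proof.
move=> gts okP.
under eq_bigr => i _ do rewrite (chain_rows gts (okP i)).
rewrite (bigA_distr_big_dep (fun (i : 'I_M) (b : {ffun 'I_M -> 'I_D}) => (\sum_j b j == l i)%N)) raddf_sum /=.
rewrite /tables -sum1_card natr_sum.
pose curry (T : {ffun 'I_M * 'I_M -> 'I_D}) : {ffun 'I_M -> {ffun 'I_M -> 'I_D}} :=
  [ffun i => [ffun j => T (i, j)]].
rewrite (reindex curry) /=; last first.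
  exists (fun F : {ffun 'I_M -> {ffun 'I_M -> 'I_D}} => [ffun p => F p.1 p.2]) => [T|F] _.
    by apply/ffunP => -[i j]; rewrite !ffunE.
  by apply/ffunP => i; apply/ffunP => j; rewrite !ffunE.
rewrite big_mkcond [RHS]big_mkcond; apply: eq_bigr => T _; rewrite [in RHS]inE.
have rowE (i : 'I_M) : (\sum_j curry T i j = \sum_j T (i, j))%N.
  by apply: eq_bigr => j _; rewrite /curry !ffunE.
case: familyP => H1; last first.
  case: forallP => // H2; case: H1 => i.
  by rewrite /in_mem /= (rowE i).
case: forallP => H2; last by case: H2 => i; have := H1 i; rewrite /in_mem /= (rowE i).
rewrite /= (_ : \prod_i _ = 'X_[[multinom (\sum_i T (i, j))%N | j < M]]); last first.
  rewrite exchange_big /= mpolyXE_id; apply: eq_bigr => j _.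
  by rewrite mnmE -prodrXr; apply: eq_bigr => i _; rewrite /curry !ffunE.
rewrite mcoeffX; case: forallP => [h|h]; case: eqP => //.
  by case; apply/mnmP => j; rewrite !mnmE; exact/eqP.
move=> e; case: h => j; have := congr1 (fun u : 'X_{1..M} => u j) e.
by rewrite /= !mnmE => ->.
Qed.

End Tables.

(** * Power series and their restrictions to finitely many variables *)

Section Series.
Variable K : fieldType.

Definition supp_below (M : nat) (a : mon) : Prop := forall i, (M <= i)%N -> a i = 0%N.

Definition represents M (f : series K) (p : {mpoly K[M]}) : Prop :=
  forall a : mon, supp_below M a -> f a = p@_(mnm_ord M a).

Definition mon_mnm M (m : 'X_{1..M}) : mon :=
  [fsfun i in [fset x in iota 0 M]%fset => nth 0%N [seq m j | j <- enum 'I_M] i].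

Lemma mon_mnmE M (m : 'X_{1..M}) (i : 'I_M) : mon_mnm m i = m i.
Proof.
rewrite fsfunE inE /= mem_iota /= ltn_ord (nth_map i) ?size_enum_ord //.
by rewrite nth_ord_enum.
Qed.

Lemma mon_mnm_below M (m : 'X_{1..M}) : supp_below M (mon_mnm m).
Proof. by move=> i Mi; rewrite fsfunE inE /= mem_iota /= ltnNge Mi. Qed.

Lemma mon_mnmK M (m : 'X_{1..M}) : mnm_ord M (mon_mnm m) = m.
Proof. by apply/mnmP => i; rewrite mnmE mon_mnmE. Qed.

Lemma mnm_ordK M (a : mon) : supp_below M a -> mon_mnm (mnm_ord M a) = a.
Proof.
move=> aM; apply/fsfunP => i; have [iM|Mi] := ltnP i M; last first.
  by rewrite mon_mnm_below // aM.
by rewrite -[i]/(val (Ordinal iM)) mon_mnmE mnmE.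
Qed.

Lemma supp_below_le M M' a : (M <= M')%N -> supp_below M a -> supp_below M' a.
Proof. by move=> le h i Mi; apply: h; apply: leq_trans Mi. Qed.

Lemma exists_supp_below (a : mon) : exists M, supp_below M a.
Proof.
exists (\max_(i <- finsupp a) i.+1)%N => i le; apply/eqP.
rewrite -[_ == _]negbK; apply/negP; rewrite -mem_finsupp => ia.
by move: le; rewrite (big_rem i ia) /= geq_max ltnn.
Qed.

Lemma mdeg_below M (a : mon) : supp_below M a -> Defs.mdeg a = mpoly.mdeg (mnm_ord M a).
Proof.
move=> aM; rewrite mdegE (eq_bigr (fun i : 'I_M => a i)); last by move=> i _; rewrite mnmE.
rewrite /Defs.mdeg -(big_mkord xpredT (fun i => a i)) /index_iota subn0.
rewrite [RHS](bigID (fun i => i \in finsupp a)) /= [X in (_ + X)%N]big1 ?addn0; last first.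
  by move=> i; rewrite mem_finsupp negbK => /eqP.
rewrite -[RHS]big_filter; apply: perm_big; apply: uniq_perm => [||i].
- exact: fset_uniq.
- by rewrite filter_uniq ?iota_uniq.
rewrite mem_filter mem_iota /= add0n; case: (boolP (i \in finsupp a)) => //= ia.
by symmetry; rewrite ltnNge; apply/negP => /aM ai; rewrite mem_finsupp ai eqxx in ia.
Qed.

Lemma represents_sone M : represents (sone K) (1 : {mpoly K[M]}).
Proof.
by move=> a aM; rewrite /sone mcoeff1 (mdeg_below aM) mdeg_eq0.
Qed.

Lemma represents_smul M f g (p q : {mpoly K[M]}) :
  represents f p -> represents g q -> represents (smul f g) (p * q).
Proof.
move=> fp gq a aM; rewrite /smul mcoeffM.
set d := (mpoly.mdeg _).+1.
pose P (k : 'X_{1..M < d, d}) := mnm_ord M a == (k.1 + k.2)%MM.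
pose h (k : 'X_{1..M < d, d}) := (mon_mnm (bmnm k.1), mon_mnm (bmnm k.2)).
have sub (b : mon * mon) : (forall i, (b.1 i + b.2 i)%N = a i) ->
    supp_below M b.1 /\ supp_below M b.2.
  by move=> e; split=> i /aM; have := e i; lia.
rewrite (reindex_fsbig h [set` P]); last first.
  split.
  - move=> k /= /eqP e i; have [iM|Mi] := ltnP i M; last first.
      by rewrite !mon_mnm_below // aM.
    rewrite -[i]/(val (Ordinal iM)) !mon_mnmE.
    by have := congr1 (fun u : 'X_{1..M} => u (Ordinal iM)) e; rewrite /= mnmDE mnmE.
  - move=> [k1 k2] [l1 l2] _ _ [/(congr1 (fun b : mon => mnm_ord M b)) e1 /(congr1 (fun b : mon => mnm_ord M b)) e2].
    by rewrite !mon_mnmK in e1 e2; congr (_, _); apply: val_inj.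
  - move=> [b1 b2] /= e; have [/= h1 h2] := sub (b1, b2) e.
    have eP : mnm_ord M a = (mnm_ord M b1 + mnm_ord M b2)%MM.
      by apply/mnmP => i; rewrite mnmDE !mnmE e.
    have l1 : (mpoly.mdeg (mnm_ord M b1) < d)%N by rewrite /d eP mdegD ltnS leq_addr.
    have l2 : (mpoly.mdeg (mnm_ord M b2) < d)%N by rewrite /d eP mdegD ltnS leq_addl.
    exists (BMultinom l1, BMultinom l2); first exact/eqP.
    by rewrite /h /= !mnm_ordK.
rewrite -(@bigfs _ _ _ _ (index_enum ('X_{1..M < d, d} : finType)) P) ?index_enum_uniq //; last first.
  by move=> k _; rewrite mem_index_enum.
apply: eq_bigr => k _; rewrite /h /= fp ?gq ?mon_mnmK //; exact: mon_mnm_below.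
Qed.

Local Notation X := (fun i : 'I__ => 'X_i).

(* [lt_rel i j] reads "i is greater than j". *)
Definition lt_rel M : rel 'I_M := fun i j => (j < i)%N.
Definition le_rel M : rel 'I_M := fun i j => (i <= j)%N.

Lemma lt_rel_super M : superorder (@lt_rel M).
Proof.
split=> [a b|b a c]; rewrite /lt_rel; last by move=> ? ?; lia.
by rewrite -val_eqE /=; lia.
Qed.

Lemma le_rel_super M : superorder (@le_rel M).
Proof.
split=> [a b|b a c]; rewrite /le_rel; last by move=> ? ?; lia.
by rewrite -val_eqE /=; lia.
Qed.

Definition epol M k : {mpoly K[M]} := chain (@lt_rel M) (fun i => 'X_i) k.
Definition hpol M k : {mpoly K[M]} := chain (@le_rel M) (fun i => 'X_i) k.

Lemma represents_hsf M k : represents (hsf K k) (hpol M k).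
Proof.
move=> a aM; rewrite /hsf /hpol chain_coef; last exact: le_rel_super.
rewrite (mdeg_below aM) (_ : repeats_ok _ _ = true) ?andbT //.
by apply/forallP => i; rewrite /le_rel leqnn implybT.
Qed.

Lemma represents_esf M (k : nat) : represents (esf K k%:Z) (epol M k).
Proof.
move=> a aM; rewrite /esf /epol chain_coef; last exact: lt_rel_super.
rewrite (mdeg_below aM); congr (_ && _)%:R; apply/allP/forallP => h i.
  rewrite /lt_rel ltnn implybF -ltnNge ltnS mnmE.
  by case: (posnP (a i)) => [-> //|ai]; rewrite (eqP (h i _)) // mem_finsupp -lt0n.
rewrite mem_finsupp; have [iM|/aM -> //] := ltnP i M.
have := h (Ordinal iM); rewrite /lt_rel ltnn implybF -ltnNge ltnS mnmE /=; lia.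
Qed.

Lemma represents_prod M (I : Type) (r : seq I) (f : I -> series K) (p : I -> {mpoly K[M]}) :
  (forall i, represents (f i) (p i)) ->
  represents (\big[@smul K/sone K]_(i <- r) f i) (\prod_(i <- r) p i).
Proof.
move=> fp; elim: r => [|i r IH]; first by rewrite !big_nil; exact: represents_sone.
by rewrite !big_cons; apply: represents_smul.
Qed.

Lemma represents_ext (f g : series K) :
  (forall M, exists2 p : {mpoly K[M]}, represents f p & represents g p) -> f =1 g.
Proof.
move=> h a; have [M aM] := exists_supp_below a.
by have [p fp gp] := h M; rewrite fp // gp.
Qed.

End Series.

(** * Partitions as sorted exponent vectors *)

Definition parts (l : mon) : seq nat := [seq l i | i <- finsupp l].

Definition pmon (s : seq nat) : mon :=
  [fsfun i in [fset x in iota 0 (size s)]%fset => nth 0%N (sort geq s) i].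

Lemma pmonE s i : pmon s i = nth 0%N (sort geq s) i.
Proof.
rewrite fsfunE inE /= mem_iota /= add0n; case: ltnP => // le.
by rewrite nth_default // size_sort.
Qed.

Lemma geq_total : total geq.
Proof. by move=> i j; apply: leq_total. Qed.

Lemma geq_trans : transitive geq.
Proof. by move=> j i k /= ij jk; apply: leq_trans jk ij. Qed.

Lemma pmon_partn s : is_partn (pmon s).
Proof.
move=> i j ij; rewrite !pmonE.
have [jn|?] := ltnP j (size (sort geq s)); last by rewrite (nth_default _ (_ : _ <= j)%N).
apply: (sorted_leq_nth geq_trans leqnn _ (sort_sorted geq_total s)) => //.
by rewrite inE; apply: leq_ltn_trans jn.
Qed.

Lemma perm_parts M (l : mon) : supp_below M l ->
  perm_eq (parts l) [seq k <- [seq l i | i <- iota 0 M] | k != 0%N].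
Proof.
move=> lM; rewrite filter_map; apply: perm_map; apply: uniq_perm => [||i].
- exact: fset_uniq.
- by rewrite filter_uniq ?iota_uniq.
rewrite mem_filter mem_iota /= add0n mem_finsupp /=.
case: (l i =P 0%N) => //= li; symmetry; rewrite ltnNge; apply/negP => /lM //.
Qed.

Lemma parts_pmon s : perm_eq (parts (pmon s)) [seq k <- s | k != 0%N].
Proof.
have sM : supp_below (size s) (pmon s).
  by move=> i le; rewrite pmonE nth_default ?size_sort.
apply: perm_trans (perm_parts sM) _; apply: perm_filter.
rewrite (eq_map (pmonE s)) -[X in iota _ X](size_sort geq) map_nth_iota0 ?take_size //.
by rewrite perm_sort.
Qed.

(** In a weakly decreasing list the zeros come last, so dropping them shifts nothing. *)
Lemma nth_filter_neq0 (s : seq nat) i : sorted geq s ->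
  nth 0%N [seq k <- s | k != 0%N] i = nth 0%N s i.
Proof.
elim: s i => //= a s IH i pth; have [a0|na0] /= := eqVneq a 0%N; last first.
  by case: i => //= i; apply: IH (path_sorted pth).
have z j : nth 0%N s j = 0%N.
  have /allP al : all (geq a) s by apply: order_path_min pth; apply: geq_trans.
  have [js|?] := ltnP j (size s); last by rewrite nth_default.
  by have := al _ (mem_nth 0%N js); rewrite /= a0 leqn0 => /eqP.
rewrite (_ : [seq k <- s | k != 0%N] = [::]).
  by rewrite nth_nil; case: i => [|i] //=; rewrite z.
apply/eqP; rewrite -[_ == _]negbK -has_filter; apply/hasPn => k /(nthP 0%N)[j _ <-].
by rewrite z.
Qed.

Lemma partn_pmon l : is_partn l -> pmon (parts l) = l.
Proof.
move=> lp; have [M lM] := exists_supp_below l.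
have srt : sorted geq [seq l i | i <- iota 0 M].
  rewrite sorted_map; apply: sub_sorted (iota_sorted 0 M) => i j /= ij; exact: lp.
apply/fsfunP => i; rewrite pmonE.
rewrite (perm_sortP geq_total geq_trans _ _ _ (perm_parts lM)); last first.
  by move=> a b /= ab; apply/eqP; rewrite eqn_leq andbC.
rewrite sorted_sort ?nth_filter_neq0 //; [|exact: geq_trans|]; last first.
  exact: (sorted_filter geq_trans).
have [iM|Mi] := ltnP i M; first by rewrite (nth_map 0%N) ?size_iota // nth_iota.
by rewrite nth_default ?size_map ?size_iota // lM.
Qed.

Lemma pmon_perm s s' : perm_eq s s' -> pmon s = pmon s'.
Proof.
move=> p; apply/fsfunP => i; rewrite !pmonE.
congr nth; apply/perm_sortP => //.
- exact: geq_total.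
- exact: geq_trans.
- by move=> a b /= ab; apply/eqP; rewrite eqn_leq andbC.
Qed.

Lemma perm_parts_eq l a : is_partn l ->
  perm_eq (parts a) (parts l) = (l == pmon (parts a)).
Proof.
move=> lp; apply/idP/eqP => [p|->]; first by rewrite (pmon_perm p) partn_pmon.
rewrite perm_sym; apply: perm_trans (parts_pmon _) _.
rewrite (_ : filter _ _ = parts a) //; apply/all_filterP/allP => k /mapP[i].
by rewrite mem_finsupp => h ->.
Qed.

Section Prods.
Variables (B : comPzRingType) (h : nat -> B).
Hypothesis h0 : h 0 = 1.

Lemma prod_finsupp M l : supp_below M l ->
  \prod_(i <- finsupp l) h (l i) = \prod_(i < M) h (l i).
Proof.
move=> lM; rewrite -(big_map (fun i => l i) xpredT h) (perm_big _ (perm_parts lM)).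
rewrite big_filter big_mkcond /= big_map -(big_mkord xpredT (fun i => h (l i))).
rewrite /index_iota subn0; apply: eq_bigr => i _.
by case: eqP => //= ->.
Qed.

Lemma prod_pmon s : \prod_(i <- finsupp (pmon s)) h (pmon s i) = \prod_(k <- s) h k.
Proof.
rewrite -(big_map (fun i => pmon s i) xpredT h) (perm_big _ (parts_pmon s)).
by rewrite big_filter big_mkcond; apply: eq_bigr => k _; case: eqP => //= ->.
Qed.

End Prods.

(** * Symmetry of the coefficient matrices *)

Section Bases.
Variable K : fieldType.

Lemma represents_hsf_part M l :
  represents (hsf_part K l) (\prod_(i <- finsupp l) hpol K M (l i)).
Proof. by apply: represents_prod => i; apply: represents_hsf. Qed.

Lemma represents_esf_part M l :
  represents (esf_part K l) (\prod_(i <- finsupp l) epol K M (l i)).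
Proof. by apply: represents_prod => i; apply: represents_esf. Qed.

(** Both sides count the nonnegative integer matrices with margins l and a, up to transposition; D
    is chosen larger than every margin, so that it does not restrict the entries. *)
Lemma hsf_partC l a : hsf_part K l a = hsf_part K a l.
Proof.
have [M1 h1] := exists_supp_below l; have [M2 h2] := exists_supp_below a.
pose M := maxn M1 M2; pose D := (\sum_(i < M) (l i + a i)).+1.
have lM : supp_below M l by apply: supp_below_le h1; rewrite leq_maxl.
have aM : supp_below M a by apply: supp_below_le h2; rewrite leq_maxr.
have ok (l' : nat -> nat) (i : 'I_M) (m : 'X_{1..M}) : (l' i < D)%N ->
    mpoly.mdeg m = l' i -> repeats_ok (@le_rel M) m = [forall i, m i < D]%N.
  move=> lt dm; transitivity true; first by apply/forallP => j; rewrite /le_rel leqnn implybT.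
  symmetry; apply/forallP => j; apply: leq_ltn_trans lt; rewrite -dm mdegE (bigD1 j) //=.
  exact: leq_addr.
have lD (i : 'I_M) : (l i + a i < D)%N.
  by rewrite /D ltnS (bigD1 i) //= leq_addr.
have hl : @represents K M (hsf_part K l) _ := @represents_hsf_part M l.
have ha : @represents K M (hsf_part K a) _ := @represents_hsf_part M a.
rewrite (hl a aM) (ha l lM) (prod_finsupp _ lM) // (prod_finsupp _ aM) //.
rewrite (@prod_chain_tables K M D _ l a); first last.
- by move=> i m; apply: ok; have := lD i; lia.
- exact: le_rel_super.
rewrite (@prod_chain_tables K M D _ a l); first last.
- by move=> i m; apply: ok; have := lD i; lia.
- exact: le_rel_super.
by rewrite tablesC.
Qed.

(** The same argument with 0-1 matrices. *)
Lemma esf_partC l a : esf_part K l a = esf_part K a l.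
Proof.
have [M1 h1] := exists_supp_below l; have [M2 h2] := exists_supp_below a.
pose M := maxn M1 M2.
have lM : supp_below M l by apply: supp_below_le h1; rewrite leq_maxl.
have aM : supp_below M a by apply: supp_below_le h2; rewrite leq_maxr.
have ok (m : 'X_{1..M}) : repeats_ok (@lt_rel M) m = [forall i, m i < 2]%N.
  by apply: eq_forallb => i; rewrite /lt_rel ltnn implybF -ltnNge.
have hl : @represents K M (esf_part K l) _ := @represents_esf_part M l.
have ha : @represents K M (esf_part K a) _ := @represents_esf_part M a.
rewrite (hl a aM) (ha l lM) (prod_finsupp _ lM) // (prod_finsupp _ aM) //.
rewrite (@prod_chain_tables K M 2 _ l a) //; last exact: lt_rel_super.
rewrite (@prod_chain_tables K M 2 _ a l) //; last exact: lt_rel_super.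
by rewrite tablesC.
Qed.

End Bases.

(** * The Hall pairing with the products h_k e_j *)

Section Hall.
Variable K : fieldType.

Definition expansion (Bas : mon -> series K) (f : series K) (s : seq (K * seq nat)) : Prop :=
  forall a, f a = \sum_(c <- s) c.1 * Bas (pmon c.2) a.

(** Collecting equal partitions in any finite expansion shows that [coord] chooses from a nonempty
    set; nothing is claimed about which expansion it chooses. *)
Lemma coordP (Bas : mon -> series K) f s : expansion Bas f s ->
  (forall l, l \in finsupp (Defs.coord Bas f) -> is_partn l) /\
  (forall a, f a = \sum_(l <- finsupp (Defs.coord Bas f)) Defs.coord Bas f l * Bas l a).
Proof.
move=> fs; pose S := [fset l in [seq pmon c.2 | c <- s]]%fset.
pose c : {fsfun mon -> K with 0} :=
  [fsfun l in S => \sum_(d <- s | pmon d.2 == l) d.1].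
apply: (@xgetPex _ _ [set c : {fsfun mon -> K with 0} |
    (forall l, l \in finsupp c -> is_partn l) /\
    (forall a, f a = \sum_(l <- finsupp c) c l * Bas l a)]).
exists c; split=> [l|a].
  rewrite mem_finsupp fsfunE; case: ifP => [|_]; last by rewrite eqxx.
  by rewrite !inE => /mapP[d _ ->] _; apply: pmon_partn.
transitivity (\sum_(l <- S) c l * Bas l a).
  under [RHS]eq_big_seq => l lS do rewrite fsfunE lS mulr_suml.
  rewrite (exchange_big_dep xpredT) //= fs; apply: eq_big_seq => d ds.
  have dS : pmon d.2 \in S by rewrite inE /=; apply/mapP; exists d.
  rewrite (big_rem _ dS) /= eqxx big1_seq ?addr0 // => l /andP[/eqP <-].
  by rewrite mem_rem_uniqF // fset_uniq.
rewrite (bigID (fun l => l \in finsupp c)) /= [X in _ + X = _]big1 ?addr0; last first.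
  by move=> l; rewrite mem_finsupp negbK => /eqP ->; rewrite mul0r.
rewrite -big_filter; apply: perm_big; apply: uniq_perm; rewrite ?filter_uniq ?fset_uniq // => l.
rewrite mem_filter andb_idr // mem_finsupp fsfunE; case: ifP => //; by rewrite eqxx.
Qed.

(** By [hsf_partC], the symmetry of h_l in the variables becomes the fact that h_a depends only on
    the parts of a. *)
Lemma hsf_part_pmon l a : hsf_part K l (pmon (parts a)) = hsf_part K l a.
Proof.
rewrite hsf_partC [RHS]hsf_partC.
suff e : hsf_part K (pmon (parts a)) =1 hsf_part K a by rewrite e.
apply: represents_ext => M; exists (\prod_(i <- finsupp a) hpol K M (a i)); last first.
  exact: represents_hsf_part.
have -> : \prod_(i <- finsupp a) hpol K M (a i) =
    \prod_(i <- finsupp (pmon (parts a))) hpol K M (pmon (parts a) i).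
  by rewrite (@prod_pmon _ (hpol K M)) // /parts big_map.
exact: represents_hsf_part.
Qed.

Lemma hsf_part_deg l a : hsf_part K l a != 0 -> Defs.mdeg a = Defs.mdeg l.
Proof.
have [M1 h1] := exists_supp_below l; have [M2 h2] := exists_supp_below a.
pose M := maxn M1 M2; pose D := (\sum_(i < M) (l i + a i)).+1.
have lM : supp_below M l by apply: supp_below_le h1; rewrite leq_maxl.
have aM : supp_below M a by apply: supp_below_le h2; rewrite leq_maxr.
have hl : @represents K M (hsf_part K l) _ := @represents_hsf_part K M l.
have lD (i : 'I_M) : (l i + a i < D)%N.
  by rewrite /D ltnS (bigD1 i) //= leq_addr.
rewrite (hl a aM) (prod_finsupp _ lM) // (@prod_chain_tables K M D _ l a); first last.
- move=> i m dm; transitivity true.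
    by apply/forallP => j; rewrite /le_rel leqnn implybT.
  symmetry; apply/forallP => j; have := lD i; rewrite -dm mdegE (bigD1 j) //=; lia.
- exact: le_rel_super.
rewrite /tables; have [->|[T]] := set_0Vmem [set T : {ffun 'I_M * 'I_M -> 'I_D} |
     [forall i : 'I_M, \sum_j T (i, j) == l i]%N && [forall j : 'I_M, \sum_i T (i, j) == a j]%N].
  by rewrite cards0 eqxx.
rewrite inE => /andP[/forallP hr /forallP hc] _.
rewrite (mdeg_below aM) (mdeg_below lM) !mdegE.
under eq_bigr => j _ do rewrite mnmE -(eqP (hc j)).
under [RHS]eq_bigr => j _ do rewrite mnmE -(eqP (hr j)).
exact: exchange_big.
Qed.

(** Monomial coordinates can be read off as coefficients. What needs work is the existence of a
    finite monomial expansion, which follows from symmetry and bounded degree. *)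
Lemma coord_msf F s : expansion (@hsf_part K) F s ->
  forall l, is_partn l -> Defs.coord (@msf K) F l = F l.
Proof.
move=> Fs; pose N := (\sum_(c <- s) Defs.mdeg (pmon c.2))%N.
have F_sym a : F (pmon (parts a)) = F a.
  by rewrite !Fs; apply: eq_bigr => c _; rewrite hsf_part_pmon.
have F_deg a : F a != 0 -> (Defs.mdeg a <= N)%N.
  apply: contraNT; rewrite -ltnNge => lt; rewrite Fs big1_seq // => c /= cs.
  apply/eqP; rewrite mulf_eq0; apply/orP; right.
  apply: contraTT lt => /hsf_part_deg ->; rewrite -leqNgt /N (big_rem c) //=.
  exact: leq_addr.
have msfE l a : is_partn l -> msf K l a = (l == pmon (parts a))%:R.
  by move=> lp; rewrite -perm_parts_eq.
(* Sorted N-tuples of numbers at most N include every partition of size at most N, padded with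
   zeros. *)
pose cand := undup [seq pmon (map val t) | t : N.-tuple 'I_N.+1].
have cand_in a : F a != 0 -> pmon (parts a) \in cand.
  move=> /F_deg dN; rewrite mem_undup.
  have pN k : k \in parts a -> (0 < k <= N)%N.
    case/mapP => i ia ->; rewrite lt0n -mem_finsupp ia /=; apply: leq_trans dN.
    by rewrite /Defs.mdeg (big_rem i) //= leq_addr.
  have szN : (size (parts a) <= N)%N.
    apply: leq_trans dN.
    have -> : Defs.mdeg a = (\sum_(k <- parts a) k)%N by rewrite /parts big_map.
    rewrite -sum1_size big_seq [in leqRHS]big_seq; apply: leq_sum => k /pN; lia.
  pose u := [seq inord k : 'I_N.+1 | k <- parts a] ++ nseq (N - size (parts a)) ord0.
  have szu : size u == N by rewrite size_cat size_map size_nseq subnKC.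
  apply/mapP; exists (Tuple szu); first by rewrite mem_enum.
  have -> : [seq val k | k <- Tuple szu] = parts a ++ nseq (N - size (parts a)) 0%N.
    rewrite /= /u map_cat map_nseq -map_comp; congr (_ ++ _).
    rewrite -[RHS]map_id; apply/eq_in_map => k /pN kN /=; rewrite inordK //; lia.
  have eqp s1 s2 : [seq k <- s1 | k != 0%N] = [seq k <- s2 | k != 0%N] -> pmon s1 = pmon s2.
    move=> e; rewrite -(partn_pmon (pmon_partn s1)) -(partn_pmon (pmon_partn s2)).
    by rewrite (pmon_perm (parts_pmon s1)) (pmon_perm (parts_pmon s2)) e.
  apply: eqp; rewrite filter_cat (_ : [seq k <- nseq _ _ | _] = [::]) ?cats0 //.
  by elim: (N - _)%N.
have expF a : F a = \sum_(c <- [seq (F l, parts l) | l <- cand]) c.1 * msf K (pmon c.2) a.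
  rewrite big_map /=.
  have cp l : l \in cand -> is_partn l.
    by rewrite mem_undup => /mapP[t _ ->]; apply: pmon_partn.
  under eq_big_seq => l /cp lp.
    rewrite partn_pmon // msfE //; over.
  have [Fa0|Fa] := eqVneq (F a) 0.
    rewrite Fa0 big1 // => l _; case: eqP => [->|]; last by rewrite mulr0.
    by rewrite F_sym Fa0 mul0r.
  rewrite (big_rem (pmon (parts a))) ?cand_in //= eqxx mulr1 F_sym.
  rewrite big1_seq ?addr0 // => l /andP[_]; case: eqP => [->|]; last by rewrite mulr0.
  by rewrite mem_rem_uniqF ?undup_uniq.
have [cp ce] := coordP expF => l lp.
rewrite ce; have [lc|nlc] := boolP (l \in finsupp (Defs.coord (@msf K) F)); last first.
  rewrite [LHS]fsfun_dflt // big1_seq // => l' /andP[_ l'c].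
  rewrite (msfE _ _ (cp _ l'c)) partn_pmon //.
  case: eqP => [e|]; last by rewrite mulr0.
  by rewrite -e l'c in nlc.
rewrite (big_rem l) //= msfE // partn_pmon // eqxx mulr1 big1_seq ?addr0 // => l' /andP[_ l'c].
rewrite msfE; last by apply: cp; exact: mem_rem l'c.
rewrite partn_pmon //; case: eqP => [e|]; last by rewrite mulr0.
by move: l'c; rewrite e mem_rem_uniqF ?fset_uniq.
Qed.

(** By [hsf_partC], pairing h_c with g gives the coefficient of g at c, whichever h-coordinates of g
    were chosen. *)
Lemma hall_hsf F g sF sg :
  expansion (@hsf_part K) F sF -> expansion (@hsf_part K) g sg ->
  hall F g = \sum_(c <- sF) c.1 * g (pmon c.2).
Proof.
move=> hF hg; have [cp ce] := coordP hg; rewrite /hall.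
under eq_big_seq => l /cp lp.
  rewrite (coord_msf hF) // hF mulr_suml; over.
rewrite exchange_big /=; apply: eq_bigr => c _.
rewrite ce mulr_sumr; apply: eq_bigr => l _.
by rewrite hsf_partC -mulrA; congr (_ * _); rewrite mulrC.
Qed.

(* Through the symmetric matrix of the [esf_part l a] both sides become the same
   pairing of G with g, which does not depend on the expansion of G. *)
Lemma omega_pairing G g sG sg (d := Defs.coord (@esf_part K) G) :
  expansion (@esf_part K) G sG -> expansion (@esf_part K) g sg ->
  \sum_(l <- finsupp d) d l * g l = \sum_(c <- sG) c.1 * g (pmon c.2).
Proof.
move=> hG hg; have [cp ce] := coordP hG.
transitivity (\sum_(c <- sg) c.1 * G (pmon c.2)).
  under eq_bigr => l _ do rewrite hg mulr_sumr.
  rewrite exchange_big /=; apply: eq_bigr => c _.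
  rewrite ce mulr_sumr; apply: eq_bigr => l _.
  by rewrite esf_partC mulrCA.
under eq_bigr => c _ do rewrite hG mulr_sumr.
rewrite exchange_big /=; apply: eq_bigr => c _.
rewrite hg mulr_sumr; apply: eq_bigr => l _.
by rewrite esf_partC mulrCA.
Qed.

End Hall.

Section HallOmega.
Variable K : fieldType.

Lemma eq_chain (B : comAlgType K) (A : finType) (gt gt' : rel A) (wt : A -> B) k :
  gt =2 gt' -> chain gt wt k = chain gt' wt k.
Proof.
move=> e; case: k => [//|k] /=; apply: eq_bigr => c _.
elim: k c => [//|k IH] c /=; congr (_ * _).
by apply: eq_big => [b|b _]; [exact: e | exact: IH].
Qed.

Lemma expands_hsf n F (f : series K) : expands n F ->
  (forall M, represents f (F {mpoly K[M]} 'I_M (@le_rel M) (fun i => 'X_i))) ->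
  exists s, expansion (@hsf_part K) f s.
Proof.
move=> [cs _ e] h; exists cs => a; have [M aM] := exists_supp_below a.
rewrite (h M a aM) e; last exact: le_rel_super.
rewrite raddf_sum /=; apply: eq_bigr => c _; rewrite mcoeffZ; congr (_ * _).
rewrite (@represents_hsf_part K M (pmon c.2) a aM); congr (_@_ _).
by rewrite (@prod_pmon _ (hpol K M)).
Qed.

Lemma expands_esf n F (f : series K) : expands n F ->
  (forall M, represents f (F {mpoly K[M]} 'I_M (@lt_rel M) (fun i => 'X_i))) ->
  exists2 s : seq (K * seq nat), expansion (@esf_part K) f s &
    all (fun c => sumn c.2 == n) s /\
    forall (B : comAlgType K) (A : finType) (gt : rel A) (wt : A -> B),
    superorder gt ->
    F B A gt wt = \sum_(c <- s) c.1 *: \prod_(k <- c.2) chain gt wt k.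
Proof.
move=> [cs deg e] h; exists cs => // a; have [M aM] := exists_supp_below a.
rewrite (h M a aM) e; last exact: lt_rel_super.
rewrite raddf_sum /=; apply: eq_bigr => c _; rewrite mcoeffZ; congr (_ * _).
rewrite (@represents_esf_part K M (pmon c.2) a aM); congr (_@_ _).
by rewrite (@prod_pmon _ (epol K M)).
Qed.

(** For positive k and j, h_k e_j is the sum of two hook Schur functions. *)
Definition hook (k j : nat) : series K := smul (hsf K k) (esf K j%:Z).

Lemma represents_hook M k j : @represents K M (hook k j) (hpol K M k * epol K M j).
Proof. by apply: represents_smul; [exact: represents_hsf | exact: represents_esf]. Qed.

(** The pairing needs h_k e_j both in the h_l, for [hall_hsf], and in the e_l, for
    [omega_pairing]. *)
Lemma hook_hsf k j : exists s, expansion (@hsf_part K) (hook k j) s.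
Proof.
have h := expands_chain_mul k (@expands_chainN K j).
apply: (expands_hsf h) => M.
rewrite -(@eq_chain _ _ (@lt_rel M) (fun a b => ~~ le_rel a b)) => [|a b].
  exact: represents_hook.
by rewrite /lt_rel /le_rel ltnNge.
Qed.

Lemma hook_esf k j : exists s, expansion (@esf_part K) (hook k j) s.
Proof.
have h := expands_chain_mul j (@expands_chainN K k).
have [|s] := @expands_esf _ _ (hook k j) h; last by exists s.
move=> M.
rewrite -(@eq_chain _ _ (@le_rel M) (fun a b => ~~ lt_rel a b)) => [|a b]; last by rewrite /lt_rel /le_rel leqNgt.
by rewrite mulrC; exact: represents_hook.
Qed.

Lemma mcoeff_mulX M (p : {mpoly K[M]}) (u m : 'X_{1..M}) :
  (p * 'X_[u])@_m = if (u <= m)%MM then p@_(m - u) else 0.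
Proof.
case: ifP => um; first by rewrite -{1}(submK um) addmC mcoeffMX.
rewrite mcoeffM big1 // => -[k1 k2] /= /eqP e; rewrite mcoeffX.
case: eqP => [e2|]; last by rewrite mulr0.
suff : (u <= m)%MM by rewrite um.
apply/mnm_lepP => i; have := congr1 (fun v : 'X_{1..M} => v i) e.
by rewrite e2 /= mnmDE => ->; rewrite leq_addl.
Qed.

Definition chain_super_val (k : nat) : {poly K} :=
  if k is j.+1 then ('X ^+ j.+1) + ('X ^+ j) else 1.

(** A term of the coefficient of h_k e_(N-k) is a choice, for each part p, of giving 0 or 1 to the
    e-factor; what is left, p or p - 1, is the exponent of the variable. *)
Lemma sum_hook (s : seq nat) N : sumn s = N ->
  \sum_(k < N.+1) (hook k (N - k) (pmon s))%:P * 'X^k =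
  \prod_(k <- s) chain_super_val k.
Proof.
move=> sN; pose M := size s.
have sM : supp_below M (pmon s) by move=> i le; rewrite pmonE nth_default ?size_sort.
set m := mnm_ord M (pmon s).
have mN : mpoly.mdeg m = N.
  rewrite -mdeg_below // -sN /Defs.mdeg sumnE -(big_map (fun i => pmon s i) xpredT id).
  rewrite (perm_big _ (parts_pmon s)) big_filter big_mkcond /=.
  by apply: eq_bigr => k _; case: eqP.
rewrite -(@prod_pmon _ chain_super_val) // (prod_finsupp _ sM) //.
have -> : \prod_(i < M) chain_super_val (pmon s i) =
  \prod_(i < M) \sum_(b < 2) (if (b <= m i)%N then 'X ^+ (m i - b) else 0).
  apply: eq_bigr => i _; rewrite /m mnmE !big_ord_recl big_ord0 /= addr0 subn0.
  by case: (pmon s i) => [|j] /=; rewrite ?expr0 ?addr0 // subn1.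
rewrite bigA_distr_bigA /=.
have hk (k : 'I_N.+1) : hook k (N - k) (pmon s) =
   \sum_(b : {ffun 'I_M -> 'I_2} | (\sum_j b j == N - k)%N)
     (([forall i, b i <= m i]%N)%:R : K).
  rewrite (@represents_hook M _ _ _ sM) /epol (@chain_rows _ _ 2 _ (N - k)); first last.
  - move=> u _; apply: eq_forallb => i; by rewrite /lt_rel ltnn implybF -ltnNge.
  - exact: lt_rel_super.
  rewrite big_distrr raddf_sum /=; apply: eq_bigr => b /eqP bN.
  rewrite (_ : \prod_j _ = 'X_[[multinom b j : nat | j < M]]); last first.
    by rewrite mpolyXE_id; apply: eq_bigr => j _; rewrite mnmE.
  rewrite mcoeff_mulX -/m (_ : (_ <= m)%MM = [forall i, b i <= m i]%N); last first.
    by apply: eq_forallb => i; rewrite mnmE.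
  case: ifP => // /forallP bm; rewrite /hpol chain_coef; last exact: le_rel_super.
  rewrite (_ : repeats_ok _ _ = true) ?andbT; last first.
    by apply/forallP => i; rewrite /le_rel leqnn implybT.
  have e : m = (m - [multinom b j : nat | j < M] + [multinom b j : nat | j < M])%MM.
    by apply/mnmP => i; rewrite mnmDE mnmBE mnmE subnK.
  have du : mpoly.mdeg [multinom b j : nat | j < M] = (N - k)%N.
    by rewrite mdegE -bN; apply: eq_bigr => j _; rewrite mnmE.
  have {}e : N = (mpoly.mdeg (m - [multinom b j : nat | j < M])%MM + (N - k))%N.
    by rewrite -du -mdegD -e mN.
  by rewrite (_ : _ == _ = true) //; apply/eqP; have := ltn_ord k; lia.
under eq_bigr => k _ do rewrite hk raddf_sum mulr_suml.
rewrite (exchange_big_dep xpredT) //=; apply: eq_bigr => b _.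
case: (boolP [forall i, b i <= m i]%N) => [/forallP bm|/forallPn[i bi]]; last first.
  rewrite big1 => [|k _]; last by rewrite mul0r.
  by rewrite (bigD1 i) //= (negPf bi) mul0r.
have bN : (\sum_j b j <= N)%N.
  by rewrite -mN mdegE; apply: leq_sum => i _; exact: bm.
rewrite (big_pred1 (inord (N - \sum_j b j))) => [|k]; last first.
  rewrite /= -[RHS]val_eqE /= inordK; last by rewrite ltnS leq_subr.
  by rewrite -[\val k]/(nat_of_ord k); move: bN (ltn_ord k); set S := (\sum_j _)%N; clearbody S; move: (nat_of_ord k) => k0; lia.
rewrite mul1r inordK ?ltnS ?leq_subr //.
rewrite (eq_bigr (fun i => 'X ^+ (m i - b i))); last by move=> i _; rewrite (bm i).
rewrite prodrXr; congr ('X ^+ _); rewrite -mN mdegE.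
by rewrite -sumnB.
Qed.

(** Turns all pairings at once into one evaluation. Homogeneity of degree N makes [sum_hook]
    applicable to each product of e's, and its factors are the values computed in [chain_super]. *)
Lemma hall_generating (T : choiceType) (L : set T) (w : T -> K) (G : T -> series K)
    (F : T -> functional K) (N : nat) :
  finite_set L -> (forall x, L x -> expands N (F x)) ->
  (forall x M, L x -> represents (G x) (F x {mpoly K[M]} 'I_M (@lt_rel M) (fun i => 'X_i))) ->
  \sum_(k \in [set: nat])
    (hall (fun a => \sum_(x \in L) w x * omega (G x) a)
       (smul (hsf K k) (esf K (N%:Z - k%:Z))))%:P * 'X^k =
  \sum_(x \in L) (w x)%:P *
    F x {poly K} bool (fun a _ => a) (fun a => if a then 'X else 1).
Proof.
move=> finL exL repG.
have hG x : x \in L -> exists s : seq (K * seq nat), [/\ expansion (@esf_part K) (G x) s,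
    all (fun c => sumn c.2 == N) s &
    forall (B : comAlgType K) (A : finType) (gt : rel A) (wt : A -> B), superorder gt ->
    F x B A gt wt = \sum_(c <- s) c.1 *: \prod_(k <- c.2) chain gt wt k].
  rewrite inE => Lx; have [s e [d h]] := expands_esf (exL x Lx) (fun M => repG x M Lx).
  by exists s.
pose sG x := xget [::] [set s : seq (K * seq nat) | [/\ expansion (@esf_part K) (G x) s,
    all (fun c => sumn c.2 == N) s &
    forall (B : comAlgType K) (A : finType) (gt : rel A) (wt : A -> B), superorder gt ->
    F x B A gt wt = \sum_(c <- s) c.1 *: \prod_(k <- c.2) chain gt wt k]].
have sGP x : x \in L -> [/\ expansion (@esf_part K) (G x) (sG x),
    all (fun c => sumn c.2 == N) (sG x) &
    forall (B : comAlgType K) (A : finType) (gt : rel A) (wt : A -> B), superorder gt ->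
    F x B A gt wt = \sum_(c <- sG x) c.1 *: \prod_(k <- c.2) chain gt wt k].
  by move=> /hG; exact: xgetPex.
set H := fun a => \sum_(x \in L) _.
pose r := fset_set L.
have rL x : x \in r -> x \in L by rewrite in_fset_set.
pose d x := Defs.coord (@esf_part K) (G x).
pose sH := flatten [seq [seq (w x * d x l, parts l) | l <- finsupp (d x)] | x <- r].
have expH : expansion (@hsf_part K) H sH.
  move=> a; rewrite /H fsbig_finite //= big_flatten /= big_map.
  apply: eq_big_seq => x /rL xL; have [e _ _] := sGP x xL; have [cp ce] := coordP e.
  rewrite big_map /omega mulr_sumr; apply: eq_big_seq => l /cp lp /=.
  by rewrite partn_pmon // mulrA.
have hallE k j : hall H (hook k j) =
    \sum_(x <- r) w x * \sum_(c <- sG x) c.1 * hook k j (pmon c.2).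
  have [s1 h1] := hook_hsf k j; have [s2 h2] := hook_esf k j.
  rewrite (hall_hsf expH h1) big_flatten /= big_map.
  apply: eq_big_seq => x /rL xL; have [e _ _] := sGP x xL; have [cp ce] := coordP e.
  rewrite -(omega_pairing e h2) big_map mulr_sumr; apply: eq_big_seq => l /cp lp /=.
  by rewrite partn_pmon // mulrA.
(* Beyond N the index of the e-factor is negative, so the series is zero and has the empty
   expansion; the sum over all k is thus finite. *)
have hall0 k : (N < k)%N -> hall H (smul (hsf K k) (esf K (N%:Z - k%:Z))) = 0.
  move=> Nk; have e0 : expansion (@hsf_part K) (smul (hsf K k) (esf K (N%:Z - k%:Z))) [::].
    move=> a; rewrite big_nil /smul fsbig1 // => -[b1 b2] _ /=.
    rewrite /esf (_ : _ == _ = false) ?mulr0 //; lia.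
  rewrite (hall_hsf expH e0) big1 // => c _.
  by rewrite e0 big_nil mulr0.
set U := iota 0 N.+1; rewrite (fsbigE U) ?iota_uniq //; last first.
  move=> k _; rewrite /U mem_iota add0n ltnS -ltnNge => /hall0 ->.
  by rewrite polyC0 mul0r.
under eq_bigl do rewrite in_setT.
rewrite (_ : U = index_iota 0 N.+1) ?big_mkord; last by rewrite /index_iota subn0.
under eq_bigr => k _.
  rewrite (_ : N%:Z - (k : nat)%:Z = (N - k)%N%:Z); last by have := ltn_ord k; lia.
  rewrite -/(hook k (N - k)) hallE raddf_sum mulr_suml; over.
rewrite exchange_big fsbig_finite //=; apply: eq_big_seq => x /rL xL.
have [e /allP deg univ] := sGP x xL.
rewrite univ; last by split=> [[] []|b [] []].
under eq_bigr do rewrite polyCM -mulrA.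
rewrite -mulr_sumr; congr (_ * _).
under eq_bigr => k _ do rewrite raddf_sum mulr_suml.
rewrite exchange_big; apply: eq_big_seq => c /deg /eqP degc /=.
under eq_bigr => k _ do rewrite polyCM -mulrA.
rewrite -mulr_sumr sum_hook // mul_polyC; congr (_ *: _).
by apply: eq_bigr => k _; rewrite chain_super.
Qed.

End HallOmega.

(** * Counting along the boundary of a partition *)

Lemma count_initial (p : pred nat) M y : (forall i j, (0 < i <= j)%N -> p j -> p i) ->
  (0 < y <= M)%N -> (y <= count p (iota 1 M))%N = p y.
Proof.
move=> dec; elim: M => [|M IH] yM; first by lia.
have -> : iota 1 M.+1 = iota 1 M ++ [:: M.+1] by have := iotaD 1 M 1; rewrite addn1 add1n.
rewrite count_cat /= addn0.
have cM := count_size p (iota 1 M); rewrite size_iota in cM.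
have [yle|yge] := leqP y M.
  rewrite -IH; last by lia.
  case pM: (p M.+1); last by rewrite addn0.
  have yc : (y <= count p (iota 1 M))%N.
    by rewrite IH; [apply: dec pM; lia | lia].
  by move: yc; lia.
have -> : y = M.+1 by lia.
case pM: (p M.+1); last by lia.
suff -> : count p (iota 1 M) = M by lia.
rewrite -[RHS](size_iota 1); apply/eqP; rewrite -all_count; apply/allP => i.
by rewrite mem_iota => ?; apply: dec pM; lia.
Qed.

Section PathIdentity.
Variables (m n l : nat) (lam : nat -> nat).

(* The element of the semimodule attached to the box (x, y). *)
Definition box_label (x y : nat) : int := (l + n + m)%N%:Z - (n * x)%N%:Z - (m * y)%N%:Z.

Lemma labS1 x y : box_label x.+1 y = box_label x y - n%:Z.
Proof. by rewrite /box_label; lia. Qed.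

Lemma labS2 x y : box_label x y.+1 = box_label x y - m%:Z.
Proof. by rewrite /box_label; lia. Qed.

Hypotheses (m_gt0 : (0 < m)%N) (n_gt0 : (0 < n)%N).

Let N := (l %/ m)%N.
Let R := (l %/ n)%N.

(* [lam y] is the length of row y, for y >= 1; [lam 0] is irrelevant. *)
Definition fits : Prop :=
  (forall y y', (0 < y <= y')%N -> (lam y' <= lam y)%N) /\
  (forall y, (0 < y)%N -> (0 < lam y)%N -> (n * lam y + m * y <= l)%N).

Hypothesis lam_fits : fits.

Definition col_height (x : nat) : nat := count (fun y => (x <= lam y)%N) (iota 1 N).

Lemma lam_out y : (N < y)%N -> lam y = 0%N.
Proof.
have [_ h] := lam_fits; rewrite /N ltn_divLR // => lt.
by case: (posnP (lam y)) => // /(h y); lia.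
Qed.

Lemma lam_leR y : (0 < y)%N -> (lam y <= R)%N.
Proof.
have [_ h] := lam_fits => y0; rewrite leq_divRL //.
case: (posnP (lam y)) => [->|/(h y y0)]; lia.
Qed.

Lemma col_le x y : (0 < x)%N -> (0 < y)%N -> (y <= col_height x)%N = (x <= lam y)%N.
Proof.
have [mono _] := lam_fits => x0 y0; have [yN|yN] := leqP y N.
  by apply: count_initial => [i j ij|]; [have := mono _ _ ij; lia | lia].
rewrite (lam_out yN); apply/idP/idP => [|]; last by lia.
have := count_size (fun y => (x <= lam y)%N) (iota 1 N).
by rewrite size_iota -/(col_height x); lia.
Qed.

Definition row_label (y : nat) : int := box_label (lam y) y.
Definition col_label (x : nat) : int := box_label x (col_height x).

(* The number of the labels p - m, p - 2m, ... that are at least h. *)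
Definition steps (h p : int) : int := if h <= p then ((p - h) %/ m%:Z)%Z else 0.

Lemma steps_add h g : steps h (g + m%:Z) = steps h g + (h <= g)%R%:R.
Proof.
rewrite /steps; have [hg|gh] := lerP h g.
  have -> : h <= g + m%:Z by lia.
  have -> : g + m%:Z - h = (g - h) + m%:Z by lia.
  by rewrite divzDr ?dvdzz // divzz; case: m m_gt0.
case: ifP => // h2; rewrite divz_small ?add0r //; lia.
Qed.

Lemma steps_small h p : p < h + m%:Z -> steps h p = 0.
Proof.
by move=> lt; rewrite /steps; case: ifP => // hp; rewrite divz_small //; lia.
Qed.

(* The side conditions place (X, Y) on the boundary path of the partition, which
   is followed down to its end on the horizontal axis. *)
Lemma path_ind (P : nat -> nat -> Prop) :
  (forall X, (X <= R)%N -> (forall x, (X < x)%N -> col_height x = 0%N) -> P X 0%N) ->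
  (forall X Y, (X.+1 <= lam Y.+1)%N -> col_height X.+1 = Y.+1 -> P X.+1 Y.+1 -> P X Y.+1) ->
  (forall X Y, X = lam Y.+1 -> (X <= R)%N -> P X Y -> P X Y.+1) ->
  forall X Y, (Y <= N)%N -> (lam Y.+1 <= X <= R)%N -> (Y == 0%N) || (X <= lam Y)%N -> P X Y.
Proof.
have [mono fit] := lam_fits.
move=> P0 PH PV X Y; elim: {X Y}(R - X + Y)%N {-2}X {-2}Y (erefl (R - X + Y)%N) => [|k IH] X Y eqk YN /andP[X1 X2] X3.
  have Y0 : Y = 0%N by lia.
  rewrite Y0 in X1 *; apply: P0 => // x Xx.
  have : ~~ (1 <= col_height x)%N by rewrite col_le //; lia.
  by lia.
case: Y eqk YN X1 X3 => [|Y] eqk YN X1 X3.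
  apply: P0 => // x Xx; have : ~~ (1 <= col_height x)%N by rewrite col_le //; lia.
  by lia.
have lR := lam_leR (ltn0Sn Y).
have [e|ne] := eqVneq X (lam Y.+1).
  apply: PV => //; apply: IH; [lia|lia|lia|].
  by case: Y {eqk YN X1 X3 lR} e => //= Y ->; apply: mono; lia.
have lt : (X.+1 <= lam Y.+1)%N by lia.
apply: PH => //.
  have a1 := col_le (ltn0Sn X) (ltn0Sn Y); have a2 := col_le (ltn0Sn X) (ltn0Sn Y.+1).
  by lia.
by apply: IH; lia.
Qed.

(** Along the boundary path a step to the right subtracts n from the label and a step down adds m,
    so the increments of F add up to the difference between the two ends; they are grouped here by
    rows and by columns. *)
Lemma path_telescope (F : int -> int) X Y : (Y <= N)%N -> (lam Y.+1 <= X <= R)%N ->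
  (Y == 0%N) || (X <= lam Y)%N ->
  F (box_label X Y) + \sum_(1 <= y < Y.+1) (F (row_label y + m%:Z) - F (row_label y)) =
  F (box_label R 0) + \sum_(X.+1 <= x < R.+1) (F (col_label x + n%:Z) - F (col_label x)).
Proof.
move: X Y; apply: path_ind => [X XR c0|X Y lt cX IH|X Y eX XR IH].
- rewrite big_geq // addr0.
  have -> : \sum_(X.+1 <= x < R.+1) (F (col_label x + n%:Z) - F (col_label x)) =
            \sum_(X <= x < R) (F (box_label x 0) - F (box_label x.+1 0)).
    rewrite big_add1; apply: eq_big_nat => x xr.
    by rewrite /col_label c0 ?labS1 ?subrK //; lia.
  under eq_bigr do rewrite -opprB.
  by rewrite sumrN telescope_sumr // opprB addrCA subrr addr0.
- rewrite [in RHS]big_ltn; last by have := lam_leR (ltn0Sn Y); lia.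
  rewrite [RHS]addrCA -IH /col_label cX labS1 subrK; ring.
- rewrite big_nat_recr //= addrA 
    [X in X + _](_ : _ = F (row_label Y.+1) - F (box_label X Y) +
      (F (box_label X Y) + \sum_(1 <= y < Y.+1) (F (row_label y + m%:Z) - F (row_label y)))); last first.
    by rewrite /row_label -eX; ring.
  rewrite IH /row_label -eX labS2 subrK; ring.
Qed.

(** Induction along the path. A vertical step adds one row, accounted for by [steps_add]. A
    horizontal step adds one column; by [path_telescope], with F = [steps] at the current label, its
    entries sum to the effect of moving the threshold by n. *)
Lemma path_identity X Y : (Y <= N)%N -> (lam Y.+1 <= X <= R)%N ->
  (Y == 0%N) || (X <= lam Y)%N ->
  \sum_(1 <= y < Y.+1) \sum_(X.+1 <= x < R.+1)
    (if (x <= lam y)%N then - (col_label x + n%:Z <= row_label y)%R%:R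
     else (row_label y + m%:Z <= col_label x)%R%:R) =
  \sum_(X.+1 <= x < R.+1) steps (box_label X Y) (col_label x).
Proof.
have [mono fit] := lam_fits.
move: X Y; apply: path_ind => [X XR c0|X Y lt cX IH|X Y eX XR IH].
- rewrite big_geq // big_nat big1 // => x xr; rewrite steps_small // /col_label c0 /box_label; nia.
- have XR : (X.+1 < R.+1)%N by have := lam_leR (ltn0Sn Y); lia.
  under eq_bigr do rewrite big_ltn //.
  rewrite big_split /= IH [in RHS]big_ltn // (_ : steps _ _ = 0) ?add0r; last first.
    by rewrite steps_small // /col_label cX labS1; lia.
  have YN : (Y.+1 <= N)%N by rewrite leqNgt; apply/negP => /lam_out; lia.
  have tel := path_telescope (steps (box_label X Y.+1)) YN (X := X.+1).
  have side : (lam Y.+2 <= X.+1 <= R)%N.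
    by have := col_le (ltn0Sn X) (ltn0Sn Y.+1); rewrite cX; lia.
  have {}tel := tel side lt.
  rewrite (steps_small (p := box_label X.+1 Y.+1)) ?add0r in tel; last by rewrite labS1; lia.
  rewrite (steps_small (p := box_label R 0)) ?add0r in tel; last first.
    rewrite /box_label muln0; have := fit Y.+1 isT; have := ltn_pmod l n_gt0.
    have := divn_eq l n; rewrite -/R; nia.
  rewrite (eq_big_nat _ _ (F2 := fun y =>
    - (steps (box_label X Y.+1) (row_label y + m%:Z) - steps (box_label X Y.+1) (row_label y)))); last first.
    move=> y yr; rewrite (_ : (X < lam y)%N); last by have := mono y Y.+1; lia.
    by rewrite steps_add /col_label cX labS1 subrK; ring.
  rewrite sumrN tel.
  rewrite -sumrN -big_split; apply: eq_bigr => x _ /=.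
  rewrite /steps labS1.
  have -> : (box_label X Y.+1 <= col_label x + n%:Z) = (box_label X Y.+1 - n%:Z <= col_label x) by lia.
  have -> : col_label x + n%:Z - box_label X Y.+1 = col_label x - (box_label X Y.+1 - n%:Z) by lia.
  ring.
- rewrite big_nat_recr //= IH -big_split; apply: eq_big_nat => x xr /=.
  rewrite (_ : (x <= lam Y.+1)%N = false); last by lia.
  rewrite /row_label -eX labS2 subrK.
  have := steps_add (box_label X Y - m%:Z) (col_label x - m%:Z); rewrite subrK => ->.
  congr (_ + _); last by congr (_%:R); congr nat_of_bool; lia.
  rewrite /steps; have -> : (box_label X Y - m%:Z <= col_label x - m%:Z) = (box_label X Y <= col_label x) by lia.
  by congr (if _ then (_ %/ _)%Z else _); lia.
Qed.

End PathIdentity.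

(** * Semimodules *)

Lemma card_uniq (T : choiceType) (A : set T) (r : seq T) :
  uniq r -> (forall z, A z <-> z \in r) -> Defs.card A = size r.
Proof.
move=> ur Ar; rewrite /Defs.card (_ : A = [set` [fset z in r]%fset]).
  rewrite set_fsetK.
  have -> : #|` [fset z in r]%fset| = size (undup r).
    by rewrite card_fseq.
  by rewrite undup_id.
by apply/seteqP; split => z /=; rewrite inE /= => /Ar.
Qed.

Lemma card_pairs (T : choiceType) (A : set T) (f : nat -> nat -> T) (P : nat -> nat -> bool) M1 M2 :
  (forall x y x' y', (0 < x <= M1)%N -> (0 < y <= M2)%N -> (0 < x' <= M1)%N -> (0 < y' <= M2)%N ->
     f x y = f x' y' -> x = x' /\ y = y') ->
  (forall z, A z <-> exists x y, [/\ (0 < x <= M1)%N, (0 < y <= M2)%N, P x y & z = f x y]) ->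
  Defs.card A = (\sum_(1 <= y < M2.+1) \sum_(1 <= x < M1.+1) P x y)%N.
Proof.
move=> f_inj AP.
pose r := [seq p <- [seq (x, y) | y <- iota 1 M2, x <- iota 1 M1] | P p.1 p.2].
have rP p : p \in r -> [/\ (0 < p.1 <= M1)%N, (0 < p.2 <= M2)%N & P p.1 p.2].
  rewrite mem_filter => /andP[Pp /allpairsP[[y x] [/= + + e]]]; rewrite e /= in Pp *.
  by rewrite !mem_iota => ? ?; split; lia.
rewrite (@card_uniq _ A [seq f p.1 p.2 | p <- r]).
- rewrite size_map size_filter -sum1_count big_mkcond big_allpairs_dep /=.
  rewrite /index_iota !subSS !subn0; apply: eq_bigr => y _.
  by apply: eq_bigr => x _; case: (P x y).
- rewrite map_inj_in_uniq; last first.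
    move=> [x y] [x' y'] /rP[/= ? ? _] /rP[/= ? ? _] /f_inj[] // -> ->; by [].
  rewrite filter_uniq // allpairs_uniq ?iota_uniq // => -[? ?] [? ?] _ _ /= [-> ->]; by [].
move=> z; rewrite AP; split=> [[x [y [hx hy Pxy ->]]]|/mapP[[x y] /rP[/= ? ? ?] ->]]; last by exists x, y.
apply/mapP; exists (x, y) => //; rewrite mem_filter Pxy /=.
by apply/allpairsP; exists (y, x); rewrite !mem_iota /=; split=> //; lia.
Qed.

Section Semimodule.
Variables (m n l : nat) (lam : nat -> nat).
Hypotheses (m_gt0 : (0 < m)%N) (n_gt0 : (0 < n)%N) (co_mn : coprime m n).
Hypothesis l_lt : (l < m * n)%N.
Hypothesis lam_fits : fits m n l lam.

Local Notation N := (l %/ m)%N.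
Local Notation R := (l %/ n)%N.
Local Notation lab := (box_label m n l).
Local Notation gen := (row_label m n l lam).
Local Notation colend := (col_label m n l lam).
Local Notation col := (col_height m l lam).

Definition diagram : set box :=
  [set b | [/\ (1 <= b.1)%N, (1 <= b.2)%N & (b.1 <= lam b.2)%N]].

Definition Delta : set int :=
  [set i | 0 <= i /\ (Gamma m n (i + m%:Z * n%:Z - l%:Z - (n%:Z + m%:Z)) \/
     exists x y, [/\ (0 < x)%N, (0 < y)%N, (x <= lam y)%N & i = lab x y])].

Lemma R_lt_m : (R < m)%N.
Proof. by rewrite ltn_divLR. Qed.

Lemma N_lt_n : (N < n)%N.
Proof. by rewrite ltn_divLR // mulnC. Qed.

(** By coprimality, boxes with equal labels differ by a multiple of (m, -n). *)
Lemma lab_inj x y x' y' : (x < x' + m)%N -> (x' < x + m)%N ->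
  lab x y = lab x' y' -> x = x' /\ y = y'.
Proof.
move=> h1 h2 e; have e1 : (n * x + m * y = n * x' + m * y')%N by rewrite /box_label in e; lia.
have xx : x = x'.
  wlog le : x y x' y' h1 h2 e1 {e} / (x <= x')%N.
    move=> W; have [le|/ltnW le] := leqP x x'; first exact: (W x y x' y').
    by rewrite (W x' y' x y).
  have : (m %| n * (x' - x))%N.
    apply/dvdnP; exists (y - y')%N; rewrite mulnBl mulnBr; nia.
  rewrite Gauss_dvdr // => /dvdn_leq; lia.
by split=> //; subst; nia.
Qed.

(* Every integer is n u + m b with 0 <= u < m, and it lies outside the semigroup
   exactly when b < 0. *)
Lemma gamma_lab (i : int) :
  ~ Gamma m n (i + m%:Z * n%:Z - l%:Z - (n%:Z + m%:Z)) ->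
  exists x y, [/\ (0 < x <= m)%N, (0 < y)%N & i = lab x y].
Proof.
set v := (i + _ - _ - _) => nG.
have [u [a ub]] : exists u a : int, v = n%:Z * u + m%:Z * a.
  have /coprimezP[[u a] /= e] : coprimez n m by rewrite coprimezE /= coprime_sym.
  exists (v * u), (v * a); rewrite -[LHS]mulr1 -e; ring.
pose u0 := (u %% m%:Z)%Z; pose b := a + n%:Z * (u %/ m%:Z)%Z.
have ve : v = n%:Z * u0 + m%:Z * b.
  rewrite ub {1}(divz_eq u m%:Z) /b /u0; ring.
have u0r : 0 <= u0 < m%:Z by rewrite modz_ge0 ?ltz_pmod //; lia.
have b0 : b < 0.
  rewrite ltNge; apply/negP => b0; apply: nG; exists `|u0|%N, `|b|%N; rewrite ve; lia.
exists (m - `|u0|)%N, `|b|%N; split; [lia|lia|].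
have : i = v - m%:Z * n%:Z + l%:Z + (n%:Z + m%:Z) by rewrite /v; ring.
rewrite /box_label ve; move: u0r b0; clear; nia.
Qed.

(** Amounts to mn having no representation n u + m v with u and v positive, again by coprimality. *)
Lemma lab_not_gamma x y : (0 < x)%N -> (0 < y)%N ->
  ~ Gamma m n (lab x y + m%:Z * n%:Z - l%:Z - (n%:Z + m%:Z)).
Proof.
move=> x0 y0 [x' [y' e]].
have {}e : (n * (x + x') + m * (y + y') = m * n)%N by rewrite /box_label in e; lia.
have : (m %| n * (x + x'))%N by apply/dvdnP; exists (n - (y + y'))%N; rewrite mulnBl; lia.
rewrite Gauss_dvdr // => /dvdn_leq; nia.
Qed.

Lemma lab_ge0_m x y : (0 < y)%N -> 0 <= lab x y -> (x <= m)%N.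
Proof. by rewrite /box_label => y0 h; rewrite -ltnS -(ltn_pmul2l n_gt0); nia. Qed.

Lemma lab_ge0_N x y : (0 < x)%N -> 0 <= lab x y -> (y <= N.+1)%N.
Proof.
rewrite /box_label => x0 h; have : (y.-1 <= N)%N by rewrite leq_divRL //; nia.
lia.
Qed.

Lemma gaps_lab k : gaps Delta k <->
  exists x y, [/\ (0 < x)%N, (0 < y)%N, (lam y < x)%N, 0 <= lab x y & k = lab x y].
Proof.
split=> [[k0 nD]|[x [y [x0 y0 xy l0 ->]]]].
  have nG : ~ Gamma m n (k + m%:Z * n%:Z - l%:Z - (n%:Z + m%:Z)).
    by move=> G; apply: nD; split=> //; left.
  have [x [y [x0 y0 e]]] := gamma_lab nG.
  exists x, y; split=> //; [lia| |by rewrite -e].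
  rewrite ltnNge; apply/negP => le; apply: nD; split=> //; right.
  by exists x, y; split=> //; lia.
split=> // -[_ [/lab_not_gamma|[x' [y' [x'0 y'0 x'l e]]]]]; first exact.
have xm := lab_ge0_m y0 l0.
have x'm : (x' < m)%N by have := lam_leR m_gt0 n_gt0 lam_fits y'0; have := R_lt_m; lia.
have [ex ey] : x = x' /\ y = y' by apply: lab_inj e; lia.
by subst; lia.
Qed.

Lemma Delta_lab x y : (0 < x)%N -> (0 < y)%N -> 0 <= lab x y ->
  Delta (lab x y) <-> (x <= lam y)%N.
Proof.
move=> x0 y0 l0; split=> [D|le]; last by split=> //; right; exists x, y.
rewrite leqNgt; apply/negP => lt.
have /gaps_lab[_] : exists x' y', [/\ (0 < x')%N, (0 < y')%N, (lam y' < x')%N, 0 <= lab x' y' & lab x y = lab x' y'] by exists x, y.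
by apply.
Qed.

(** The axes belong to the shifted Gamma, so moving left or down from a box of the diagram never
    leaves [Delta]. *)
Lemma Delta_lab0y y : (0 < y <= n)%N -> 0 <= lab 0 y -> Delta (lab 0 y).
Proof.
move=> yn l0; split=> //; left; exists 0%N, (n - y)%N; rewrite /box_label.
by rewrite muln0 add0n mulnBr; nia.
Qed.

Lemma Delta_labx0 x : (x <= m)%N -> 0 <= lab x 0 -> Delta (lab x 0).
Proof.
move=> xm l0; split=> //; left; exists (m - x)%N, 0%N; rewrite /box_label.
by rewrite muln0 addn0 mulnBr; nia.
Qed.

Lemma gen_ge y : (0 < y <= N)%N -> (n + m)%N%:Z <= gen y.
Proof.
move=> yN; have [_ fit] := lam_fits; rewrite /row_label /box_label.
have : (y * m <= l)%N by rewrite -leq_divRL //; lia.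
have := fit y; case: (posnP (lam y)) => [->|]; nia.
Qed.

(** The empty row [N.+1] still gives an n-generator, the one in [n, n + m). *)
Lemma gen_top : gen N.+1 = (n + l %% m)%N%:Z.
Proof.
rewrite /row_label (lam_out m_gt0 n_gt0 lam_fits) // /box_label.
by have := divn_eq l m; nia.
Qed.

Lemma gen_inj y y' : (0 < y)%N -> (0 < y')%N -> gen y = gen y' -> y = y'.
Proof.
move=> y0 y'0; have := R_lt_m.
have := lam_leR m_gt0 n_gt0 lam_fits y0; have := lam_leR m_gt0 n_gt0 lam_fits y'0 => ? ? ?.
by case/lab_inj => //; lia.
Qed.

Lemma gen_ngen y : (0 < y <= N.+1)%N -> ngen n Delta (gen y).
Proof.
move=> yN; have [_ fit] := lam_fits.
have ym : (y.-1 * m <= l)%N by rewrite -leq_divRL //; lia.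
have l0 : 0 <= gen y - n%:Z.
  rewrite /row_label /box_label; have := fit y; case: (posnP (lam y)) => [->|]; nia.
split.
  rewrite /row_label; case: (posnP (lam y)) => [e|ly]; last first.
    apply/Delta_lab => //; [lia|]; rewrite /row_label in l0; lia.
  by rewrite e; apply: Delta_lab0y; rewrite /row_label e in l0; have := N_lt_n; lia.
rewrite /row_label -labS1 //.
have /gaps_lab[] : exists x' y', [/\ (0 < x')%N, (0 < y')%N, (lam y' < x')%N, 0 <= lab x' y' & lab (lam y).+1 y = lab x' y'] .
  exists (lam y).+1, y; split=> //; first by lia.
  by rewrite labS1.
by [].
Qed.

Lemma ngen_gen k : ngen n Delta k -> n%:Z <= k ->
  exists2 y, (0 < y <= N.+1)%N & k = gen y.
Proof.
move=> [Dk nD] nk; have /gaps_lab[x [y [x0 y0 lx l0 e]]] : gaps Delta (k - n%:Z).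
  by split=> //; lia.
have yN := lab_ge0_N x0 l0.
exists y; first by lia.
case: x x0 lx l0 e => // x _ lx l0; rewrite labS1 => /addIr e.
rewrite e /row_label; congr lab.
case: (posnP x) => [x0|x0]; first by lia.
have : (x <= lam y)%N by apply/Delta_lab => //; rewrite -?e //; lia.
by lia.
Qed.

End Semimodule.

(** * The statistics of a partition and of its semimodule *)

Section Statistics.
Variables (m n l : nat) (lam : nat -> nat).
Hypotheses (m_gt0 : (0 < m)%N) (n_gt0 : (0 < n)%N) (co_mn : coprime m n).
Hypothesis l_lt : (l < m * n)%N.
Hypothesis lam_fits : fits m n l lam.

Local Notation N := (l %/ m)%N.
Local Notation R := (l %/ n)%N.
Local Notation lab := (box_label m n l).
Local Notation gen := (row_label m n l lam).
Local Notation colend := (col_label m n l lam).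
Local Notation col := (col_height m l lam).
Local Notation Delta := (Delta m n l lam).
Local Notation diagram := (diagram lam).

Lemma sum_nat_window c q M : (c + q <= M)%N ->
  (\sum_(1 <= y < M.+1) (c < y <= c + q) = q)%N.
Proof.
move=> cq; rewrite (big_cat_nat (n := c.+1)) //=; last by lia.
rewrite (big_cat_nat (n := (c + q).+1) (m := c.+1)) //=; try lia.
rewrite big_nat big1 => [|y yr]; last by lia.
rewrite add0n [X in (_ + X)%N]big_nat [X in (_ + X)%N]big1 => [|y yr]; last by lia.
rewrite addn0 (eq_big_nat _ _ (F2 := fun=> 1%N)) => [|y yr]; last by lia.
by rewrite sum_nat_const_nat; lia.
Qed.

(** The boxes of column x above the diagram have labels [colend x - m], [colend x - 2m], and so on;
    the bound a >= n + m keeps those counted in rows up to N. *)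
Lemma steps_count x (a : int) : (0 < x)%N -> (n + m)%N%:Z <= a ->
  \sum_(1 <= y < N.+1) (((lam y < x)%N && (a <= lab x y)) : nat)%:Z =
  steps m a (colend x).
Proof.
move=> x0 an; set B := colend x; set c := col x.
have cN : (c <= N)%N by have := count_size (fun y => (x <= lam y)%N) (iota 1 N); rewrite size_iota.
have s0 : 0 <= steps m a B.
  by rewrite /steps; case: ifP => // h; rewrite divz_ge0 //; lia.
pose q := `|steps m a B|%N; have qE : steps m a B = q%:Z by rewrite /q; lia.
have labB y : (c <= y)%N -> lab x y = B - (m * (y - c))%N%:Z.
  by move=> cy; rewrite /B /col_label /box_label -/c mulnBr; nia.
have cond y : (c < y)%N -> (a <= lab x y) = (y <= c + q)%N.
  move=> cy; rewrite labB; last by lia.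
  have -> : (y <= c + q)%N = ((y - c)%N%:Z <= steps m a B) by rewrite qE; lia.
  rewrite /steps; case: ifP => aB; last by nia.
  by rewrite lez_divRL ?ltz_nat //; nia.
rewrite qE -(@sum_nat_window c q N).
  rewrite (big_morph Posz PoszD erefl).
  apply: eq_big_nat => y /andP[y1 yN]; congr (nat_of_bool _)%:Z.
  have := col_le m_gt0 n_gt0 lam_fits x0 y1; rewrite -/c => e.
  rewrite ltnNge -e -ltnNge; case: (ltnP c y) => //= cy; exact: cond.
case: (posnP q) => [->|q0]; first by rewrite addn0.
have := cond (c + q)%N; rewrite leqnn => /(_ _)/esym h.
have {h} : a <= lab x (c + q)%N by rewrite -h //; lia.
by rewrite leq_divRL // /box_label; nia.
Qed.

Lemma window_count x (a b : int) : (0 < x)%N -> (n + m)%N%:Z <= a -> a <= b ->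
  \sum_(1 <= y < N.+1) (((lam y < x)%N && (a <= lab x y < b)) : nat)%:Z =
  steps m a (colend x) - steps m b (colend x).
Proof.
move=> x0 an ab; rewrite -!steps_count //; last by lia.
rewrite -sumrB; apply: eq_bigr => y _.
by case: (lam y < x)%N => //=; lia.
Qed.

(** The gaps that are at least n + m are the labels of the boxes of tau outside the diagram. *)
Lemma card_gaps (p : int -> bool) :
  Defs.card [set k | [/\ gaps Delta k, n%:Z + m%:Z <= k & p k]] =
  (\sum_(1 <= y < N.+1) \sum_(1 <= x < R.+1)
    ((lam y < x) && ((n + m)%N%:Z <= lab x y)%R && p (lab x y)))%N.
Proof.
apply: (card_pairs (f := lab)) => [x y x' y' xr yr xr' yr'|k].
  have Rm := R_lt_m n_gt0 l_lt.
  by apply: lab_inj => //; lia.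
split=> [[/(gaps_lab m_gt0 n_gt0 co_mn l_lt lam_fits)[x [y [x0 y0 xy l0 ->]]] nk pk]|].
  exists x, y; split=> //.
  - by rewrite x0 leq_divRL //; move: nk; rewrite /box_label; nia.
  - by rewrite y0 leq_divRL //; move: nk; rewrite /box_label; nia.
  - by rewrite xy pk andbT; move: nk; lia.
move=> [x [y [xr yr /andP[/andP[xy nk] pk] ->]]]; split=> //.
by apply/(gaps_lab m_gt0 n_gt0 co_mn l_lt lam_fits); exists x, y; split=> //; lia.
Qed.

Lemma Posz_sum2 M1 M2 (F : nat -> nat -> bool) :
  ((\sum_(1 <= y < M2) \sum_(1 <= x < M1) F x y)%N)%:Z =
  \sum_(1 <= y < M2) \sum_(1 <= x < M1) (F x y : nat)%:Z.
Proof.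
rewrite (big_morph Posz PoszD erefl); apply: eq_bigr => y _.
by rewrite (big_morph Posz PoszD erefl).
Qed.

Lemma area'_sum : (area' m n Delta)%:Z = \sum_(1 <= x < R.+1) steps m (n + m)%N%:Z (colend x).
Proof.
rewrite /area' (_ : [set k | _] = [set k | [/\ gaps Delta k, n%:Z + m%:Z <= k & xpredT k]]); last first.
  by apply/seteqP; split=> k [h1 h2]; split.
rewrite card_gaps Posz_sum2 exchange_big; apply: eq_big_nat => x xr.
rewrite -steps_count //; last by lia.
by apply: eq_bigr => y _; rewrite andbT.
Qed.

Lemma card_window v : (n%:Z <= v) ->
  (Defs.card [set k | [/\ gaps Delta k, n%:Z + m%:Z <= k & v <= k <= v + m%:Z - 1]])%:Z =
  \sum_(1 <= x < R.+1) (steps m (Num.max v (n + m)%N%:Z) (colend x) - steps m (v + m%:Z) (colend x)).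
Proof.
move=> nv; rewrite card_gaps Posz_sum2 exchange_big; apply: eq_big_nat => x xr.
rewrite -window_count //; [|lia|lia|lia].
by apply: eq_bigr => y _; congr (nat_of_bool _)%:Z; lia.
Qed.

Lemma ngen_low v : ngen n Delta v -> v < n%:Z ->
  Defs.card [set k | [/\ gaps Delta k, n%:Z + m%:Z <= k & v <= k <= v + m%:Z - 1]] = 0%N.
Proof.
move=> _ vn; rewrite (@card_uniq _ _ [::]) // => k; split=> // -[_ h1 h2]; lia.
Qed.

(** The only n-generator in [n, n + m) is the label of the empty row [N.+1], so the binomial
    coefficient in [codinv'] vanishes. *)
Lemma xi_m1 : xi m n Delta (-1) = 1%N.
Proof.
have N0 : (0 < N.+1 <= N.+1)%N by rewrite leqnn.
have top := gen_top m_gt0 n_gt0 co_mn l_lt lam_fits.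
rewrite /xi (@card_uniq _ _ [:: gen N.+1]) // => k; rewrite inE; split=> [[kg kr]|/eqP ->].
  have [|y yN e] := ngen_gen m_gt0 n_gt0 co_mn l_lt lam_fits kg; first by lia.
  have [yle|yge] := leqP y N; last by rewrite e (_ : y = N.+1) //; lia.
  have := gen_ge m_gt0 n_gt0 co_mn l_lt lam_fits (y := y); rewrite -e; lia.
split; first exact: gen_ngen.
by rewrite top; have := ltn_pmod l m_gt0; lia.
Qed.

(** The labels of a column above the diagram are spaced by m, so the window of a row contains at
    most one of them, and one exactly when [gen y + m <= colend x]. The last sum is the window of
    the empty row [N.+1], cut off below at n + m and ending at [gen N.+1 + m = lab 0 N]. *)
Lemma codinv'_sum : codinv' m n Delta =
  \sum_(1 <= y < N.+1) \sum_(1 <= x < R.+1) (gen y + m%:Z <= colend x)%R%:R +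
  \sum_(1 <= x < R.+1) (steps m (n + m)%N%:Z (colend x) - steps m (lab 0 N) (colend x)).
Proof.
have top := gen_top m_gt0 n_gt0 co_mn l_lt lam_fits.
rewrite /codinv' xi_m1 subr0.
(* Generators below n have windows that end before n + m and contribute 0; the remaining ones are
   the rows 1 to [N.+1]. *)
rewrite (fsbigE (map gen (iota 1 N.+1))); last 3 first.
- rewrite map_inj_in_uniq ?iota_uniq // => y y'; rewrite !mem_iota => yr yr'.
  by apply: gen_inj => //; lia.
- by move=> v /mapP[y]; rewrite mem_iota => yr ->; apply: gen_ngen => //; lia.
- move=> v gv vN; rewrite ngen_low // ltNge; apply/negP => nv.
  have [y yN e] := ngen_gen m_gt0 n_gt0 co_mn l_lt lam_fits gv nv.
  by case/negP: vN; apply/mapP; exists y => //; rewrite mem_iota; lia.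
rewrite big_map [RHS]addrC.
transitivity (\sum_(y <- iota 1 N.+1) (Defs.card [set k | [/\ gaps Delta k, n%:Z + m%:Z <= k
      & gen y <= k <= gen y + m%:Z - 1]])%:Z).
  rewrite big_seq_cond [RHS]big_seq; apply: eq_bigl => y.
  have [|//] := boolP (y \in iota 1 N.+1); rewrite mem_iota => yr.
  by rewrite andTb; apply/asboolP; apply: gen_ngen => //; lia.
have -> : iota 1 N.+1 = index_iota 1 N.+2 by rewrite /index_iota subSS subn0.
rewrite big_nat_recr //= [LHS]addrC; congr (_ + _).
  rewrite card_window; last by rewrite top; lia.
  apply: eq_bigr => x _; congr (steps m _ _ - steps m _ _).
    by rewrite top; have := ltn_pmod l m_gt0; lia.
  rewrite top /box_label; have := divn_eq l m; nia.
apply: eq_big_nat => y yr.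
have gy : (n + m)%N%:Z <= gen y by apply: gen_ge => //; lia.
rewrite card_window; last by lia.
apply: eq_bigr => x _; rewrite (_ : Num.max _ _ = gen y); last by lia.
have := steps_add l m_gt0 n_gt0 (gen y) (colend x - m%:Z); rewrite subrK => ->.
have -> : steps m (gen y) (colend x - m%:Z) = steps m (gen y + m%:Z) (colend x).
  rewrite /steps; have -> : (gen y <= colend x - m%:Z) = (gen y + m%:Z <= colend x) by lia.
  by congr (if _ then (_ %/ _)%Z else _); lia.
rewrite addrAC subrr add0r; congr (nat_of_bool _)%:R; lia.
Qed.

Lemma arm_diagram x y : (0 < x)%N -> (0 < y)%N -> arm diagram (x, y) = (lam y - x)%N.
Proof.
move=> x0 y0; rewrite /arm (@card_uniq _ _ [seq (x', y) | x' <- iota x.+1 (lam y - x)]).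
- by rewrite size_map size_iota.
- by rewrite map_inj_uniq ?iota_uniq // => ? ? [].
move=> [a b]; split=> /= [[[/= a1 b1 ab] eb xa]|/mapP[x' + [-> ->]]].
  by subst b; apply/mapP; exists a => //; rewrite mem_iota; lia.
by rewrite mem_iota => h; split=> //=; [split => //=|]; lia.
Qed.

Lemma leg_diagram x y : (0 < x)%N -> (0 < y)%N -> leg diagram (x, y) = (col x - y)%N.
Proof.
move=> x0 y0; rewrite /leg (@card_uniq _ _ [seq (x, y') | y' <- iota y.+1 (col x - y)]).
- by rewrite size_map size_iota.
- by rewrite map_inj_uniq ?iota_uniq // => ? ? [].
move=> [a b]; split=> /= [[[/= a1 b1 ab] ea yb]|/mapP[y' + [-> ->]]].
  subst a; apply/mapP; exists b => //; rewrite mem_iota.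
  by rewrite -(col_le m_gt0 n_gt0 lam_fits) // in ab; lia.
rewrite mem_iota => h; split=> //=; last by lia.
by split=> //=; [lia | rewrite -(col_le m_gt0 n_gt0 lam_fits) //; lia].
Qed.

Lemma card_diagram : (Defs.card diagram)%:Z =
  \sum_(1 <= y < N.+1) \sum_(1 <= x < R.+1) ((x <= lam y)%N : nat)%:Z.
Proof.
rewrite (@card_pairs _ _ (fun x y => (x, y)) (fun x y => (x <= lam y)%N) R N) ?Posz_sum2 //.
  by move=> ? ? ? ? _ _ _ _ [-> ->].
move=> [x y]; split=> [[/= x0 y0 xy]|[x' [y' [? ? ? [-> ->]]]]]; last by split=> /=; lia.
exists x, y; split=> //; have := lam_leR m_gt0 n_gt0 lam_fits y0; first by lia.
by move=> _; rewrite y0 leqNgt; apply/negP => /(lam_out m_gt0 n_gt0 lam_fits); lia.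
Qed.

(** Since [gen y - colend x] equals m leg - n arm, the two slope conditions become comparisons of
    labels. *)
Lemma dinv_sum (K : realType) (r s : K) : s / r = n%:R / m%:R ->
  (dinv r s diagram)%:Z =
  \sum_(1 <= y < N.+1) \sum_(1 <= x < R.+1)
    ([&& (x <= lam y)%N, ~~ (colend x + n%:Z <= gen y) & ~~ (gen y + m%:Z <= colend x)] : nat)%:Z.
Proof.
move=> sr; rewrite /dinv (@card_pairs _ _ (fun x y => (x, y))
  (fun x y => [&& (x <= lam y)%N, ~~ (colend x + n%:Z <= gen y) & ~~ (gen y + m%:Z <= colend x)]) R N) ?Posz_sum2 //.
  by move=> ? ? ? ? _ _ _ _ [-> ->].
have m0 : (0 : K) < m%:R by rewrite ltr0n.
have key x y : (0 < x)%N -> (0 < y)%N -> (x <= lam y)%N ->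
  ((leg diagram (x, y))%:R / ((arm diagram (x, y))%:R + 1) < s / r
    /\ (arm diagram (x, y) = 0%N \/ s / r <= ((leg diagram (x, y))%:R + 1) / (arm diagram (x, y))%:R))
  <-> ~~ (colend x + n%:Z <= gen y) && ~~ (gen y + m%:Z <= colend x).
  move=> x0 y0 xy; rewrite arm_diagram // leg_diagram // sr.
  have yc : (y <= col x)%N by rewrite (col_le m_gt0 n_gt0 lam_fits).
  set a := (lam y - x)%N; set b := (col x - y)%N.
  have E : gen y - colend x = (m * b)%N%:Z - (n * a)%N%:Z.
    by rewrite /row_label /col_label /box_label /a /b; nia.
  have aR : (a < m)%N.
    have := lam_leR m_gt0 n_gt0 lam_fits y0; have := R_lt_m n_gt0 l_lt; rewrite /a; lia.
  have c1 : (b%:R / (a%:R + 1) < n%:R / m%:R :> K) = (m * b < n * a.+1)%N.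
    rewrite natr1 ltr_pdivrMr ?ltr0n // mulrAC ltr_pdivlMr // -!natrM ltr_nat.
    by rewrite mulnC.
  have c2 : a <> 0%N -> (n%:R / m%:R <= (b%:R + 1) / a%:R :> K) = (n * a <= m * b.+1)%N.
    move=> a0; have a0' : (0 < a)%N by lia.
    rewrite natr1 ler_pdivrMr // mulrAC ler_pdivlMr ?ltr0n // -!natrM ler_nat.
    by rewrite [(b.+1 * m)%N]mulnC.
  (* Coprimality and arm < m rule out equality in the second slope condition, so the weak inequality
     may be read as strict. *)
  have ne : (n * a)%N <> (m * b.+1)%N.
    move=> e; have : (m %| n * a)%N by rewrite e dvdn_mulr.
    rewrite Gauss_dvdr //; case: (posnP a) => [a0|a0 /dvdn_leq]; last by lia.
    by move: e; rewrite a0 muln0 => /esym/eqP; rewrite muln_eq0; lia.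
  rewrite c1; have [a0|a0] := eqVneq a 0%N.
    rewrite a0 in E *; split=> [[h _]|h]; last by split; [lia | left].
    by nia.
  rewrite (c2 (elimN eqP a0)); split=> [[h [|h2]]|h]; [by move/eqP: a0|by nia|].
  by split; [nia|right; nia].
move=> [x y]; split=> [[[/= x0 y0 xy] h1 h2]|[x' [y' [xr yr /andP[xy h] [-> ->]]]]].
  exists x, y; split=> //; last by rewrite xy; apply/key.
  - by have := lam_leR m_gt0 n_gt0 lam_fits y0; lia.
  - by rewrite y0 leqNgt; apply/negP => /(lam_out m_gt0 n_gt0 lam_fits); lia.
have [h1 h2] := (key x' y' (proj1 (andP xr)) (proj1 (andP yr)) xy).2 h.
by split=> //; split=> //=; [case/andP: xr | case/andP: yr].
Qed.

(** Taken at (0, N), [path_identity] has threshold [lab 0 N], the one left over in [codinv'_sum].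
    The rest is compared box by box, the two excluded conditions of [dinv_sum] being mutually
    exclusive. *)
Theorem dinv_codinv (K : realType) (r s : K) : s / r = n%:R / m%:R ->
  (dinv r s diagram)%:Z + codinv' m n Delta = (Defs.card diagram)%:Z + (area' m n Delta)%:Z.
Proof.
move=> sr; rewrite (dinv_sum sr) codinv'_sum card_diagram area'_sum sumrB.
rewrite -(path_identity m_gt0 n_gt0 lam_fits (X := 0) (leqnn N)); first last.
- by case: eqP.
- by rewrite (lam_out m_gt0 n_gt0 lam_fits) //= leq0n.
have alg (a b c d e : int) : a + b - d = e -> a + (b + (c - d)) = e + c by lia.
apply: alg; rewrite -big_split -sumrB; apply: eq_bigr => y _.
rewrite -big_split -sumrB; apply: eq_bigr => x _ /=.
case: (x <= lam y)%N => /=; last by rewrite add0r subrr.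
case: (boolP (_ + n%:Z <= _)) => h1; case: (boolP (_ + m%:Z <= _)) => h2 //=; lia.
Qed.

End Statistics.

(** * Cogenerators and the product over rows *)

Section Cogenerators.
Variables (m n l : nat) (lam : nat -> nat).
Hypotheses (m_gt0 : (0 < m)%N) (n_gt0 : (0 < n)%N) (co_mn : coprime m n).
Hypothesis l_lt : (l < m * n)%N.
Hypothesis lam_fits : fits m n l lam.

Local Notation N := (l %/ m)%N.
Local Notation R := (l %/ n)%N.
Local Notation lab := (box_label m n l).
Local Notation gen := (row_label m n l lam).
Local Notation Delta := (Delta m n l lam).

Hypothesis N_gt0 : (0 < N)%N.
Hypothesis top_row : (l < n + m * N)%N.

(* Row y carries the last box of its skew row, i.e. no row has label
   [gen y + m]; see [bottomP]. *)
Definition bottom (y : nat) : bool := (y == 1%N) || (lam y < lam y.-1)%N.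

Lemma gen_sub_n y : gen y - n%:Z = lab (lam y).+1 y.
Proof. by rewrite labS1. Qed.

Lemma lab_gen_ge0 y : (0 < y <= N)%N -> 0 <= lab (lam y).+1 y.
Proof.
move=> yr; rewrite -gen_sub_n.
by have := gen_ge m_gt0 n_gt0 co_mn l_lt lam_fits yr; lia.
Qed.

Lemma Delta_above y : (0 < y <= N)%N -> Delta (gen y - n%:Z + m%:Z) <-> bottom y.
Proof.
move=> yr; have l0 := lab_gen_ge0 yr; have lR := lam_leR m_gt0 n_gt0 lam_fits.
have Rm := R_lt_m n_gt0 l_lt.
rewrite gen_sub_n /bottom; case: y yr l0 => // y yr l0; rewrite labS2 subrK /=.
rewrite labS2 in l0.
case: y yr l0 => [|y] yr l0.
  split=> // _; apply: (Delta_labx0 lam m_gt0 n_gt0 co_mn l_lt); last by lia.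
  by have := lR 1%N isT; lia.
by rewrite (Delta_lab m_gt0 n_gt0 co_mn l_lt lam_fits) //; lia.
Qed.

Lemma cogenP k : cogen m n Delta k <->
  exists2 y, (0 < y <= N)%N && bottom y & k = gen y - n%:Z.
Proof.
split=> [[gk Dn Dm]|[y /andP[yr yb] ->]].
  have /(gaps_lab m_gt0 n_gt0 co_mn l_lt lam_fits)[x [y [x0 y0 xy l0 e]]] := gk.
  have yN := lab_ge0_N m_gt0 n_gt0 co_mn l_lt x0 l0.
  have ex : x = (lam y).+1.
    case: x x0 xy l0 e => // x _ xy l0 e; congr _.+1.
    move: Dn; rewrite e labS1 subrK; case: (posnP x) => [x0|x0]; first by lia.
    rewrite (Delta_lab m_gt0 n_gt0 co_mn l_lt lam_fits) //; first by lia.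
    by rewrite labS1 in l0; lia.
  have ek : k = gen y - n%:Z by rewrite gen_sub_n -ex.
  (* For row [N.+1], k + m is the label of the box (1, N), which [top_row] puts outside tau. *)
  have yN' : (y <= N)%N.
    rewrite leqNgt; apply/negP => lt; have ey : y = N.+1 by lia.
    move: Dm; rewrite ek gen_sub_n ey labS2 subrK (Delta_lab m_gt0 n_gt0 co_mn l_lt lam_fits) //.
      by have [_ /(_ N N_gt0)] := lam_fits; nia.
    by move: l0; rewrite ex ey labS2; lia.
  exists y => //; rewrite y0 yN' /=; apply/Delta_above; first by rewrite y0.
  by rewrite -ek.
have l0 := lab_gen_ge0 yr.
split; last exact/Delta_above.
  rewrite gen_sub_n; apply/(gaps_lab m_gt0 n_gt0 co_mn l_lt lam_fits).
  by exists (lam y).+1, y; split=> //; lia.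
by rewrite subrK; apply: (proj1 (gen_ngen m_gt0 n_gt0 co_mn l_lt lam_fits _)); lia.
Qed.

Lemma bottomP y : (0 < y <= N)%N ->
  bottom y = ~~ [exists j : 'I_N, gen j.+1 - gen y == m%:Z].
Proof.
move=> yr; have Rm := R_lt_m n_gt0 l_lt; have lR := lam_leR m_gt0 n_gt0 lam_fits.
have [mono _] := lam_fits.
apply/idP/existsPn => [yb j|h].
  apply/negP => /eqP e; have {}e : gen j.+1 = lab (lam y) y.-1.
    have : lab (lam y) y.-1 = gen y + m%:Z by case: y yr {yb e} => // y _; rewrite /row_label labS2 subrK.
    by lia.
  have [e1 e2] : lam j.+1 = lam y /\ j.+1 = y.-1.
    apply: (lab_inj m_gt0 n_gt0 co_mn l_lt _ _ e); have := lR j.+1 isT; have := lR y; lia.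
  by move: yb; rewrite /bottom -e2 e1 ltnn orbF; lia.
rewrite /bottom; case: eqP => //= y1.
have jN : (y.-2 < N)%N by lia.
have := h (Ordinal jN) => /=; rewrite (_ : y.-2.+1 = y.-1); last by lia.
apply: contraR; rewrite -leqNgt => le.
have e : lam y.-1 = lam y by have := mono y.-1 y; lia.
rewrite /row_label e {e le h}; case: y yr y1 jN => // y _ _ _.
by rewrite labS2; apply/eqP; rewrite /=; lia.
Qed.

Lemma xi_gen y : (0 < y <= N)%N -> bottom y ->
  xi m n Delta (gen y - n%:Z) = #|[pred j : 'I_N | 0 < gen j.+1 - gen y < m%:Z]|.
Proof.
move=> yr yb; have gy := gen_ge m_gt0 n_gt0 co_mn l_lt lam_fits yr.
pose r := [seq gen (nat_of_ord j).+1 | j <- enum [pred j : 'I_N | 0 < gen j.+1 - gen y < m%:Z]].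
have inj : injective (fun j : 'I_N => gen j.+1).
  by move=> i j /(gen_inj m_gt0 n_gt0 co_mn l_lt lam_fits) e; apply: val_inj; apply: succn_inj; apply: e.
rewrite /xi (@card_uniq _ _ r) ?size_map -?cardE //.
  by rewrite (map_inj_uniq inj) enum_uniq.
move=> k; split=> [[kg kr]|/mapP[j]].
  have [|y' y'r ek] := ngen_gen m_gt0 n_gt0 co_mn l_lt lam_fits kg; first by lia.
  have y'N : (y' <= N)%N.
    rewrite leqNgt; apply/negP => lt; have ey : y' = N.+1 by lia.
    move: kr; rewrite ek ey (gen_top m_gt0 n_gt0 co_mn l_lt lam_fits).
    by have := ltn_pmod l m_gt0; lia.
  (* The window of [xi] includes its right end gen y + m, but that is no n-generator when y is a
     bottom row. *)
  have kne : k != gen y + m%:Z.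
    apply/eqP => e; case: kg => _; apply; rewrite e.
    by have /Delta_above := yb; move=> /(_ yr); rewrite addrAC.
  have jN : (y'.-1 < N)%N by lia.
  have y'E : y'.-1.+1 = y' by lia.
  apply/mapP; exists (Ordinal jN); last by rewrite /= y'E.
  by rewrite mem_enum inE /= y'E; lia.
rewrite mem_enum inE => jr ->; split; last by lia.
by apply: gen_ngen => //; have := ltn_ord j; lia.
Qed.

Lemma cogen_prod (K : fieldType) (t : K) :
  \big[*%R/1]_(k \in cogen m n Delta) (1 + (t ^- xi m n Delta k)%:P * 'X) =
  \prod_(i < N) (1 + (if [exists j : 'I_N, gen j.+1 - gen i.+1 == m%:Z] then 0
    else (t^-1 ^+ #|[pred j : 'I_N | 0 < gen j.+1 - gen i.+1 < m%:Z]|)%:P * 'X)).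
Proof.
pose r := [seq gen i.+1 - n%:Z | i <- [seq i <- iota 0 N | bottom i.+1]].
have rP k : cogen m n Delta k <-> k \in r.
  rewrite cogenP; split=> [[y /andP[yr yb] ->]|/mapP[i]].
    apply/mapP; exists y.-1; rewrite ?mem_filter ?mem_iota ?prednK ?yb //=; lia.
  by rewrite mem_filter mem_iota => /andP[ib iN] ->; exists i.+1 => //; rewrite ib andbT; lia.
have -> : cogen m n Delta = [set` r] by apply/seteqP; split=> k /rP.
rewrite -fsbig_seq; last first.
  rewrite map_inj_in_uniq ?filter_uniq ?iota_uniq // => i j _ _ /addIr.
  by move=> /(gen_inj m_gt0 n_gt0 co_mn l_lt lam_fits) e; apply: succn_inj; apply: e.
rewrite big_map big_filter -{1}[N]subn0 big_mkord big_mkcond /=.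
apply: eq_bigr => i _; have ir : (0 < i.+1 <= N)%N by have := ltn_ord i; lia.
rewrite (bottomP ir); case: ifP => [nb|/negbFE ->]; last by rewrite addr0.
rewrite (negPf nb) xi_gen //; last by rewrite bottomP.
by rewrite exprVn.
Qed.

End Cogenerators.

(** * Partitions inside tau and semimodules *)

Section Bijection.
Variables (m n l : nat).
Hypotheses (m_gt0 : (0 < m)%N) (n_gt0 : (0 < n)%N) (co_mn : coprime m n).
Hypothesis l_lt : (l < m * n)%N.

Local Notation N := (l %/ m)%N.
Local Notation R := (l %/ n)%N.
Local Notation lab := (box_label m n l).
Local Notation Delta := (Delta m n l).
Local Notation G i := (Gamma m n (i + m%:Z * n%:Z - l%:Z - (n%:Z + m%:Z))).

Definition DeltaS (L : set box) : set int :=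
  [set i | 0 <= i /\ (G i \/ exists2 b, L b & i = lab b.1 b.2)].

Lemma DeltaS_diagram lam : DeltaS (diagram lam) = Delta lam.
Proof.
apply/seteqP; split=> i [i0 [Gi|D]]; try by split; [|left].
  by split=> //; right; case: D => -[x y] [/= x0 y0 xy] ->; exists x, y.
by split=> //; right; case: D => x [y [x0 y0 xy ->]]; exists (x, y).
Qed.

Lemma Gamma_addn v : Gamma m n v -> Gamma m n (v + n%:Z).
Proof. by move=> [x [y ->]]; exists x.+1, y; rewrite mulnS; lia. Qed.

Lemma Gamma_addm v : Gamma m n v -> Gamma m n (v + m%:Z).
Proof. by move=> [x [y ->]]; exists x, y.+1; rewrite mulnS; lia. Qed.

Lemma Delta_Inv lam : fits m n l lam -> Defs.Inv m n (Delta lam).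
Proof.
move=> Hf; have [mono fit] := Hf; have lR := lam_leR m_gt0 n_gt0 Hf.
have Rm := R_lt_m n_gt0 l_lt; have Nn := N_lt_n m_gt0 l_lt.
split=> k [k0 Dk] //; first (split; [lia|]).
  case: Dk => [/Gamma_addm Gk|[x [y [x0 y0 xy e]]]].
    by left; move: Gk; rewrite -!addrA; congr Gamma; lia.
  have -> : k + m%:Z = lab x y.-1 by rewrite e; case: y y0 {e xy} => // y _; rewrite labS2 subrK.
  have l0 : 0 <= lab x y.-1 by move: e k0; case: y y0 {xy} => // y _; rewrite labS2 /=; lia.
  case: (posnP y.-1) => [y1|y1].
    rewrite y1 in l0 *; apply: (proj2 (Delta_labx0 lam m_gt0 n_gt0 co_mn l_lt _ l0)).
    by have := lR _ y0; lia.
  by right; exists x, y.-1; split=> //; have := mono y.-1 y; lia.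
split; first by lia.
case: Dk => [/Gamma_addn Gk|[x [y [x0 y0 xy e]]]].
  by left; move: Gk; rewrite -!addrA; congr Gamma; lia.
have -> : k + n%:Z = lab x.-1 y by rewrite e; case: x x0 {e xy} => // x _; rewrite labS1 subrK.
have l0 : 0 <= lab x.-1 y by move: e k0; case: x x0 {xy} => // x _; rewrite labS1 /=; lia.
case: (posnP x.-1) => [x1|x1].
  rewrite x1 in l0 *; apply: (proj2 (Delta_lab0y lam m_gt0 n_gt0 co_mn l_lt _ l0)).
  rewrite y0 /=; apply: leq_trans Nn; rewrite leqW // leqNgt.
  by apply/negP => /(lam_out m_gt0 n_gt0 Hf); lia.
by right; exists x.-1, y; split=> //; lia.
Qed.

Lemma Delta_InvW lam : fits m n l lam -> InvW m n l (Delta lam).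
Proof.
move=> Hf; split; first exact: Delta_Inv.
move=> i ir; split=> [[_ [//|[x [y [x0 y0 xy e]]]]]|Gi]; last by split; [lia|left].
have [_ /(_ y y0)] := Hf; rewrite e /box_label in ir; nia.
Qed.

(** The least element of the shifted Gamma is below m + n, so from any k >= m + n one can subtract m
    or n inside it, down to the window where [InvW] prescribes D. *)
Lemma InvW_gamma D (k : nat) : InvW m n l D -> G k%:Z -> D k%:Z.
Proof.
move=> [[D0 Dm Dn] DW].
elim: k.+1 {-2}k (ltnSn k) => // B IH {}k kB Gk.
have [lt|ge] := ltnP k (m + n); first by apply/DW => //; lia.
have [x [y e]] := Gk.
case: x e => [|x] e.
  case: y e => [|y] e; first by move: e l_lt; nia.
  have -> : k%:Z = (k - m)%N%:Z + m%:Z by lia.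
  by apply: Dm; apply: IH; [lia|exists 0%N, y; rewrite mulnS in e; lia].
have -> : k%:Z = (k - n)%N%:Z + n%:Z by lia.
by apply: Dn; apply: IH; [lia|exists x, y; rewrite mulnS in e; lia].
Qed.

(** Adding n or m to a label moves one box left or down, so closure of D makes the boxes of tau with
    label in D a partition. *)
Lemma InvW_Delta D : InvW m n l D -> exists2 lam, fits m n l lam & D = Delta lam.
Proof.
move=> HD; have [[D0 Dm Dn] DW] := HD.
pose p (y x : nat) := (n * x + m * y <= l)%N && `[< D (lab x y) >].
pose lam y := count (p y) (iota 1 R).
have Dmul (d : nat) (k : int) j : (forall k', D k' -> D (k' + d%:Z)) -> D k -> D (k + (j * d)%N%:Z).
  move=> Dd Dk; elim: j => [|j IH]; first by rewrite mul0n addr0.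
  by have := Dd _ IH; rewrite mulSnr PoszD addrA.
have down x x' y : (0 < x <= x')%N -> p y x' -> p y x.
  move=> xr /andP[le /asboolP Dx]; apply/andP; split; first by nia.
  apply/asboolP; have -> : lab x y = lab x' y + ((x' - x) * n)%N%:Z by rewrite /box_label; nia.
  exact: Dmul.
have lamP x y : (0 < x <= R)%N -> (x <= lam y)%N = p y x.
  by move=> xr; apply: count_initial xr => i j ij; apply: down.
have lR y : (lam y <= R)%N by have := count_size (p y) (iota 1 R); rewrite size_iota.
have Hf : fits m n l lam.
  split=> [y y' yr|y y0 ly].
    case: (posnP (lam y')) => [-> //|l0].
    rewrite lamP ?l0 ?lR //.
    have : p y' (lam y') by rewrite -lamP ?leqnn // l0 lR.
    move=> /andP[le /asboolP Dx]; apply/andP; split; first by nia.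
    apply/asboolP.
    have -> : lab (lam y') y = lab (lam y') y' + ((y' - y) * m)%N%:Z by rewrite /box_label; nia.
    exact: Dmul.
  have : p y (lam y) by rewrite -lamP ?leqnn // ly lR.
  by case/andP.
exists lam => //; apply/seteqP; split=> i.
  move=> Di; split; first exact: D0.
  have [Gi|nG] := pselect (G i); [by left|right].
  have [x [y [/andP[x0 xm] y0 e]]] := gamma_lab m_gt0 n_gt0 co_mn l_lt nG.
  exists x, y; split=> //; have i0 := D0 _ Di.
  have [lt|ge] := ltP i (m%:Z + n%:Z); first by case: nG; apply/DW => //; lia.
  have le : (n * x + m * y <= l)%N by rewrite e /box_label in ge; lia.
  have xR : (x <= R)%N by rewrite leq_divRL //; nia.
  by rewrite lamP ?x0 // /p le /=; apply/asboolP; rewrite -e.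
move=> [i0 [Gi|[x [y [x0 y0 xy ->]]]]].
  have ei : i = `|i|%N%:Z by lia.
  by rewrite ei; apply: InvW_gamma => //; rewrite -ei.
have : p y x by rewrite -lamP // x0; apply: leq_trans xy (lR y).
by case/andP => _ /asboolP.
Qed.

Section DyckPaths.
Variables (K : realType) (r s z : K).
Hypotheses (z_ge1 : 1 <= z) (l_def : l = Num.truncn z).
Hypotheses (def_r : r = z / n%:R) (def_s : s = z / m%:R).

Lemma tauE : tau r s = tau_mnl m n l.
Proof.
have z0 : 0 < z by apply: lt_le_trans z_ge1.
apply/seteqP; split=> -[x y] [/= x0 y0 h]; split=> //=; move: h;
  rewrite def_r def_s !invf_div !mulrA -mulrDl ler_pdivrMr // mul1r -!natrM -natrD
    l_def truncn_ge_nat ?(ltW z0) // [(x * n)%N]mulnC [(y * m)%N]mulnC //.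
Qed.

Lemma DyckP L : Dyck r s L <-> exists2 lam, fits m n l lam & L = diagram lam.
Proof.
rewrite /Dyck tauE /=; split=> [[[lam [mono [M lM] ->]] sub]|[lam Hf ->]].
  exists lam => //; split=> [y y' /andP[_ yy']|y y0 ly]; first exact: mono.
  by have := sub (lam y, y); case; [split | move=> /= _ _].
have [mono fit] := Hf; split.
  (* [fits] leaves the value at 0 free, while [is_partition] asks for monotonicity from 0 on; the
     value at 1 is repeated there. *)
  exists (fun y => lam (maxn y 1)); split.
  - by move=> y y' yy'; apply: mono; lia.
  - by exists N.+1; rewrite maxnC; apply: (lam_out m_gt0 n_gt0 Hf); lia.
  - apply/seteqP; split=> -[x y] [/= x0 y0]; rewrite (_ : maxn y 1 = y) //; lia.
by move=> [x y] [/= x0 y0 xy]; split=> //=; have := fit y y0; nia.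
Qed.

Lemma finite_Dyck : finite_set (Dyck r s).
Proof.
pose D (f : {ffun 'I_N -> 'I_R.+1}) : set box :=
  diagram (fun y => nth 0%N [seq val (f i) | i <- enum 'I_N] y.-1).
apply: (sub_finite_set (B := range D)); last exact: finite_image.
move=> L /DyckP[lam Hf ->].
have lt (i : 'I_N) : (lam i.+1 < R.+1)%N by rewrite ltnS; apply: (lam_leR m_gt0 n_gt0 Hf).
exists [ffun i => Ordinal (lt i)] => //.
have e y : (0 < y)%N ->
    nth 0%N [seq val ([ffun i => Ordinal (lt i)] i) | i <- enum 'I_N] y.-1 = lam y.
  case: y => // y _; have [yN|yN] := ltnP y N.
    by rewrite (nth_map (Ordinal yN)) ?size_enum_ord // -[y.+1.-1]/(val (Ordinal yN))
      nth_ord_enum ffunE.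
  by rewrite nth_default; [rewrite (lam_out m_gt0 n_gt0 Hf) | rewrite size_map size_enum_ord].
by apply/seteqP; split=> -[x y] [/= x0 y0 xy]; split=> //=; rewrite e in xy *.
Qed.

Lemma DeltaS_bij : set_bij (Dyck r s) (InvW m n l) DeltaS.
Proof.
split.
- by move=> L /DyckP[lam Hf ->]; rewrite DeltaS_diagram; apply: Delta_InvW.
- have sub lam lam' : fits m n l lam -> fits m n l lam' ->
      Delta lam = Delta lam' -> diagram lam `<=` diagram lam'.
    move=> Hf Hf' e [x y] [/= x0 y0 xy]; split=> //=.
    have l0 : 0 <= lab x y by have [_ /(_ y y0)] := Hf; rewrite /box_label; nia.
    apply/(Delta_lab m_gt0 n_gt0 co_mn l_lt Hf' x0 y0 l0); rewrite -e.
    by apply/(Delta_lab m_gt0 n_gt0 co_mn l_lt Hf x0 y0 l0).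
  move=> L L'; rewrite !inE => /DyckP[lam Hf ->] /DyckP[lam' Hf' ->].
  by rewrite !DeltaS_diagram => e; apply/seteqP; split; apply: sub.
move=> D /InvW_Delta[lam Hf ->]; exists (diagram lam); last exact: DeltaS_diagram.
by apply/DyckP; exists lam.
Qed.

End DyckPaths.
End Bijection.

(** * LLT polynomials as colour sums *)

Section LLTColorings.
Variables (R : realType) (eps : R) (p : nat) (nu : 'I_p -> {fset box}).
Variables (K : fieldType) (t : K).
Local Notation V := (tbox nu).
Variables (E W : rel V).
Hypothesis attackE : forall u v, attacking eps u v && (content eps u < content eps v) = E u v.
Hypothesis semistandardE : forall T : {ffun V -> nat},
  semistandard T <-> forall u v, W u v -> (T u <= T v)%N.

(** Fillings with entries below M are colourings; one that breaks a weak inequality has weight 0,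
    and the factors of E multiply to t to the number of inversions. *)
Lemma LLT_represents M : represents (LLT eps nu t)
  (colsum_weak (@lt_rel M) (fun i => 'X_i : {mpoly K[M]}) t E W).
Proof.
move=> a aM; rewrite /LLT /colsum_weak raddf_sum /=.
pose ok (k : {ffun V -> 'I_M}) := [forall u, forall v, W u v ==> (k u <= k v)%N] &&
  (\prod_u ('X_(k u) : {mpoly K[M]}) == 'X_[mnm_ord M a]).
pose h (k : {ffun V -> 'I_M}) : {ffun V -> nat} := [ffun u => val (k u)].
have wtE (k : {ffun V -> 'I_M}) : \prod_u ('X_(k u) : {mpoly K[M]}) =
    'X_[[multinom #|[set u | k u == i]%SET| | i < M]].
  rewrite -(big_morph (fun m => 'X_[m] : {mpoly K[M]}) (mpolyXD _) (mpolyX0 _ _)).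
  congr 'X_[_]; apply/mnmP => i; rewrite mnm_sumE mnmE -sum1_card [RHS]big_mkcond /=.
  by apply: eq_bigr => u _; rewrite mnm1E inE.
have okP k : reflect (semistandard (h k) /\ has_weight (h k) a) (ok k).
  apply: (iffP andP) => [[/forallP ss wt]|[/semistandardE ss wt]]; split.
  - apply/semistandardE => u v Wuv; rewrite !ffunE.
    by have /forallP /(_ v) /implyP := ss u; apply.
  - move: wt; rewrite wtE => /eqP /(congr1 (fun q : {mpoly K[M]} => q@_(mnm_ord M a))).
    rewrite !mcoeffX eqxx; case: eqP => [e _|_ /eqP]; last by rewrite eq_sym oner_eq0.
    move=> i; have [iM|Mi] := ltnP i M.
      have := congr1 (fun u : 'X_{1..M} => u (Ordinal iM)) e; rewrite /= !mnmE => <-.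
      by apply: eq_card => u; rewrite !inE ffunE -val_eqE.
    rewrite aM //; apply: eq_card0 => u; rewrite !inE ffunE.
    by apply/negbTE; have := ltn_ord (k u); rewrite neq_ltn => /leq_trans ->.
  - apply/forallP => u; apply/forallP => v; apply/implyP => /ss; by rewrite !ffunE.
  - rewrite wtE; apply/eqP; congr 'X_[_]; apply/mnmP => i; rewrite !mnmE -wt.
    by apply: eq_card => u; rewrite !inE ffunE -val_eqE.
rewrite (reindex_fsbig h [set` ok]); last first.
  split.
  - by move=> k /= /okP.
  - move=> k k' _ _ e; apply/ffunP => u; apply: val_inj.
    by have := congr1 (fun T : {ffun V -> nat} => T u) e; rewrite !ffunE.
  - move=> T /= [ss wt].
    have TM u : (T u < M)%N.
      rewrite ltnNge; apply/negP => /aM; rewrite -wt => /eqP; rewrite cards_eq0 => /eqP.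
      by move/finset.setP => /(_ u); rewrite finset.in_set0 inE eqxx.
    pose k : {ffun V -> 'I_M} := [ffun u => Ordinal (TM u)].
    have hk : h k = T by apply/ffunP => u; rewrite !ffunE.
    by exists k => //=; apply/okP; rewrite hk.
rewrite -(@bigfs _ _ _ _ (index_enum ({ffun V -> 'I_M} : finType)) ok) ?index_enum_uniq //; last first.
  by move=> k _; rewrite mem_index_enum.
rewrite big_mkcond; apply: eq_bigr => k _.
rewrite /ok; case: (boolP [forall u, _]) => [/forallP ss|]; last first.
  rewrite negb_forall => /existsP[u]; rewrite negb_forall => /existsP[v].
  rewrite negb_imply -ltnNge => /andP[Wuv lt].
  rewrite [X in (_ * X * _)@__](bigD1 (u, v)) //= /lt_rel Wuv lt /=.
  by rewrite mul0r mulr0 mul0r mcoeff0.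
rewrite [X in (_ * X * _)@__]big1 ?mulr1; last first.
  move=> [u v] _ /=; case: ifP => // /andP[Wuv]; rewrite /lt_rel ltnNge.
  by have /forallP /(_ v) /implyP /(_ Wuv) -> := ss u.
rewrite andTb.
have -> : \prod_q (if E q.1 q.2 && lt_rel (k q.1) (k q.2) then t%:A else 1) =
    (t ^+ inv_filling eps (h k))%:A :> {mpoly K[M]}.
  rewrite -big_mkcond prodr_const exprZn expr1n; congr (_ ^+ _ *: _).
  rewrite /inv_filling cardsE; apply: eq_card => -[u v]; rewrite /in_mem /=.
  by rewrite -attackE /lt_rel !ffunE andbA.
rewrite mulr_algl mcoeffZ wtE mcoeffX -wtE.
have -> : (\prod_u ('X_(k u) : {mpoly K[M]}) == 'X_[mnm_ord M a]) =
    ([multinom #|[set u | k u == i]%SET| | i < M] == mnm_ord M a).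
  rewrite wtE; apply/eqP/eqP => [/(congr1 (fun q : {mpoly K[M]} => q@_(mnm_ord M a)))|-> //].
  by rewrite !mcoeffX eqxx; case: eqP => // _ /eqP; rewrite eq_sym oner_eq0.
by case: eqP; rewrite ?mulr1 ?mulr0.
Qed.

End LLTColorings.

Lemma truncn_div (K : realType) (z : K) k : 0 <= z -> (0 < k)%N ->
  Num.truncn (z / k%:R) = (Num.truncn z %/ k)%N.
Proof.
move=> z0 k0; have k0' : (0 : K) < k%:R by rewrite ltr0n.
have /andP[le lt] := truncn_itv z0.
apply: truncn_def; rewrite ler_pdivlMr // ltr_pdivrMr // -!natrM; apply/andP; split.
  by apply: le_trans le; rewrite ler_nat leq_trunc_div.
by apply: lt_le_trans lt _; rewrite ler_nat ltn_ceil.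
Qed.

(** Same abscissa and larger residue, or next abscissa and smaller residue: the shape of the
    attacking condition on contents. *)
Lemma label_window (n m a b x y : nat) : (x < m)%N -> (y < m)%N ->
  (0 < (n + m * b + y)%N%:Z - (n + m * a + x)%N%:Z < m%:Z) =
  (a == b) && (x < y)%N || (b == a.+1) && (y < x)%N.
Proof.
move=> xm ym; case: (ltngtP a b) => [ab|ba|->].
- case: (eqVneq b a.+1) => [->|nab]; first by rewrite mulnS; lia.
  have : (m * a.+2 <= m * b)%N by rewrite leq_mul2l; lia.
  by rewrite !mulnS; lia.
- have : (m * b.+1 <= m * a)%N by rewrite leq_mul2l; lia.
  by rewrite mulnS; lia.
- by lia.
Qed.

(** * The boxes of the skew rows as rows of the partition *)

Section SkewRowsOfDiagram.
Variables (K : realType) (m n l : nat) (lam : nat -> nat) (z r s : K).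
Hypotheses (m_gt0 : (0 < m)%N) (n_gt0 : (0 < n)%N) (co_mn : coprime m n).
Hypothesis l_lt : (l < m * n)%N.
Hypothesis lam_fits : fits m n l lam.
Hypotheses (z_ge1 : 1 <= z) (l_def : l = Num.truncn z).
Hypotheses (def_r : r = z / n%:R) (def_s : s = z / m%:R).

Local Notation N := (l %/ m)%N.
Local Notation R := (l %/ n)%N.
Local Notation lab := (box_label m n l).
Local Notation gen := (row_label m n l lam).
Local Notation col := (col_height m l lam).
Local Notation diagram := (diagram lam).

Definition tcol (x : nat) : nat := ((l - n * x) %/ m)%N.
(** By [hgapE] this is m times the gap h_(x+1), up to a shift common to all x, so it orders the
    components. *)
Definition res (x : nat) : nat := ((l - n * x) %% m)%N.

Lemma z_ge0 : 0 <= z.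
Proof. by apply: le_trans z_ge1. Qed.

Lemma truncn_s : Num.truncn s = N.
Proof. by rewrite def_s truncn_div ?z_ge0 // -l_def. Qed.

Lemma rtildeE : rtilde r = R.+1.
Proof. by rewrite /rtilde def_r truncn_div ?z_ge0 // -l_def. Qed.

Lemma column_length_tau x : (0 < x)%N -> column_length (tau r s) x = tcol x.
Proof.
move=> x0; rewrite /column_length (tauE z_ge1 l_def def_r def_s).
rewrite (@card_uniq _ _ [seq (x, y) | y <- iota 1 (tcol x)]).
- by rewrite size_map size_iota.
- by rewrite map_inj_uniq ?iota_uniq // => ? ? [].
have le y : (0 < y)%N -> (y <= tcol x)%N = (n * x + m * y <= l)%N.
  move=> y0; rewrite /tcol leq_divRL //.
  by rewrite mulnC; have : (0 < m * y)%N; [rewrite muln_gt0 m_gt0 | lia].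
move=> [a b]; split=> /= [[[/= a0 b0 h] e]|/mapP[y + [-> ->]]].
  by subst a; apply/mapP; exists b => //; rewrite mem_iota add1n ltnS le ?b0.
by rewrite mem_iota add1n ltnS => /andP[y0]; rewrite le.
Qed.

Lemma tautildeE x : tautilde r s x.+1 = tcol x.
Proof.
rewrite /tautilde; case: x => [|x] /=; first by rewrite truncn_s /tcol muln0 subn0.
exact: column_length_tau.
Qed.

(** Column 0 reproduces the entry floor(s) that [lamtilde] puts in front of the column lengths. *)
Lemma col0 : col 0 = N.
Proof. by rewrite /col_height (eq_count (a2 := predT)) // count_predT size_iota. Qed.

Lemma col_leN x : (col x <= N)%N.
Proof. by have := count_size (fun y => (x <= lam y)%N) (iota 1 N); rewrite size_iota. Qed.

Lemma col_out x : (R < x)%N -> col x = 0%N.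
Proof.
move=> Rx; apply/eqP; rewrite -leqn0 leqNgt; apply/negP => c0.
have := col_le m_gt0 n_gt0 lam_fits (x := x) (y := 1); rewrite c0 => /(_ _ isT).
have := lam_leR m_gt0 n_gt0 lam_fits (y := 1) isT; lia.
Qed.

Lemma column_length_diagram x : (0 < x)%N -> column_length diagram x = col x.
Proof.
move=> x0; rewrite /column_length (@card_uniq _ _ [seq (x, y) | y <- iota 1 (col x)]).
- by rewrite size_map size_iota.
- by rewrite map_inj_uniq ?iota_uniq // => ? ? [].
move=> [a b]; split=> /= [[[/= a0 b0 h] e]|/mapP[y + [-> ->]]].
  by subst a; apply/mapP; exists b => //; rewrite mem_iota add1n ltnS b0 (col_le m_gt0 n_gt0 lam_fits).
by rewrite mem_iota add1n ltnS => /andP[y0]; rewrite (col_le m_gt0 n_gt0 lam_fits).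
Qed.

Lemma lamtildeE x : lamtilde r s diagram x.+1 = col x.
Proof.
rewrite /lamtilde rtildeE ltnS; case: x => [|x] /=; first by rewrite truncn_s col0.
by case: leqP => [h|_]; [rewrite col_out | exact: column_length_diagram].
Qed.

Lemma gammaP x (b : box) : (b \in gamma r s diagram x.+1) =
  [&& b.2 == 1%N, (tcol x - col x < b.1)%N & (b.1 <= tcol x - col x.+1)%N].
Proof.
rewrite /gamma in_fset_set; last first.
  apply: (sub_finite_set (B := [set` [seq (a, 1%N) | a <- iota 0 (tcol x).+1]])); last exact: finite_seq.
  move=> [a c] [/= -> _ h]; have aT : a \in iota 0 (tcol x).+1.
    by rewrite mem_iota add0n ltnS; apply: leq_trans h _; rewrite tautildeE leq_subr.
  exact: (map_f (fun a => (a, 1%N)) aT).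
apply/idP/and3P; rewrite inE /= !tautildeE !lamtildeE => -[h1 h2 h3]; split=> //.
  by rewrite h1.
exact/eqP.
Qed.

Lemma s_over_r : s / r = n%:R / m%:R.
Proof.
have z0 : z != 0 by rewrite gt_eqF // (lt_le_trans _ z_ge1).
rewrite def_r def_s; field.
by rewrite z0 !pnatr_eq0 -!lt0n m_gt0 n_gt0.
Qed.

Lemma hgapE x : (x <= R)%N -> hgap r s x.+1 = (res x)%:R / m%:R + (z - l%:R) / m%:R.
Proof.
move=> xR; rewrite /hgap tautildeE s_over_r -natr1 addrK def_s.
have m0 : m%:R != 0 :> K by rewrite pnatr_eq0 -lt0n.
have e : l%:R = (tcol x)%:R * m%:R + (res x)%:R + n%:R * x%:R :> K.
  rewrite -!natrM -!natrD -divn_eq subnK //.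
  by rewrite mulnC -leq_divRL.
rewrite e; field; exact: m0.
Qed.

(** The reason why the gaps are distinct: n is invertible modulo m, and R < m. *)
Lemma res_inj x x' : (x <= R)%N -> (x' <= R)%N -> res x = res x' -> x = x'.
Proof.
have Rm := R_lt_m n_gt0 l_lt.
have main a b : (a <= b <= R)%N -> res a = res b -> a = b.
  move=> /andP[ab bR] e.
  have lb : (n * b <= l)%N by rewrite mulnC -leq_divRL.
  have := divn_eq (l - n * a) m; have := divn_eq (l - n * b) m; rewrite -/(res a) -/(res b) e.
  set q := ((l - n * a) %/ m)%N; set q' := ((l - n * b) %/ m)%N => e1 e2.
  have nab : (n * a <= n * b)%N by rewrite leq_mul2l ab orbT.
  have : (m %| n * (b - a))%N by apply/dvdnP; exists (q - q')%N; rewrite mulnBr mulnBl; lia.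
  rewrite Gauss_dvdr // => /dvdn_leq; lia.
move=> xR xR' e; have [le|/ltnW le] := leqP x x'; first by apply: main; rewrite ?le.
by symmetry; apply: main; rewrite ?le.
Qed.

Lemma res_lt x : (res x < m)%N.
Proof. exact: ltn_pmod. Qed.

Local Notation p := (rtilde r).
Local Notation nu := (@nu_of K r s diagram).
Local Notation V := (tbox nu).

Definition pos (j : 'I_p) : nat := tnth (hgap_order r s) j.

Lemma pos_leR j : (pos j <= R)%N.
Proof. by have := ltn_ord (tnth (hgap_order r s) j); rewrite [X in (_ < X)%N]rtildeE. Qed.

Lemma pos_inj : injective pos.
Proof.
move=> i j /val_inj; apply: (tuple_uniqP _ _).
by rewrite sort_uniq; have := enum_uniq ('I_p : finType); rewrite -val_ord_tuple.
Qed.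

Lemma pos_surj x : (x <= R)%N -> exists j, pos j = x.
Proof.
move=> xR; have xp : (x < p)%N by rewrite rtildeE.
have : Ordinal xp \in hgap_order r s by rewrite mem_sort; apply/tnthP; exists (Ordinal xp); rewrite tnth_ord_tuple.
by case/tnthP => j e; exists j; rewrite /pos -e.
Qed.

Lemma pos_lt (i j : 'I_p) : (i < j)%N = (res (pos i) < res (pos j))%N.
Proof.
have m0 : (0 : K) < m%:R by rewrite ltr0n.
have srt : sorted (fun i j : 'I_p => hgap r s i.+1 <= hgap r s j.+1) (hgap_order r s).
  by apply: sort_sorted => a b; apply: le_total.
have mono (a b : 'I_p) : (a <= b)%N -> (res (pos a) <= res (pos b))%N.
  move=> ab; suff : hgap r s (pos a).+1 <= hgap r s (pos b).+1.
    rewrite !hgapE ?pos_leR // lerD2r ler_pM2r ?invr_gt0 // ler_nat //.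
  rewrite /pos !(tnth_nth a).
  apply: (sorted_leq_nth (leT := fun i j : 'I_p => hgap r s i.+1 <= hgap r s j.+1)) => //.
  - by move=> ? ? ?; apply: le_trans.
  - by rewrite inE size_tuple; apply: ltn_ord.
  - by rewrite inE size_tuple; apply: ltn_ord.
apply/idP/idP => [ij|].
  rewrite ltn_neqAle mono ?(ltnW ij) // andbT; apply/eqP => e.
  have := pos_inj (res_inj (pos_leR i) (pos_leR j) e) => eij.
  by rewrite eij ltnn in ij.
by rewrite !ltnNge; apply: contra; apply: mono.
Qed.

Lemma cornerP (u : V) (x := pos (tcomp u)) : [/\ (tcorner u).2 = 1%N,
  (tcol x - col x < (tcorner u).1)%N & ((tcorner u).1 <= tcol x - col x.+1)%N].
Proof.
have : tcorner u \in nu (tcomp u) by rewrite /tcorner; exact: (valP (tagged u)).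
by rewrite /nu_of gammaP => /and3P[/eqP ? ? ?].
Qed.

(* A box of the component indexed by column x corresponds to a row of length x;
   boxes of a skew row from left to right are rows from top to bottom. *)
Definition rowof (u : V) : nat := (tcol (pos (tcomp u)) - (tcorner u).1).+1.

Lemma rowofP (u : V) : (rowof u <= N)%N /\ lam (rowof u) = pos (tcomp u).
Proof.
have [_ h1 h2] := cornerP u; rewrite /rowof; set x := pos _ in h1 h2 *.
set a := (tcorner u).1 in h1 h2 *; set y := (tcol x - a).+1.
have y1 : (y <= col x)%N by rewrite /y; lia.
have y2 : (col x.+1 < y)%N by rewrite /y; lia.
have yN : (y <= N)%N by apply: leq_trans y1 (col_leN x).
split=> //; apply/eqP; rewrite eqn_leq; apply/andP; split.
  by rewrite leqNgt -(col_le m_gt0 n_gt0 lam_fits) // -ltnNge.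
by case: (posnP x) => [-> //|x0]; rewrite -(col_le m_gt0 n_gt0 lam_fits).
Qed.

(** Compare with the content x - 1 + j eps: after scaling by m, the residue plays the part of the
    shift j eps, both increasing with the component. *)
Lemma gen_rowof (u : V) :
  gen (rowof u) = (n + m * (tcorner u).1 + res (pos (tcomp u)))%N%:Z.
Proof.
have [_ e] := rowofP u; rewrite /row_label e /box_label /rowof.
have [_ h1 h2] := cornerP u; have := pos_leR (tcomp u); set x := pos _ in h1 h2 *.
rewrite leq_divRL // => xR.
have := divn_eq (l - n * x) m; rewrite -/(res x) -/(tcol x).
have : ((tcorner u).1 <= tcol x)%N by lia.
set a := (tcorner u).1; move=> aT E.
have -> : (m * (tcol x - a).+1 = m * tcol x - m * a + m)%N by rewrite mulnS mulnBr; lia.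
have : (m * a <= m * tcol x)%N by rewrite leq_mul2l aT orbT.
by move: E; rewrite (mulnC _ m); lia.
Qed.

Definition row_index (u : V) : 'I_N := Ordinal (rowofP u).1.

Lemma row_index_bij : bijective row_index.
Proof.
have inj : injective row_index.
  move=> u v /(congr1 val) /= [e].
  have e' : rowof u = rowof v by rewrite /rowof e.
  have ej : tcomp u = tcomp v.
    by apply: pos_inj; rewrite -(rowofP u).2 -(rowofP v).2 e'.
  have := gen_rowof u; rewrite e' gen_rowof ej => E.
  have e1 : (tcorner u).1 = (tcorner v).1.
    have : (m * (tcorner u).1 = m * (tcorner v).1)%N by lia.
    by move/eqP; rewrite eqn_mul2l; case: eqP m_gt0 => [->|_ _ /eqP].
  have e2 : tcorner u = tcorner v.
    have [a _ _] := cornerP u; have [b _ _] := cornerP v.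
    by move: a b e1; case: (tcorner u) => ? ?; case: (tcorner v) => ? ? /= -> -> ->.
  case: u v {e e' E e1} ej e2 => [j a] [j' b] /= ej; subst j' => e2.
  by congr existT; apply: val_inj.
have surj (i : 'I_N) : exists u, row_index u == i.
  have xR : (lam i.+1 <= R)%N by apply: (lam_leR m_gt0 n_gt0 lam_fits).
  have [j ej] := pos_surj xR; set x := lam i.+1 in xR ej.
  have iN := ltn_ord i.
  have y1 : (i.+1 <= col x)%N.
    by case: (posnP x) => [->|x0]; rewrite ?col0 // (col_le m_gt0 n_gt0 lam_fits).
  have y2 : (col x.+1 < i.+1)%N.
    by rewrite ltnNge (col_le m_gt0 n_gt0 lam_fits) // -ltnNge.
  have y3 : (i.+1 <= tcol x)%N.
    rewrite /tcol; case: (posnP x) => [->|x0]; first by rewrite muln0 subn0.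
    have [_ /(_ i.+1 isT x0)] := lam_fits; rewrite leq_divRL // -/x; lia.
  (* Inverts [rowof]: row [i.+1] of length x corresponds to the abscissa [tcol x - i]. *)
  have b_in : ((tcol x - i)%N, 1%N) \in nu j.
    by rewrite /nu_of gammaP -/(pos j) ej; apply/and3P; split=> //=; lia.
  exists (existT (fun j => nu j) j [` b_in]%fset : V).
  apply/eqP/val_inj; rewrite /= /tcorner /tcomp /= ej; lia.
exists (fun i => xchoose (surj i)) => [u|i]; last exact/eqP/(xchooseP (surj i)).
by apply: inj; apply/eqP/(xchooseP (surj (row_index u))).
Qed.

Definition label (u : V) : int := gen (row_index u).+1.

Lemma labelE u : label u = (n + m * (tcorner u).1 + res (pos (tcomp u)))%N%:Z.
Proof. exact: gen_rowof. Qed.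

Variable eps : K.
Hypotheses (eps_gt0 : 0 < eps) (eps_small : (rtilde r)%:R * eps < 1).

Lemma contentB (u v : V) : content eps v - content eps u =
  ((tcorner v).1%:R - (tcorner u).1%:R) + ((tcomp v)%:R - (tcomp u)%:R) * eps.
Proof.
rewrite /content; have [-> _ _] := cornerP u; have [-> _ _] := cornerP v.
rewrite -!(natr1 (tcomp _)); ring.
Qed.

Lemma attack_label (u v : V) :
  attacking eps u v && (content eps u < content eps v) = (0 < label v - label u < m%:Z).
Proof.
have -> : attacking eps u v && (content eps u < content eps v) =
    (0 < content eps v - content eps u < 1).
  rewrite /attacking distrC subr_gt0; case: (ltP (content eps u)) => h; last by rewrite andbF.
  by rewrite andbT gtr0_norm ?subr_gt0 // h.
rewrite contentB !labelE.
set j := tcomp v; set i := tcomp u; set a := (tcorner u).1; set b := (tcorner v).1.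
have si : (i : nat)%:R * eps < 1.
  by apply: lt_trans eps_small; rewrite ltr_pM2r // ltr_nat.
have sj : (j : nat)%:R * eps < 1.
  by apply: lt_trans eps_small; rewrite ltr_pM2r // ltr_nat.
have i0 : 0 <= (i : nat)%:R * eps by rewrite mulr_ge0 // ltW.
have j0 : 0 <= (j : nat)%:R * eps by rewrite mulr_ge0 // ltW.
have cij : (0 < ((j : nat)%:R - (i : nat)%:R) * eps) = (res (pos i) < res (pos j))%N.
  by rewrite pmulr_lgt0 // subr_gt0 ltr_nat pos_lt.
have cji : (((j : nat)%:R - (i : nat)%:R) * eps < 0) = (res (pos j) < res (pos i))%N.
  by rewrite pmulr_llt0 // subr_lt0 ltr_nat pos_lt.
have ri := res_lt (pos i); have rj := res_lt (pos j).
set e := (_ - _) * eps in cij cji *.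
(* The bound on eps keeps the shifts of two components less than 1 apart. *)
have e1 : -1 < e < 1 by rewrite /e mulrBl; lra.
rewrite label_window //; case: (ltngtP a b) => [ab|ba|->].
- have [->|nab] := eqVneq b a.+1.
    by rewrite /= -cji -natr1; apply/idP/idP => h; lra.
  have : (a%:R + 2 <= b%:R :> K) by rewrite -natrD ler_nat addn2 ltn_neqAle eq_sym nab.
  by move=> hK; rewrite [LHS](_ : _ = false) //; apply/negbTE/negP => /andP[_ h]; lra.
- have : (b%:R + 1 <= a%:R :> K) by rewrite natr1 ler_nat.
  move=> hK; rewrite [LHS](_ : _ = false); last by apply/negbTE/negP => /andP[h _]; lra.
  by symmetry; apply/negbTE; move: ba; clear; lia.
by rewrite subrr add0r cij /=; have /andP[_ ->] := e1; rewrite andbT; move: (_ < _)%N; clear; lia.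
Qed.

Lemma label_adjacent (u v : V) : label v - label u = m%:Z <->
  tcomp u = tcomp v /\ (tcorner v).1 = (tcorner u).1.+1.
Proof.
rewrite !labelE; have ri := res_lt (pos (tcomp u)); have rj := res_lt (pos (tcomp v)).
split=> [e|[-> ->]]; last by lia.
have er : res (pos (tcomp u)) = res (pos (tcomp v)).
  move: e ri rj; move: (res _) (res _) (tcorner u).1 (tcorner v).1 => x y a b; clear -m_gt0.
  case: (ltngtP b a) => [h|h|-> ]; try by lia.
    by have : (m * b.+1 <= m * a)%N; [rewrite leq_mul2l h orbT | rewrite mulnS; lia].
  case: (eqVneq b a.+1) => [->|nab]; first by rewrite mulnS; lia.
  have : (m * a.+2 <= m * b)%N by rewrite leq_mul2l; lia.
  by rewrite !mulnS; lia.
have := pos_inj (res_inj (pos_leR _) (pos_leR _) er) => ej; split=> //.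
have : (m * (tcorner v).1 = m * (tcorner u).1.+1)%N by move: e; rewrite ej mulnS; clear; lia.
by move/eqP; rewrite eqn_pmul2l // => /eqP.
Qed.

(** Each component is a single row, so the column condition is vacuous and the row condition follows
    from adjacent boxes. *)
Lemma semistandard_label (T : {ffun V -> nat}) :
  semistandard T <-> forall u v, label v - label u = m%:Z -> (T u <= T v)%N.
Proof.
split=> [ss u v /label_adjacent[ej ea]|h u v ej].
  have [h _] := ss u v ej; apply: h; last by rewrite ea.
  by have [-> _ _] := cornerP u; have [-> _ _] := cornerP v.
have [u2 ul ur] := cornerP u; have [v2 vl vr] := cornerP v.
split=> [_|_]; last by rewrite u2 v2.
case: u v ej u2 ul ur v2 vl vr => [j a] [j' b] /= ej; subst j'.
rewrite /tcorner /tcomp /=; set x := pos j => a2 al ar b2 bl br.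
(* Induction on the distance to b, through the boxes in between, which all belong to the skew
   row. *)
have key (k c : nat) (cP : (c, 1%N) \in nu j) : (c <= (fsval b).1)%N -> ((fsval b).1 - c = k)%N ->
    (T (existT (fun j => nu j) j [` cP]%fset : V) <= T (existT (fun j => nu j) j b : V))%N.
  elim: k c cP => [|k IH] c cP cb ck.
    have e : [` cP]%fset = b.
      by apply: val_inj => /=; move: b2 cb ck; case: (fsval b) => /= ? ? -> ? ?; congr (_, _); lia.
    by rewrite e.
  have cP' : (c.+1, 1%N) \in nu j.
    move: cP; rewrite /nu_of !gammaP -/(pos j) -/x /= => /andP[h1 _].
    by apply/andP; split; [exact: leqW | apply: leq_trans br; rewrite -subn_gt0 ck].
  have := h (existT (fun j => nu j) j [` cP]%fset : V) (existT (fun j => nu j) j [` cP']%fset : V).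
  rewrite label_adjacent => /(_ (conj erefl erefl)) le1.
  apply: leq_trans le1 (IH _ _ _ _); first by rewrite -subn_gt0 ck.
  by rewrite subnS ck.
move=> ab; have aP : ((fsval a).1, 1%N) \in nu j.
  by have := valP a; rewrite /= -a2 -surjective_pairing.
have ea : [` aP]%fset = a by apply: val_inj => /=; move: a2; case: (fsval a) => ? ? /= ->.
by have := key _ _ aP ab erefl; rewrite ea.
Qed.

Theorem LLT_diagram (F : fieldType) (t : F) M : represents (LLT eps nu t)
  (colsum_weak (@lt_rel M) (fun i => 'X_i : {mpoly F[M]}) t
    (fun i j : 'I_N => 0 < gen j.+1 - gen i.+1 < m%:Z)
    (fun i j : 'I_N => gen j.+1 - gen i.+1 == m%:Z)).
Proof.
rewrite (colsum_weak_bij _ _ _ _ _ row_index_bij).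
apply: LLT_represents => [u v|T]; first exact: attack_label.
by rewrite semistandard_label; split=> h u v => [/eqP|/eqP] /h.
Qed.

End SkewRowsOfDiagram.

Lemma card_tau_mnl m n l lam : (0 < m)%N -> (0 < n)%N -> coprime m n -> (l < m * n)%N ->
  fits m n l lam ->
  Defs.card (tau_mnl m n l) = (Defs.card (diagram lam) + area' m n (Delta m n l lam))%N.
Proof.
move=> m0 n0 co ln Hf; apply/eqP; rewrite -eqz_nat PoszD (card_diagram m0 n0 co ln Hf).
rewrite /area' (_ : [set k | _] = [set k | [/\ gaps (Delta m n l lam) k,
  n%:Z + m%:Z <= k & xpredT k]]); last first.
  by apply/seteqP; split=> k [h1 h2]; split.
rewrite (card_gaps m0 n0 co ln Hf) Posz_sum2 -big_split.
rewrite (@card_pairs _ _ (fun x y => (x, y)) (fun x y => (n * x + m * y <= l)%N)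
  (l %/ n) (l %/ m)) ?Posz_sum2.
- apply/eqP; apply: eq_big_nat => y /andP[y0 _]; rewrite -big_split; apply: eq_big_nat => x /andP[x0 _] /=.
  have [_ /(_ y y0)] := Hf; rewrite /box_label andbT; case: (leqP x (lam y)) => /= xy h.
    by rewrite (_ : (_ <= l)%N); [|have := h (leq_trans x0 xy); nia].
  by rewrite add0r; congr (nat_of_bool _)%:Z; lia.
- by move=> ? ? ? ? _ _ _ _ [-> ->].
move=> [x y]; split=> [[/= x0 y0 h]|[x' [y' [xr yr h [-> ->]]]]]; last by split=> //=; lia.
by exists x, y; split=> //; rewrite ?x0 ?y0 leq_divRL //; nia.
Qed.

(** * The identity over a general coefficient field *)

Section Assembly.
Variables (R : realType) (K : fieldType) (q t : K) (m n : nat) (z r s eps : R).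
Hypotheses (two_neq0 : 2%:R != 0 :> K) (t_neq0 : t != 0) (tN1 : t + 1 != 0) (t1 : t - 1 != 0).
Hypotheses (m_gt0 : (0 < m)%N) (n_gt0 : (0 < n)%N) (co_mn : coprime m n).
Hypotheses (z_ge1 : 1 <= z) (z_lt : z < (m * n)%:R).
Hypotheses (def_r : r = z / n%:R) (def_s : s = z / m%:R).
Hypothesis rows_tau : (column_length (tau r s) 1 < Num.truncn s)%N.
Hypotheses (eps_gt0 : 0 < eps) (eps_small : (rtilde r)%:R * eps < 1).

Let l := Num.truncn z.

Let l_lt : (l < m * n)%N.
Proof.
have z0 : 0 <= z by apply: le_trans z_ge1.
by rewrite -(ltr_nat R); apply: le_lt_trans z_lt; have /andP[] := truncn_itv z0.
Qed.

Lemma dinv_exponent lam : fits m n l lam ->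
  q ^+ area r s (diagram lam) * t ^+ dinv r s (diagram lam) =
  t ^+ Defs.card (tau_mnl m n l) * (q ^+ area' m n (Delta m n l lam) *
     t ^ (- codinv' m n (Delta m n l lam))).
Proof.
move=> Hf; have ct := card_tau_mnl m_gt0 n_gt0 co_mn l_lt Hf.
have dc := dinv_codinv m_gt0 n_gt0 co_mn l_lt Hf
  (s_over_r m_gt0 n_gt0 z_ge1 def_r def_s).
rewrite /area (tauE z_ge1 (erefl l) def_r def_s) ct addKn mulrCA; congr (_ * _).
rewrite [X in X * _](_ : _ = t ^ (Defs.card (tau_mnl m n l))%:Z); last by rewrite ct.
rewrite -expfzDr // ct -[LHS]/(t ^ (dinv r s (diagram lam))%:Z); congr (_ ^ _).
by move: dc; rewrite PoszD; lia.
Qed.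

Lemma Schroeder_hall : Schroeder m n l q t =
  \sum_(k \in [set: nat])
    (hall (Hfun r s eps q t) (smul (hsf K k) (esf K ((Num.truncn s)%:Z - k%:Z))))%:P * 'X^k.
Proof.
have sN : Num.truncn s = (l %/ m)%N by exact: (truncn_s m_gt0 z_ge1 (erefl l) def_s).
(* [rows_tau] says that floor((l - n) / m) < N, which places the box (1, N) outside tau. *)
have top : (0 < l %/ m)%N /\ (l < n + m * (l %/ m))%N.
  move: rows_tau; rewrite sN (column_length_tau m_gt0 n_gt0 co_mn l_lt z_ge1 (erefl l) def_r def_s) // /tcol muln1.
  move=> lt; split; first by lia.
  by move: lt; rewrite ltn_divLR //; lia.
pose lamof (L : set box) := xget (fun=> 0%N) [set lam | fits m n l lam /\ L = diagram lam].
have lamP L : Dyck r s L -> fits m n l (lamof L) /\ L = diagram (lamof L).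
  move=> /(DyckP m_gt0 n_gt0 co_mn l_lt z_ge1 (erefl l) def_r def_s)[lam Hf e].
  by apply: (@xgetPex _ _ [set lam | fits m n l lam /\ L = diagram lam]); exists lam.
pose E (L : set box) (i j : 'I_(l %/ m)) :=
  0 < row_label m n l (lamof L) j.+1 - row_label m n l (lamof L) i.+1 < m%:Z.
pose W (L : set box) (i j : 'I_(l %/ m)) :=
  row_label m n l (lamof L) j.+1 - row_label m n l (lamof L) i.+1 == m%:Z.
(* The LLT parameter is t^-1, so the expansion divides by 1 + t^-1 and 1 - t^-1. *)
have tV1 : 1 + t^-1 != 0 by rewrite -(mulfV t_neq0) -{2}[t^-1]mul1r -mulrDl mulf_neq0 ?invr_eq0.
have tV2 : 1 - t^-1 != 0 by rewrite -(mulfV t_neq0) -{2}[t^-1]mul1r -mulrBl mulf_neq0 ?invr_eq0.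
rewrite /Hfun sN (@hall_generating K _ (Dyck r s)
  (fun L => q ^+ area r s L * t ^+ dinv r s L) _
  (fun L B A gt wt => colsum_weak gt wt t^-1 (E L) (W L)) (l %/ m)); first last.
- move=> L M /lamP[Hf e]; rewrite {1}e.
  exact: (LLT_diagram m_gt0 n_gt0 co_mn l_lt Hf z_ge1 (erefl l) def_r def_s eps_gt0 eps_small).
- move=> L /lamP[Hf _]; rewrite -[X in expands X](card_ord (l %/ m)).
  apply: (expands_labelled two_neq0 tV1 tV2 (g := fun i : 'I_(l %/ m) => row_label m n l (lamof L) i.+1)) => //.
  move=> i j /(gen_inj m_gt0 n_gt0 co_mn l_lt Hf) h; apply: val_inj.
  by apply: succn_inj; apply: h.
- exact: (finite_Dyck m_gt0 n_gt0 co_mn l_lt z_ge1 (erefl l) def_r def_s).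
rewrite /Schroeder mulr_fsumr.
rewrite (reindex_fsbig _ _ _ _ (DeltaS_bij m_gt0 n_gt0 co_mn l_lt z_ge1 (erefl l) def_r def_s)).
apply: eq_fsbigr => L; rewrite inE => /lamP[Hf e]; rewrite colsum_weak_super.
have wL := dinv_exponent Hf; rewrite -e in wL; rewrite wL.
have -> : DeltaS m n l L = Delta m n l (lamof L) by rewrite {1}e DeltaS_diagram.
rewrite [in RHS]polyCM -[RHS]mulrA; congr (_ * (_ * _)).
by rewrite (cogen_prod m_gt0 n_gt0 co_mn l_lt Hf top.1 top.2).
Qed.

End Assembly.

Lemma Qqt_neq0 (p : {poly {poly rat}}) : p != 0 -> tofrac p != 0 :> Qqt.
Proof. by rewrite tofrac_eq0. Qed.

Theorem theorem5 (R : realType) (m n : nat) (z r s eps : R)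
    (m_gt0 : (0 < m)%N) (n_gt0 : (0 < n)%N) (coprime_mn : coprime m n)
    (z_ge1 : 1 <= z) (z_lt : z < (m * n)%:R)
    (def_r : r = z / n%:R) (def_s : s = z / m%:R)
    (rows_tau : (column_length (tau r s) 1 < Num.truncn s)%N)
    (eps_gt0 : 0 < eps) (eps_small : (rtilde r)%:R * eps < 1) :
  Schroeder m n (Num.truncn z) qvar tvar =
  \sum_(k \in [set: nat])
    (hall (Hfun r s eps qvar tvar)
          (smul (hsf Qqt k) (esf Qqt ((Num.truncn s)%:Z - k%:Z))))%:P * 'X^k.
Proof.
apply: Schroeder_hall => //.
- rewrite -(rmorph_nat (@tofrac {poly {poly rat}})) Qqt_neq0 //.
  by rewrite -!polyC_natr !polyC_eq0.
- by rewrite Qqt_neq0 // polyX_eq0.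
- rewrite -(rmorph1 (@tofrac {poly {poly rat}})) -rmorphD Qqt_neq0 //.
  by rewrite -[1]opprK -polyCN polyXsubC_eq0.
- rewrite -(rmorph1 (@tofrac {poly {poly rat}})) -rmorphB Qqt_neq0 //.
  by rewrite polyXsubC_eq0.
Qed.
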